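(* Let $N\ge 3$, let $B=B_1(0)\subset\mathbb{R}^N$ be the open unit ball, and let $\gamma\in\mathbb{R}$ satisfy $$\frac{(N-2)^2}{4}-4\le \gamma<\frac{(N-2)^2}{4}.$$ Then there exists $\epsilon_0>0$ such that for every $\epsilon\in(0,\epsilon_0)$ the problem $$-\Delta u-\gamma\frac{u}{|x|^2}-\epsilon u=|u|^{\frac{4}{N-2}}u\ \text{ in } B,\qquad u=0\ \text{ on }\partial B,$$ has no radial sign-changing solution $u\in H^1_0(B)$.
   Context: Solutions are weak solutions in $H^1_0(B)$, i.e. critical points of $u\mapsto \frac12\int_B|\nabla u|^2-\frac{\gamma}{2}\int_B\frac{u^2}{|x|^2}-\frac{\epsilon}{2}\int_B u^2-\frac{N-2}{2N}\int_B|u|^{\frac{2N}{N-2}}$ on $H^1_0(B)$. Sign-changing means that both the positive part and the negative part of $u$ are nontrivial. *)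

(* Defs.v *)
From HB Require Import structures.
From mathcomp Require Import all_boot all_order all_algebra.
From mathcomp Require Import all_classical all_reals all_analysis.

Set Implicit Arguments.
Unset Strict Implicit.
Unset Printing Implicit Defensive.

Import Order.TTheory GRing.Theory Num.Theory.
Import numFieldNormedType.Exports.

Local Open Scope classical_set_scope.
Local Open Scope ring_scope.

(* The product sigma-algebra on R^n, i.e. its Borel sigma-algebra; same
   construction as the library's instance on [n.-tuple T]. *)
Definition measure_rV_display : measure_display -> measure_display.
Proof. exact. Qed.

Section measurable_rV.
Variables (R : realType) (n : nat).

Let coors : 'I_n -> 'rV[R]_n -> R := fun i x => x ord0 i.

Let rV_set0 : g_sigma_preimage coors set0.
Proof. exact: sigma_algebra0. Qed.

Let rV_setC A : g_sigma_preimage coors A -> g_sigma_preimage coors (~` A).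
Proof. exact: sigma_algebraC. Qed.

Let rV_bigcup (F : (set 'rV[R]_n)^nat) :
  (forall i, g_sigma_preimage coors (F i)) ->
  g_sigma_preimage coors (\bigcup_i (F i)).
Proof. exact: sigma_algebra_bigcup. Qed.

HB.instance Definition _ :=
  @isMeasurable.Build (measure_rV_display default_measure_display)
    'rV[R]_n (g_sigma_preimage coors) rV_set0 rV_setC rV_bigcup.

End measurable_rV.

Lemma measurable_coord (R : realType) n (i : 'I_n) :
  measurable_fun [set: 'rV[R]_n] (fun x : 'rV[R]_n => x ord0 i).
Proof.
move=> _ Y mY; rewrite setTI; apply: sub_sigma_algebra => /=.
rewrite -bigcup_seq/=; exists i => /=; first by rewrite mem_index_enum.
by exists Y => //; rewrite setTI.
Qed.

Lemma measurable_fun_rV d (T : measurableType d) (R : realType) n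
    (f : T -> 'rV[R]_n) :
  (forall i, measurable_fun setT (fun t => f t ord0 i)) ->
  measurable_fun setT f.
Proof.
move=> mf.
have /= S : g_sigma_preimage (fun i t => f t ord0 i) `<=` measurable.
  apply: smallest_sub; first exact: sigma_algebra_measurable.
  case: n => [|n] in f mf *; first by rewrite big_ord0.
  rewrite -bigcup_mkord_ord; apply: bigcup_sub => i Ii.
  by move=> A [B mB <-]; exact: mf.
move=> _ A mA; apply: S.
rewrite (_ : (fun _ => _) = (fun i => (fun x : 'rV[R]_n => x ord0 i) \o f))//.
by rewrite g_sigma_preimage_comp; exists A.
Qed.

Section lebesgue_rV.
Variable R : realType.

Definition rV_cons n (p : measurableTypeR R * 'rV[R]_n) : 'rV[R]_n.+1 :=
  \row_i oapp (fun j => p.2 ord0 j) p.1 (unlift ord0 i).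

Definition rV_uncons n (x : 'rV[R]_n.+1) : measurableTypeR R * 'rV[R]_n :=
  (x ord0 ord0, \row_j x ord0 (lift ord0 j)).

Lemma rV_consK n : cancel (@rV_cons n) (@rV_uncons n).
Proof.
move=> [a x]; rewrite /rV_uncons mxE unlift_none/=; congr pair.
by apply/rowP => j; rewrite !mxE liftK.
Qed.

Lemma measurable_rV_cons n : measurable_fun setT (@rV_cons n).
Proof.
apply: measurable_fun_rV => i.
have [j ij|i0] := unliftP ord0 i.
  rewrite (_ : (fun _ => _) = (fun x : 'rV[R]_n => x ord0 j) \o snd).
    exact: measurableT_comp (@measurable_coord R n j) measurable_snd.
  by apply/funext => p; rewrite mxE ij liftK.
rewrite (_ : (fun _ => _) = fst); first exact: measurable_fst.
by apply/funext => p; rewrite mxE i0 unlift_none.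
Qed.

Lemma measurable_rV_uncons n : measurable_fun setT (@rV_uncons n).
Proof.
apply/measurable_fun_pairP; split; first exact: measurable_coord.
apply: measurable_fun_rV => i.
rewrite (_ : (fun _ => _) = fun x : 'rV[R]_n.+1 => x ord0 (lift ord0 i)).
  exact: measurable_coord.
by apply/funext => x /=; rewrite mxE.
Qed.

Section step.
Variables (n : nat) (m : {sigma_finite_measure set 'rV[R]_n -> \bar R}).

(* From a measure m on R^n, the product of the Lebesgue measure and m, carried
   to R^(n+1). *)
Definition lebesgue_rV_step : set 'rV[R]_n.+1 -> \bar R :=
  pushforward (lebesgue_measure \x m)%E (@rV_cons n).

Let measurable_preim A : measurable A -> measurable (@rV_cons n @^-1` A).
Proof. by move=> mA; rewrite -[X in measurable X]setTI; exact: measurable_rV_cons. Qed.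

Let step0 : lebesgue_rV_step set0 = 0%E.
Proof. by rewrite /lebesgue_rV_step /pushforward preimage_set0 measure0. Qed.

Let step_ge0 A : (0 <= lebesgue_rV_step A)%E.
Proof. by rewrite /lebesgue_rV_step /pushforward; apply: measure_ge0. Qed.

Let step_sigma_additive : semi_sigma_additive lebesgue_rV_step.
Proof.
move=> F mF tF mUF; rewrite /lebesgue_rV_step /pushforward preimage_bigcup.
apply: measure_semi_sigma_additive.
- by move=> i; exact: measurable_preim.
- apply/trivIsetP => /= i j _ _ ij; rewrite -preimage_setI.
  by move/trivIsetP : tF => /(_ _ _ _ _ ij) ->//; rewrite preimage_set0.
- by rewrite -preimage_bigcup; exact: measurable_preim.
Qed.

HB.instance Definition _ := isMeasure.Build _ _ _ lebesgue_rV_step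
  step0 step_ge0 step_sigma_additive.

Let step_sigma_finite : sigma_finite setT lebesgue_rV_step.
Proof.
have /sigma_finiteP[F [TF ndF Foo]] := sigma_finiteT (@lebesgue_measure R).
have /sigma_finiteP[G [TG ndG Goo]] := sigma_finiteT m.
exists (fun i => @rV_uncons n @^-1` (F i `*` G i)) => [|i].
  rewrite -preimage_bigcup (_ : \bigcup_i _ = setT) ?preimage_setT//.
  apply/seteqP; split => // -[x y] _.
  have [k _ Fkx] : (\bigcup_i F i) x by rewrite -TF.
  have [l _ Gly] : (\bigcup_i G i) y by rewrite -TG.
  exists (maxn k l) => //; split => /=.
    by move: x Fkx; exact/subsetPset/ndF/leq_maxl.
  by move: y Gly; exact/subsetPset/ndG/leq_maxr.
have [mF Fi] := Foo i; have [mG Gi] := Goo i; split.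
  by rewrite -[X in measurable X]setTI; apply: measurable_rV_uncons => //; exact: measurableX.
rewrite /lebesgue_rV_step /pushforward -comp_preimage.
rewrite (_ : _ \o _ = id) ?preimage_id; last exact/funext/rV_consK.
by rewrite product_measure1E// lte_mul_pinfty// ge0_fin_numE.
Qed.

HB.instance Definition _ := @Measure_isSigmaFinite.Build _ _ _
  lebesgue_rV_step step_sigma_finite.

End step.

Fixpoint lebesgue_rV n : {sigma_finite_measure set 'rV[R]_n -> \bar R} :=
  if n is k.+1 then lebesgue_rV_step (lebesgue_rV k) else \d_(0 : 'rV[R]_0).

End lebesgue_rV.

Section problem.
Variables (R : realType) (N : nat).
Implicit Types (x : 'rV[R]_N) (u v phi : 'rV[R]_N -> R)
  (Du Dv : 'rV[R]_N -> 'rV[R]_N).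

Local Notation leb := (lebesgue_rV R N).

(* The library norm `|x| on 'rV[R]_N is the sup norm, hence this one. *)
Definition sqnorm x : R := \sum_(i < N) x ord0 i ^+ 2.
Definition enorm x : R := Num.sqrt (sqnorm x).

Definition unit_ball : set 'rV[R]_N := [set x | enorm x < 1].

Definition partial (i : 'I_N) phi : 'rV[R]_N -> R :=
  fun x => 'D_(delta_mx ord0 i) phi x.

Definition grad phi : 'rV[R]_N -> 'rV[R]_N :=
  fun x => \row_i partial i phi x.

(* C^infinity: all iterated partial derivatives exist and are continuous. *)
Definition smooth phi :=
  forall s : seq 'I_N, let psi := foldr partial phi s in
    continuous psi /\
    forall (i : 'I_N) x, derivable psi x (delta_mx ord0 i).

(* phi \in C_c^infinity(B), extended by 0 to R^N, where B is unit_ball *)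
Definition test_function phi :=
  [/\ smooth phi, compact (closure [set x | phi x != 0]) &
      closure [set x | phi x != 0] `<=` unit_ball].

(* Elements of L^2(B) are represented by functions on R^N, of which only the
   values on B are used, and only up to null sets. *)
Definition L2 u :=
  measurable_fun unit_ball u /\
  (\int[leb]_(x in unit_ball) (u x ^+ 2)%:E < +oo)%E.

Definition weak_gradient u Du :=
  forall phi, test_function phi -> forall i : 'I_N,
    \int[leb]_(x in unit_ball) (u x * partial i phi x) =
    - \int[leb]_(x in unit_ball) (Du x ord0 i * phi x).

(* u \in H^1(B), with (a.e. unique) weak gradient Du *)
Definition H1 u Du :=
  [/\ L2 u, forall i : 'I_N, L2 (fun x => Du x ord0 i) & weak_gradient u Du].

(* the square of the H^1(B) norm *)
Definition H1_sqnorm u Du : \bar R :=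
  (\int[leb]_(x in unit_ball) (u x ^+ 2 + sqnorm (Du x))%:E)%E.

(* u \in H^1_0(B), the closure of C_c^infinity(B) in H^1(B), with weak
   gradient Du *)
Definition H10 u Du :=
  H1 u Du /\
  forall e : R, 0 < e -> exists2 phi, test_function phi &
    (H1_sqnorm (fun x => phi x - u x)%R (fun x => grad phi x - Du x)%R
       < (e ^+ 2)%:E)%E.

(* The energy functional; Du stands for the weak gradient of u. *)
Definition energy (gamma eps : R) u Du : R :=
  2^-1 * (\int[leb]_(x in unit_ball) sqnorm (Du x))
  - gamma / 2 * (\int[leb]_(x in unit_ball) (u x ^+ 2 / enorm x ^+ 2))
  - eps / 2 * (\int[leb]_(x in unit_ball) (u x ^+ 2))
  - (N%:R - 2) / (2 * N%:R)
    * (\int[leb]_(x in unit_ball) (`|u x| `^ (2 * N%:R / (N%:R - 2)))).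

(* u is a critical point of the energy on H^1_0(B): its derivative at u
   vanishes in every direction v of H^1_0(B). *)
Definition critical_point (gamma eps : R) u Du :=
  forall v Dv, H10 v Dv ->
    is_derive (0 : R) (1 : R)
      (fun t : R => energy gamma eps (fun x => u x + t * v x)
                                     (fun x => Du x + t *: Dv x)) (0 : R).

(* u \in H^1_0(B) is a weak solution of
     - Delta u - gamma u / |x|^2 - eps u = |u|^(4 / (N - 2)) u  in B,
     u = 0  on the boundary of B. *)
Definition weak_solution (gamma eps : R) u :=
  exists Du, H10 u Du /\ critical_point gamma eps u Du.

Definition radial u :=
  exists f : R -> R, {ae leb, forall x, unit_ball x -> u x = f (enorm x)}.

Definition sign_changing u :=
  ~ {ae leb, forall x, unit_ball x -> u^\+ x = 0} /\
  ~ {ae leb, forall x, unit_ball x -> u^\- x = 0}.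

End problem.

(* Main.v *)
Require Import Defs.
From HB Require Import structures.
From mathcomp Require Import all_boot all_order all_algebra.
From mathcomp Require Import all_classical all_reals all_analysis.
From mathcomp Require Import measurable_realfun.
From mathcomp Require Import ring lra.

Import Order.TTheory GRing.Theory Num.Theory.
Import numFieldNormedType.Exports.

Local Open Scope classical_set_scope.
Local Open Scope ring_scope.

Set Implicit Arguments.
Unset Strict Implicit.
Unset Printing Implicit Defensive.

(** A radial element [u] of H^1_0 of the ball is governed by a function of one
    variable, and the equation for that function has no sign-changing solution
    because a slow tail and a large oscillation cannot coexist.

    Reduction to one variable.  For [0 < s < 1] let [h s] be the integral of
    [x . Du x / |x|^N] over [s <= |x| < 1] ([flux]).  Integrating by parts
    against the fields [eta (|x|) x / |x|^N], which is possible without boundary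
    term because [u] vanishes on the sphere, shows that [u] equals, almost
    everywhere, [- h (|x|)] divided by the area of the sphere ([radial_flux]).
    By the Cauchy-Schwarz inequality the increments of [h] are controlled by the
    Dirichlet integral on annuli ([flux_sqr_le]); so the profile [f] of [u] tends
    to [0] at [1], and [s^(N-2) (f s)^2] tends to [0] at [0] ([flux_near1],
    [flux_near0]).  With the Hardy inequality ([hardy]) these bounds make the
    energy differentiable in the direction of radial test functions
    ([euler_lagrange]); such tests say that the flux increments are integrals of
    the mass of [gamma f / r^2 + eps f + |f|^q f] in balls, where [q = 4/(N-2)]
    ([flux_increment]).  This identity bootstraps to the differential equation
    of the profile ([radial_solution_profile]).

    The Emden-Fowler equation.  With [k = (N-2)/2] and
    [w t = exp (- k t) f (exp (- t))] the equation becomes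
    [w'' = (mu^2 - eps exp (- 2 t) - |w|^q) w] on [t > 0], where
    [mu^2 = k^2 - gamma] lies in (0, 4], and [w] tends to [0] at both ends
    ([emden_fowler_transform]).  Its energy [E] decreases, with derivative
    [- eps exp (- 2 t) w^2], and has limit [0], so it is non-negative.

    If [w] changes sign, it has a last zero [T] ([late_zero]); let [a > 0] be its
    slope there, assuming [w > 0] afterwards.  After [T] the function is at most
    [M], where [M^q = (q + 2) mu^2] does not depend on [eps].  The energy
    [a^2/2] at [T] is lost entirely to the damping, of weight
    [eps exp (- 2 t)]; since [mu <= 2] this weight is at most
    [eps exp (- 2 T) exp (- mu (t - T))], and a virial identity bounds the
    integral of [exp (- mu (t - T)) w^2] over [t > T] by a multiple of [M a].
    Hence [a <= 4 M eps exp (- 2 T) / mu^2] ([slope_le]): the slope is tiny when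
    [eps] is.

    Before [T], on the other hand, [w] has a last critical point; there
    [E >= 0] forces the amplitude [m] to satisfy [m^q >= (q + 2) mu^2 / 4], while
    the growth of the linearised equation allows at most [mu m <= a exp (mu T)]
    ([amplitude]).  Together, and again because [mu <= 2], these give
    [eps >= mu^3 4^(-1/q) / 4] ([ef_eps_large]), which is false for small
    [eps]. *)

(** * Differentiation rules *)

Lemma derD (R : realType) (f g : R -> R) (x a b : R) :
  is_derive x 1 f a -> is_derive x 1 g b ->
  is_derive x 1 (fun y => f y + g y) (a + b).
Proof. by move=> df dg; exact: is_deriveD. Qed.

Lemma derN (R : realType) (f : R -> R) (x a : R) :
  is_derive x 1 f a -> is_derive x 1 (fun y => - f y) (- a).
Proof. by move=> df; exact: is_deriveN. Qed.

Lemma derB (R : realType) (f g : R -> R) (x a b : R) :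
  is_derive x 1 f a -> is_derive x 1 g b ->
  is_derive x 1 (fun y => f y - g y) (a - b).
Proof. by move=> df dg; exact: is_deriveB. Qed.

Lemma derM (R : realType) (f g : R -> R) (x a b : R) :
  is_derive x 1 f a -> is_derive x 1 g b ->
  is_derive x 1 (fun y => f y * g y) (a * g x + f x * b).
Proof.
move=> df dg; apply: is_derive_eq (is_deriveM df dg) _.
by rewrite addrC mulrC.
Qed.

Lemma derZ (R : realType) (f : R -> R) (k x a : R) :
  is_derive x 1 f a -> is_derive x 1 (fun y => k * f y) (k * a).
Proof. by move=> df; exact: (is_deriveZ k df). Qed.

Lemma derX (R : realType) (f : R -> R) n (x a : R) :
  is_derive x 1 f a -> is_derive x 1 (fun y => f y ^+ n) (n%:R * f x ^+ n.-1 * a).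
Proof.
move=> df; have := is_deriveX n df.
by congr (is_derive _ _ _ _); apply/funext => y; rewrite fctE.
Qed.

Lemma derV (R : realType) (f : R -> R) (x a : R) :
  f x != 0 -> is_derive x 1 f a ->
  is_derive x 1 (fun y => (f y)^-1) (- a / f x ^+ 2).
Proof.
move=> fx df; apply: is_derive_eq (is_deriveV fx df) _.
by rewrite /GRing.scale/= mulNr mulrC -mulNr.
Qed.

Lemma der_id (R : realType) (x : R) : is_derive x 1 (fun y => y) 1.
Proof. exact: is_derive_id. Qed.

Lemma der_cst (R : realType) (c x : R) : is_derive x 1 (fun=> c) 0.
Proof. exact: is_derive_cst. Qed.

Lemma der_comp (R : realType) (f g : R -> R) (x a b : R) :
  is_derive (g x) 1 f a -> is_derive x 1 g b ->
  is_derive x 1 (fun y => f (g y)) (a * b).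
Proof. by move=> df dg; exact: is_derive1_comp. Qed.

Lemma der_exp (R : realType) (f : R -> R) (x a : R) :
  is_derive x 1 f a -> is_derive x 1 (fun y => expR (f y)) (expR (f x) * a).
Proof. by move=> df; apply: (der_comp (is_derive_expR _) df). Qed.

Lemma der_cvg (R : realType) (f : R -> R) (x a : R) :
  is_derive x 1 f a -> {for x, continuous f}.
Proof.
move=> df; apply/differentiable_continuous/derivable1_diffP.
exact: (@ex_derive _ _ _ _ _ _ _ df).
Qed.

(** * Measurability and affine changes of variables in R^n *)

Lemma measurable_set_lt d (T : measurableType d) (R : realType) (f : T -> R) r :
  measurable_fun setT f -> measurable [set x | f x < r].
Proof.
move=> mf; rewrite (_ : [set x | _] = setT `&` f @^-1` `]-oo, r[).
  exact: mf.
by rewrite setTI; apply/seteqP; split => x /=; rewrite in_itv.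
Qed.

(** The Borel sets of R^n are generated by countably many boxes: an open set
    is the union of the boxes with rational centre and radius [1/(k+1)] that
    it contains. *)
Lemma open_measurable_rV (R : realType) n (A : set 'rV[R]_n) :
  open A -> measurable A.
Proof.
move=> oA.
(* The radius is the inverse of a successor, so that boxes form a countable
   family. *)
pose box (p : 'rV[rat]_n * nat) : set 'rV[R]_n :=
  [set x | forall i, `|ratr (p.1 ord0 i) - x ord0 i| < p.2.+1%:R^-1].
have mbox p : measurable (box p).
  rewrite (_ : box p = \big[setI/setT]_(i < n)
    [set x : 'rV[R]_n | `|ratr (p.1 ord0 i) - x ord0 i| < p.2.+1%:R^-1]).
    apply: bigsetI_measurable => i _.
    apply: measurable_set_lt.
    apply: measurableT_comp => //; apply: measurable_funB => //.
    exact: measurable_coord.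
  rewrite -bigcap_seq; apply/seteqP; split => [x xb i _|x xb i]; first exact: xb.
  by apply: xb => /=; rewrite mem_index_enum.
rewrite (_ : A = \bigcup_(p in [set p | box p `<=` A]) box p).
  rewrite bigcup_mkcond; apply: countable_bigcupT_measurable => // p.
  by case: ifP => _ //; exact: mbox.
apply/seteqP; split => [x Ax|x [p /= +]]; last exact.
have [e e0 eA] : exists2 e : R, 0 < e & ball x e `<=` A.
  have /nbhs_ballP[e /= e0 eA] : nbhs x A by exact: open_nbhs_nbhs.
  by exists e.
have [k ke] : exists k : nat, k.+1%:R^-1 < e / 2.
  have e20 : 0 < e / 2 by rewrite divr_gt0.
  have [k _ kP] := near_infty_natSinv_lt (PosNum e20).
  by exists k; exact: (kP k (leqnn _)).
have /choice[q qP] (i : 'I_n) :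
    exists q : rat, `|ratr q - x ord0 i| < k.+1%:R^-1.
  have : x ord0 i - k.+1%:R^-1 < x ord0 i + k.+1%:R^-1.
    by rewrite ltrD2l gtrN.
  move=> /rat_in_itvoo[q]; rewrite in_itv/= => /andP[q1 q2].
  by exists q; rewrite ltr_distl q1.
exists (\row_i q i, k); last by move=> i /=; rewrite mxE.
move=> z zb; apply: eA; split => // i j; rewrite (ord1 i).
have := zb j; have := qP j; rewrite /= mxE => h1 h2.
rewrite /ball/= (le_lt_trans (ler_distD (ratr (q j)) _ _))//.
by rewrite (splitr e) (ltrD (lt_trans _ ke) (lt_trans _ ke))// distrC.
Qed.

Lemma continuous_measurable_rV (R : realType) n (f : 'rV[R]_n -> R) :
  continuous f -> measurable_fun setT f.
Proof.
move=> /continuousP cf; apply: (measurability _ (RGenOpens.measurableE R)).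
move=> _ [_ [a [b ->] <-]]; rewrite setTI.
have oab : open (`]a, b[%classic : set R) by exact: interval_open.
apply: open_measurable_rV; exact: (cf _ oab).
Qed.

Lemma measurable_sqnorm (R : realType) n :
  measurable_fun setT (@sqnorm R n).
Proof.
apply: measurable_sum => i; apply: measurable_funX; exact: measurable_coord.
Qed.

Lemma measurable_enorm (R : realType) n :
  measurable_fun setT (@enorm R n).
Proof.
apply: measurableT_comp; last exact: measurable_sqnorm.
by apply: continuous_measurable_fun; exact: sqrt_continuous.
Qed.

Lemma measurable_unit_ball (R : realType) n : measurable (@unit_ball R n).
Proof.
exact: measurable_set_lt (@measurable_enorm R n).
Qed.

(** The form of Tonelli's theorem that starts every induction on the
    dimension. *)
Lemma ge0_integral_lebesgue_rVS (R : realType) n (g : 'rV[R]_n.+1 -> \bar R) :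
  measurable_fun setT g -> (forall x, 0 <= g x)%E ->
  (\int[lebesgue_rV R n.+1]_x g x =
   \int[lebesgue_measure]_a \int[lebesgue_rV R n]_x g (rV_cons (a, x)))%E.
Proof.
move=> mg g0.
pose phim : {mfun _ >-> _} := HB.pack (@rV_cons R n)
  (isMeasurableFun.Build _ _ _ _ _ (@measurable_rV_cons R n)).
transitivity (\int[pushforward (lebesgue_measure \x lebesgue_rV R n)%E
    phim]_x g x)%E.
  exact: (@eq_measure_integral _ _ _ setT
    (pushforward (lebesgue_measure \x lebesgue_rV R n)%E phim)).
rewrite (ge0_integral_pushforward (@measurable_rV_cons R n))//.
rewrite preimage_setT (fubini_tonelli1 (g \o @rV_cons R n))//.
  by apply: measurableT_comp => //; exact: measurable_rV_cons.
by move=> x /=; exact: g0.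
Qed.

(** The Lebesgue measure is a multiple of its image under the affine map,
    since both are known on intervals. *)
Lemma ge0_integral_affine1 (R : realType) (c y : R) (g : R -> \bar R) :
  0 < c -> measurable_fun setT g -> (forall x, 0 <= g x)%E ->
  (\int[lebesgue_measure]_x g (c * x + y)%R =
   (c^-1)%:E * \int[lebesgue_measure]_x g x)%E.
Proof.
move=> c0 mg g0.
pose phi := (fun x => c * x + y : measurableTypeR R) : measurableTypeR R -> _.
have mphi : measurable_fun setT phi.
  by apply: measurable_funD => //; exact: measurable_funM.
pose pm : {measure set (measurableTypeR R) -> \bar R} :=
  measure_function_pushforward__canonical__measure_function_Measure
    lebesgue_measure mphi.
have cK : c != 0 by rewrite gt_eqF.
pose m := mscale (NngNum (ltW c0)) pm.
have mE A : measurable A -> lebesgue_measure A = m A.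
  apply: lebesgue_measure_unique => X /= [[a b]] _ <-.
  rewrite /m/= /mscale/= /pushforward.
  rewrite (_ : phi @^-1` _ = `](a - y) / c, (b - y) / c]%classic); last first.
    apply/seteqP; split => x /=; rewrite !in_itv/= ler_pdivlMr// ltr_pdivrMr//;
      rewrite /phi => /andP[? ?]; apply/andP; split; lra.
  rewrite !lebesgue_measure_itv/= !lte_fin ltr_pM2r ?invr_gt0// ltrD2r.
  case: ifPn => _; last by rewrite mule0.
  by rewrite -!EFinD -EFinM; congr (_%:E); field.
have -> : (\int[lebesgue_measure]_x g x = \int[m]_x g x)%E.
  by apply: eq_measure_integral => A mA _; exact: mE.
rewrite ge0_integral_mscale//= muleA -EFinM mulVf// mul1e.
by rewrite (ge0_integral_pushforward mphi).
Qed.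

Lemma rV_cons_affine (R : realType) n (c : R) (y : 'rV[R]_n.+1) a x :
  c *: rV_cons (a, x) + y =
  rV_cons (c * a + y ord0 ord0, c *: x + \row_j y ord0 (lift ord0 j)).
Proof.
apply/rowP => i; rewrite !mxE.
by case: unliftP => [j ->|->] /=; rewrite ?mxE.
Qed.

Lemma measurable_affine_rV (R : realType) n (c : R) (y : 'rV[R]_n) :
  measurable_fun setT (fun x : 'rV[R]_n => c *: x + y).
Proof.
apply: measurable_fun_rV => i.
under eq_fun do rewrite !mxE.
by apply: measurable_funD => //; apply: measurable_funM => //; exact: measurable_coord.
Qed.

(** By induction on the dimension: an affine map of this shape acts separately
    on the first coordinate and on the others. *)
Lemma ge0_integral_affine (R : realType) n (c : R) (y : 'rV[R]_n) g :
  0 < c -> measurable_fun setT g -> (forall x, 0 <= g x)%E ->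
  (\int[lebesgue_rV R n]_x g (c *: x + y)%R =
   (c^-1 ^+ n)%:E * \int[lebesgue_rV R n]_x g x)%E.
Proof.
move=> c0; elim: n y g => [|n IH] y g mg g0.
  by rewrite expr0 mul1e; apply: eq_integral => x _; congr g; rewrite !thinmx0.
rewrite ge0_integral_lebesgue_rVS//; last first.
  by apply: measurableT_comp => //; exact: measurable_affine_rV.
rewrite [in RHS]ge0_integral_lebesgue_rVS//.
under eq_integral do under eq_integral do rewrite rV_cons_affine.
have mcons : measurable_fun setT (g \o @rV_cons R n).
  by apply: measurableT_comp => //; exact: measurable_rV_cons.
transitivity (\int[lebesgue_measure]_a ((c^-1 ^+ n)%:E *
   \int[lebesgue_rV R n]_x g (rV_cons ((c * a + y ord0 ord0)%R, x))))%E.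
  apply: eq_integral => a _.
  rewrite (IH _ (fun x => g (rV_cons (c * a + y ord0 ord0, x))))//.
  exact: (measurableT_comp mcons (pair1_measurable _)).
have mF := @measurable_fun_fubini_tonelli_F _ _ _ _ _ (lebesgue_rV R n) _ mcons.
rewrite /fubini_F/= in mF.
have ci0 : (0 <= (c^-1 ^+ n)%:E)%E.
  by rewrite lee_fin exprn_ge0// invr_ge0 ltW.
rewrite (@ge0_integral_affine1 _ c (y ord0 ord0) (fun a => (c^-1 ^+ n)%:E *
   \int[lebesgue_rV R n]_x g (rV_cons (a, x)))%E)//.
- rewrite ge0_integralZl//=.
  + by rewrite muleA -EFinM exprS.
  + by apply: mF => x; exact: g0.
  + by move=> a _; exact: integral_ge0.
- by apply: measurable_funeM; apply: mF => x; exact: g0.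
- by move=> a; rewrite mule_ge0//; exact: integral_ge0.
Qed.

(** * The Euclidean norm and the divergence theorem *)

Lemma enorm_ge0 (R : realType) n (x : 'rV[R]_n) : 0 <= enorm x.
Proof. exact: sqrtr_ge0. Qed.

Lemma sqnorm_ge0 (R : realType) n (x : 'rV[R]_n) : 0 <= sqnorm x.
Proof. by apply: sumr_ge0 => i _; exact: sqr_ge0. Qed.

Lemma enorm_sqr (R : realType) n (x : 'rV[R]_n) : enorm x ^+ 2 = sqnorm x.
Proof. by rewrite sqr_sqrtr// sqnorm_ge0. Qed.

Lemma enormZ (R : realType) n (c : R) (x : 'rV[R]_n) :
  enorm (c *: x) = `|c| * enorm x.
Proof.
rewrite /enorm (_ : sqnorm (c *: x) = c ^+ 2 * sqnorm x).
  by rewrite sqrtrM ?sqr_ge0// sqrtr_sqr.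
by rewrite /sqnorm mulr_sumr; apply: eq_bigr => i _; rewrite mxE exprMn.
Qed.

Lemma enorm0 (R : realType) n : enorm (0 : 'rV[R]_n) = 0.
Proof. by rewrite -(scale0r 0) enormZ normr0 mul0r. Qed.

Lemma normr_coord_le_enorm (R : realType) n (x : 'rV[R]_n) i :
  `|x ord0 i| <= enorm x.
Proof.
rewrite -(@ler_pXn2r _ 2)// ?nnegrE// ?enorm_ge0// enorm_sqr real_normK ?num_real//.
rewrite /sqnorm (bigD1 i)//= lerDl; apply: sumr_ge0 => j _; exact: sqr_ge0.
Qed.

Lemma enorm_eq0 (R : realType) n (x : 'rV[R]_n) : (enorm x == 0) = (x == 0).
Proof.
apply/eqP/eqP => [x0|->]; last exact: enorm0.
apply/rowP => i; rewrite mxE; apply/eqP; rewrite -normr_le0 -x0.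
exact: normr_coord_le_enorm.
Qed.

Lemma enorm_gt0 (R : realType) n (x : 'rV[R]_n) : (0 < enorm x) = (x != 0).
Proof. by rewrite lt_neqAle enorm_ge0 andbT eq_sym enorm_eq0. Qed.

Lemma measurable_rV_box (R : realType) n (r : R) :
  measurable [set x : 'rV[R]_n | forall i, `|x ord0 i| <= r].
Proof.
rewrite (_ : mkset _ = \big[setI/setT]_(i < n) 
    ~` [set x : 'rV[R]_n | - `|x ord0 i| < - r]).
  apply: bigsetI_measurable => i _; apply: measurableC; apply: measurable_set_lt.
  apply: measurableT_comp => //; apply: measurableT_comp => //.
  exact: measurable_coord.
rewrite -bigcap_seq; apply/seteqP; split => [x xb i _ /=|x xb i].
  by rewrite ltrN2; apply/negP; rewrite -leNgt xb.
have := xb i; rewrite /= mem_index_enum => /(_ isT)/negP.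
by rewrite ltrN2 -leNgt.
Qed.

Lemma lebesgue_rV_box_lty (R : realType) n (r : R) :
  (lebesgue_rV R n [set x | forall i, (`|x ord0 i| <= r)%R] < +oo)%E.
Proof.
elim: n => [|n IH].
  by rewrite /= diracE; case: (_ \in _); rewrite ltry.
rewrite /= /lebesgue_rV_step /pushforward.
rewrite (_ : _ @^-1` _ =
    `[- r, r] `*` [set x : 'rV[R]_n | forall i, `|x ord0 i| <= r]).
  rewrite product_measure1E//; last exact: measurable_rV_box.
  rewrite lte_mul_pinfty//.
  have : lebesgue_measure (`[- r, r]%classic : set R) \is a fin_num.
    by rewrite lebesgue_measure_itv/=; case: ifP.
  exact.
apply/seteqP; split => [[a x] /= h|[a x] /= [+ h] i].
  split.
    by have := h ord0; rewrite mxE unlift_none/= ler_norml in_itv.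
  by move=> i; have := h (lift ord0 i); rewrite mxE liftK.
rewrite in_itv/= -ler_norml => ha; rewrite mxE.
by case: unliftP => [j _|_] //=; exact: h.
Qed.

Lemma lebesgue_rV_unit_ball_lty (R : realType) n :
  (lebesgue_rV R n (@unit_ball R n) < +oo)%E.
Proof.
apply: le_lt_trans (lebesgue_rV_box_lty n (1 : R)); apply: le_measure.
- by rewrite inE; exact: measurable_unit_ball.
- by rewrite inE; exact: measurable_rV_box.
- move=> x /= x1 i; apply: le_trans (ltW x1); exact: normr_coord_le_enorm.
Qed.

Lemma measurable_rV_set0 (R : realType) n : measurable [set (0 : 'rV[R]_n)].
Proof.
rewrite (_ : [set 0] = ~` [set x : 'rV[R]_n | - enorm x < 0]).
  apply: measurableC; apply: measurable_set_lt; apply: measurableT_comp => //.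
  exact: measurable_enorm.
apply/seteqP; split => [x ->|x /=]; first by rewrite /= enorm0 oppr0 ltxx.
by rewrite oppr_lt0 enorm_gt0 => /negP/negPn/eqP.
Qed.

Lemma lebesgue_rV_set0 (R : realType) n : (0 < n)%N ->
  lebesgue_rV R n [set 0] = 0%E.
Proof.
case: n => // n _; rewrite /= /lebesgue_rV_step /pushforward.
rewrite (_ : _ @^-1` _ = [set 0] `*` [set 0]).
  rewrite product_measure1E//; last exact: measurable_rV_set0.
  have : (lebesgue_measure [set 0%R : R] * lebesgue_rV R n [set 0%R] = 0)%E.
    by rewrite lebesgue_measure_set1 mul0e.
  exact.
apply/seteqP; split => [[a x] /= /rowP h|[a x] /= [-> ->]].
  split; first by have := h ord0; rewrite !mxE unlift_none.
  by apply/rowP => i; have := h (lift ord0 i); rewrite !mxE liftK.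
by apply/rowP => i; rewrite !mxE; case: unliftP => //= j _; rewrite mxE.
Qed.

(** Translation invariance for a function of any sign, integrable or not: the
    positive and negative parts are translated separately. *)
Lemma integral_translate (R : realType) n (y : 'rV[R]_n) (f : 'rV[R]_n -> R) :
  measurable_fun setT f ->
  (\int[lebesgue_rV R n]_x (f (x + y)%R)%:E =
   \int[lebesgue_rV R n]_x (f x)%:E)%E.
Proof.
move=> mf.
have tr g : measurable_fun setT g -> (forall x, 0 <= g x)%E ->
  (\int[lebesgue_rV R n]_x g (x + y)%R = \int[lebesgue_rV R n]_x g x)%E.
  move=> mg g0; have := ge0_integral_affine y ltr01 mg g0.
  by rewrite invr1 expr1n mul1e; under eq_integral do rewrite scale1r.
have mE : measurable_fun setT (EFin \o f) by exact/measurable_EFinP.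
rewrite integralE [in RHS]integralE; congr (_ - _)%E.
- rewrite -[RHS](tr _ (measurable_funepos mE)) => [|x]; last exact: funepos_ge0.
  by apply: eq_integral => x _; rewrite !funeposE.
- rewrite -[RHS](tr _ (measurable_funeneg mE)) => [|x]; last exact: funeneg_ge0.
  by apply: eq_integral => x _; rewrite !funenegE.
Qed.

(** A directional derivative is an ordinary derivative along a line, so that
    the mean value theorem and the one-variable rules apply to it. *)
Lemma is_derive_line (R : realType) (V : normedModType R) (F : V -> R)
    (x v : V) (h : R) : derivable F (x + h *: v) v ->
  is_derive h 1 (fun t => F (x + t *: v)) ('D_v F (x + h *: v)).
Proof.
move=> dF.
have E : (fun t : R => t^-1 *: (((fun t => F (x + t *: v)) \o shift h) (t *: 1)
    - F (x + h *: v))) =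
  (fun t => t^-1 *: ((F \o shift (x + h *: v)) (t *: v) - F (x + h *: v))).
  apply/funext => t /=; congr (_ *: (F _ - _)).
  have -> : t *: (1 : R) = t by exact: mulr1.
  by rewrite scalerDl addrCA.
split; first by rewrite /derivable E.
by rewrite /derive E.
Qed.

Lemma enorm_delta (R : realType) n (i : 'I_n) :
  enorm (delta_mx ord0 i : 'rV[R]_n) = 1.
Proof.
rewrite /enorm /sqnorm (bigD1 i)//= big1 ?addr0.
  by rewrite mxE !eqxx/= expr1n sqrtr1.
by move=> j ji; rewrite mxE eqxx (negbTE ji) expr0n.
Qed.

Lemma delta_rV_neq0 (R : realType) n (i : 'I_n) :
  (delta_mx ord0 i : 'rV[R]_n) != 0.
Proof. by rewrite -enorm_gt0 enorm_delta. Qed.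

Lemma partial_eq0 (R : realType) n (i : 'I_n) (F : 'rV[R]_n -> R) x :
  ~ closure [set x | F x != 0] x -> partial i F x = 0.
Proof.
move=> nx.
have nearF : \forall y \near x, F y = 0.
  have : nbhs x (~` closure [set x | F x != 0]).
    apply: open_nbhs_nbhs; split => //.
    by apply: closed_openC; exact: closed_closure.
  apply: filterS => y ny; apply/eqP/negPn/negP => Fy; apply: ny.
  exact: subset_closure.
rewrite /partial.
have -> : 'D_(delta_mx ord0 i) F x = 'D_(delta_mx ord0 i) (cst 0 : _ -> R) x.
  by apply: near_eq_derive => //; exact: delta_rV_neq0.
exact: derive_cst.
Qed.

Lemma integral_supp d (T : measurableType d) (R : realType)
    (mu : {measure set T -> \bar R}) (D : set T) (f : T -> \bar R) :
  (forall x, ~ D x -> f x = 0%E) ->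
  (\int[mu]_(x in D) f x = \int[mu]_x f x)%E.
Proof.
move=> f0; rewrite integral_mkcond; apply: eq_integral => x _.
by rewrite patchE; case: ifPn => // /negP; rewrite inE => /f0.
Qed.

Lemma measurable_translate (R : realType) n (y : 'rV[R]_n) (F : 'rV[R]_n -> R) :
  measurable_fun setT F -> measurable_fun setT (fun x : 'rV[R]_n => F (x + y)).
Proof.
move=> mF; apply: measurableT_comp => //.
rewrite (_ : (fun _ => _) = (fun x : 'rV[R]_n => 1 *: x + y)).
  exact: measurable_affine_rV.
by apply/funext => x; rewrite scale1r.
Qed.

(** The integral of a difference quotient vanishes because the measure is
    translation invariant; the quotients are bounded by the mean value theorem
    and supported in a fixed box, so dominated convergence passes to the
    derivative. *)
Lemma integral_partial_eq0 (R : realType) n (i : 'I_n) (F : 'rV[R]_n -> R)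
    (K : R) :
  measurable_fun setT F ->
  (forall x, derivable F x (delta_mx ord0 i)) ->
  measurable_fun setT (partial i F) ->
  (forall x, `|partial i F x| <= K) ->
  (forall x, `|F x| <= K) ->
  closure [set x | F x != 0] `<=` @unit_ball R n ->
  (\int[lebesgue_rV R n]_(x in @unit_ball R n) (partial i F x)%:E = 0)%E.
Proof.
move=> mF dF mp pK FK suppF.
pose e : 'rV[R]_n := delta_mx ord0 i.
have F0 x : ~ unit_ball x -> F x = 0.
  move=> nx; apply/eqP/negPn/negP => Fx; apply: nx; apply: suppF.
  exact: subset_closure.
have mB := @measurable_unit_ball R n.
pose Q := [set x : 'rV[R]_n | forall i, `|x ord0 i| <= 2].
have mQ : measurable Q by exact: measurable_rV_box.
have BQ : @unit_ball R n `<=` Q.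
  move=> x /= x1 j; apply: le_trans (normr_coord_le_enorm _ _) _.
  by rewrite (le_trans (ltW x1))// ler1n.
have iF : (lebesgue_rV R n).-integrable setT (EFin \o F).
  have : (lebesgue_rV R n).-integrable (@unit_ball R n) (EFin \o F).
    apply: measurable_bounded_integrable => //.
    - exact: lebesgue_rV_unit_ball_lty.
    - exact: measurable_funTS.
    - by exists K; split; [exact: num_real|move=> M KM x _; exact: le_trans (FK x) (ltW KM)].
  rewrite integrable_mkcond//; apply: eq_integrable => // x _ /=.
  rewrite patchE; case: ifPn => // /negP; rewrite inE => nx.
  by rewrite F0.
(* The difference quotient with step [1/(k+1)]; steps of length at most one
   keep the supports inside the box [Q] of side four. *)
pose g (k : nat) (x : 'rV[R]_n) : R :=
  k.+1%:R * (F (x + k.+1%:R^-1 *: e) - F x).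
have mtr (k : nat) :
    measurable_fun setT (fun x : 'rV[R]_n => F (x + k.+1%:R^-1 *: e)).
  exact: measurable_translate.
have mg k : measurable_fun setT (g k).
  by apply: measurable_funM => //; apply: measurable_funB.
have gK k x : `|g k x| <= K.
  have k0 : 0 < k.+1%:R^-1 :> R by rewrite invr_gt0.
  have [c _] := @MVT R (fun t : R => F (x + t *: e)) (fun t : R => partial i F (x + t *: e))
    0 k.+1%:R^-1 k0 (fun (t : R) _ => is_derive_line (dF (x + t *: e)))
    (continuous_subspaceT (fun t : R => differentiable_continuous
      ((derivable1_diffP _ _).1 (@ex_derive _ _ _ _ _ _ _ (is_derive_line (dF (x + t *: e))))))).
  rewrite scale0r addr0 subr0 /g => ->.
  by rewrite mulrCA mulfV ?mulr1 ?pK// pnatr_eq0.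
have gQ k x : ~ Q x -> g k x = 0.
  move=> nQ; rewrite /g F0; last first.
    move=> /= xe; apply: nQ => j.
    have := normr_coord_le_enorm (x + k.+1%:R^-1 *: e) j.
    move=> /le_lt_trans /(_ xe); rewrite !mxE => xe1.
    rewrite -[x ord0 j](addrK (k.+1%:R^-1 * (delta_mx ord0 i : 'rV[R]_n) ord0 j)).
    rewrite mxE (le_trans (ler_normB _ _))// (_ : 2 = 1 + 1)//.
    rewrite lerD//; first exact: ltW.
    rewrite normrM ger0_norm ?invr_ge0//; case: (_ && _); rewrite ?normr0 ?mulr0//.
    by rewrite normr1 mulr1 invf_le1// ler1n.
  by rewrite F0 ?subr0 ?mulr0// => /BQ.
have Ig k : (\int[lebesgue_rV R n]_x (g k x)%:E = 0)%E.
  have iFt : (lebesgue_rV R n).-integrable setT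
      (fun x : 'rV[R]_n => (F (x + k.+1%:R^-1 *: e))%:E).
    apply/integrableP; split; first exact/measurable_EFinP.
    rewrite (integral_translate (k.+1%:R^-1 *: e) (f := fun x : 'rV[R]_n => `|F x|)).
      by have /integrableP[] := iF.
    exact: measurableT_comp.
  under eq_integral do rewrite EFinM EFinB.
  rewrite integralZl//; last exact: integrableB.
  by rewrite integralB// integral_translate// subee ?mule0// integrable_fin_num.
have cvg_g x : (g k x)%:E @[k --> \oo] --> (partial i F x)%:E.
  apply: cvg_EFin; first exact: nearW.
  have /cvgr_dnbhsP/(_ (fun k => k.+1%:R^-1)) :
    (h^-1 *: ((F \o shift x) (h *: e) - F x)) @[h --> 0^'] --> partial i F x.
    exact: dF.
  have -> : fine \o (fun k => (g k x)%:E) =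
      (fun k => k.+1%:R^-1^-1 *: ((F \o shift x) (k.+1%:R^-1 *: e) - F x)).
    by apply/funext => k; rewrite /g /= invrK [_ + x]addrC.
  by apply; split => [k|]; [rewrite invr_eq0 pnatr_eq0|exact: cvg_harmonic].
have pQ x : ~ Q x -> partial i F x = 0.
  by move=> nQ; apply: partial_eq0 => /suppF/BQ.
have iK : (lebesgue_rV R n).-integrable Q (EFin \o cst K).
  apply: measurable_bounded_integrable => //.
  - exact: lebesgue_rV_box_lty.
  - exists `|K|; split; first exact: num_real.
    by move=> M KM x _ /=; exact: ltW.
have [_ _] := dominated_convergence (mu := lebesgue_rV R n) mQ
  (f_ := fun k x => (g k x)%:E) (f := fun x => (partial i F x)%:E)
  (g := EFin \o cst K)
  (fun k => measurable_funTS ((measurable_EFinP _ _).2 (mg k)))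
  (measurable_funTS ((measurable_EFinP _ _).2 mp))
  (aeW _ (fun x _ => cvg_g x)) iK
  (aeW _ (fun x k _ => gK k x)).
have -> : [sequence (\int[lebesgue_rV R n]_(x in Q) (g k x)%:E)%E]_k = cst 0%E.
  by apply/funext => k /=; rewrite integral_supp// => x nQ; rewrite gQ.
move=> /(cvg_lim (@ereal_hausdorff R)); rewrite lim_cst//.
have suppE D : (forall x, ~ D x -> partial i F x = 0) ->
    (\int[lebesgue_rV R n]_(x in D) (partial i F x)%:E =
     \int[lebesgue_rV R n]_x (partial i F x)%:E)%E.
  by move=> D0; apply: integral_supp => x /D0 ->.
rewrite !suppE// => x nB.
by apply: partial_eq0 => /suppF.
Unshelve. all: by end_near. Qed.

(** * Polar coordinates *)

Lemma measurable_invr (R : realType) : measurable_fun setT (fun x : R => x^-1).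
Proof.
rewrite -(setUv [set (0 : R)]); apply/measurable_funU => //.
  exact: measurableC.
split; first exact: measurable_fun_set1.
apply: open_continuous_measurable_fun; first exact/closed_openC/closed_eq.
by move=> x; rewrite inE/= => /eqP x0; exact: inv_continuous.
Qed.

Lemma unit_ball_scale (R : realType) n (l : R) (y : 'rV[R]_n) : 0 < l ->
  unit_ball (l^-1 *: y) <-> enorm y < l.
Proof.
move=> l0; rewrite /unit_ball /= enormZ gtr0_norm ?invr_gt0//.
by rewrite mulrC ltr_pdivrMr// mul1r.
Qed.

Lemma integral_tail_power (R : realType) (n : nat) (a : R) : (0 < n)%N -> 0 < a ->
  (\int[lebesgue_measure]_(l in `]a, +oo[) (l ^- n.+1)%:E =
   (n%:R^-1 * a ^- n)%:E)%E.
Proof.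
move=> n0 a0.
have nn0 : n%:R != 0 :> R by rewrite pnatr_eq0 -lt0n.
pose F (x : R) : R := - (n%:R^-1 * (x ^+ n)^-1).
have dF (x : R) : a <= x -> is_derive x 1 F (x ^- n.+1).
  move=> ax; have x0 : x != 0 by rewrite gt_eqF// (lt_le_trans a0).
  have xn0 : x ^+ n != 0 by rewrite expf_neq0.
  apply: is_derive_eq (derN (derZ n%:R^-1
    (derV (f := fun y => y ^+ n) xn0 (derX n (der_id x))))) _.
  have xn : x ^+ n = x * x ^+ n.-1 by rewrite -exprS prednK.
  have y0 : x ^+ n.-1 != 0 by rewrite expf_neq0.
  rewrite [x ^+ n.+1]exprS xn.
  move: (x ^+ n.-1) (n%:R : R) y0 nn0 => y m y0 m0; field.
  by rewrite x0 m0 y0.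
have cF x : a <= x -> {for x, continuous (fun l : R => l ^- n.+1)}.
  move=> ax; have x0 : x ^+ n.+1 != 0.
    by rewrite expf_neq0// gt_eqF// (lt_le_trans a0).
  exact: der_cvg (derV (f := fun y => y ^+ n.+1) x0 (derX n.+1 (der_id x))).
have mf : measurable_fun `]a, +oo[ (fun l : R => (l ^- n.+1)%:E).
  apply/measurable_EFinP; apply: open_continuous_measurable_fun.
    exact: interval_open.
  move=> x; by rewrite inE/= in_itv/= andbT => /ltW; exact: cF.
rewrite integral_itv_obnd_cbnd//.
rewrite (@ge0_continuous_FTC2y _ (fun l => l ^- n.+1) F a 0).
- by rewrite sub0e /F /= opprK.
- by move=> x ax; rewrite invr_ge0 exprn_ge0// (le_trans (ltW a0)).
- apply: continuous_in_subspaceT => x; rewrite inE/= in_itv/= andbT.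
  exact: cF.
- apply/cvgrPdist_lt => e e0; near=> x.
  have x1 : 1 <= x by near: x; apply: nbhs_pinfty_ge; rewrite num_real.
  have xe : e^-1 < x by near: x; apply: nbhs_pinfty_gt; rewrite num_real.
  have x0 : 0 < x by exact: lt_le_trans x1.
  rewrite sub0r normrN /F normrN ger0_norm; last first.
    by rewrite mulr_ge0// invr_ge0// exprn_ge0// ltW.
  apply: (@le_lt_trans _ _ x^-1); last by rewrite -(invrK e) ltf_pV2// posrE invr_gt0.
  have n1 : n%:R^-1 <= 1 :> R by rewrite invf_le1 ?ltr0n// ler1n.
  have xn : x ^- n <= x^-1.
    rewrite lef_pV2 ?posrE ?exprn_gt0// -{1}[x]expr1.
    by rewrite ler_weXn2l.
  rewrite -[leRHS]mul1r; apply: ler_pM => //.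
  by rewrite invr_ge0 exprn_ge0// ltW.
- move=> x /ltW ax; exact: (@ex_derive _ _ _ _ _ _ _ (dF _ ax)).
- apply: cvg_at_right_filter; exact: (der_cvg (dF _ (lexx a))).
- move=> x; rewrite in_itv/= andbT => /ltW ax; rewrite derive1E.
  exact: (@derive_val _ _ _ _ _ _ _ (dF _ ax)).
Unshelve. all: by end_near. Qed.

Lemma measurable_scale_rV (R : realType) n :
  measurable_fun setT (fun p : R * 'rV[R]_n => p.1 *: p.2).
Proof.
apply: measurable_fun_rV => i.
rewrite (_ : (fun _ => _) = (fun p : R * 'rV[R]_n => p.1 * p.2 ord0 i)); last first.
  by apply/funext => p; rewrite mxE.
apply: measurable_funM; first exact: measurable_fst.
exact: (measurableT_comp (@measurable_coord R n i) measurable_snd).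
Qed.

Lemma measurable_indic_ball (R : realType) n :
  measurable_fun setT (\1_(@unit_ball R n) : 'rV[R]_n -> R).
Proof. by apply: measurable_indic; exact: measurable_unit_ball. Qed.

Lemma integral_indicE d (T : measurableType d) (R : realType)
    (mu : {measure set T -> \bar R}) (D : set T) (f : T -> \bar R) :
  (\int[mu]_(x in D) f x = \int[mu]_x ((\1_D x)%:E * f x))%E.
Proof.
rewrite integral_mkcond; apply: eq_integral => x _.
by rewrite patchE indicE; case: ifPn => _; rewrite ?mul1e ?mul0e.
Qed.

(** Polar coordinates in which the average over directions is taken over the
    ball instead of the sphere, so that no surface measure is needed. Exchange
    the integrals by Tonelli, put [y = l x] at fixed [l], and exchange again:
    what remains is the integral of [l ^- N.+1] over [l > |y|], that is
    [|y|^(-N) / N]. *)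
Lemma ge0_integral_polar (R : realType) (N : nat) (g : 'rV[R]_N -> \bar R) :
  (1 < N)%N -> measurable_fun setT g -> (forall x, 0 <= g x)%E ->
  (\int[lebesgue_rV R N]_(y in @unit_ball R N) (g y * (enorm y ^- N.-1)%:E) =
   N%:R%:E * \int[lebesgue_rV R N]_(x in @unit_ball R N) ((enorm x)%:E *
     \int[lebesgue_measure]_(l in `]0%R, +oo[)
        ((\1_(@unit_ball R N) (l *: x)%R)%:E * g (l *: x)%R)))%E.
Proof.
move=> N1 mg g0.
pose B := @unit_ball R N; pose P : set R := `]0, +oo[%classic.
have mI := @measurable_indic_ball R N.
have mP : measurable_fun setT (\1_P : R -> R) by rewrite /P; apply: measurable_indic; exact: measurable_itv.
have mS := @measurable_scale_rV R N.
pose f (p : 'rV[R]_N * R) : \bar R := ((\1_B p.1 * enorm p.1 * \1_P p.2 *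
   \1_B (p.2 *: p.1))%:E * g (p.2 *: p.1)%R)%E.
have f0 p : (0 <= f p)%E.
  by rewrite mule_ge0// lee_fin !mulr_ge0 ?enorm_ge0// indicE.
have mS' : measurable_fun setT (fun p : 'rV[R]_N * R => p.2 *: p.1).
  apply: (measurableT_comp mS (_ : measurable_fun setT (fun p : 'rV[R]_N * R => (p.2, p.1)))).
  exact: measurable_swap.
have mf : measurable_fun setT f.
  apply: emeasurable_funM; last exact: (measurableT_comp mg mS').
  apply/measurable_EFinP; apply: measurable_funM; last first.
    exact: (measurableT_comp mI mS').
  apply: measurable_funM; last exact: (measurableT_comp mP measurable_snd).
  apply: measurable_funM; first exact: (measurableT_comp mI measurable_fst).
  exact: (measurableT_comp (@measurable_enorm R N) measurable_fst).
pose f2 (p : R * 'rV[R]_N) : \bar R := ((\1_B p.2 * enorm p.2)%:E * g p.2 *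
   (\1_P p.1 * p.1 ^- N.+1 * \1_B (p.1^-1 *: p.2))%:E)%E.
have P0 l : l <= 0 -> (\1_P l : R) = 0.
  by move=> l0; rewrite indicE /P memNset//= in_itv/= andbT; apply/negP; rewrite -leNgt.
have P1 l : 0 < l -> (\1_P l : R) = 1.
  by move=> l0; rewrite indicE /P mem_set//= in_itv/= andbT.
have f20 p : (0 <= f2 p)%E.
  rewrite /f2; have [/P0 ->|p0] := leP p.1 0; first by rewrite !mul0r mule0.
  rewrite P1// mule_ge0 ?mule_ge0// lee_fin ?mulr_ge0 ?enorm_ge0 ?indicE//.
  by rewrite invr_ge0 exprn_ge0// ltW.
have [mf2 mh] : measurable_fun setT f2 /\
    measurable_fun setT (fun p : R * 'rV[R]_N =>
      (\1_P p.1 * p.1 ^- N.+1 * \1_B (p.1^-1 *: p.2))%:E).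
  have mI2 : measurable_fun setT (fun p : R * 'rV[R]_N => \1_B p.2 : R).
    exact: (measurableT_comp mI measurable_snd).
  have mV : measurable_fun setT (fun p : R * 'rV[R]_N => p.1^-1 *: p.2).
    apply: (measurableT_comp mS (_ : measurable_fun setT
      (fun p : R * 'rV[R]_N => (p.1^-1, p.2)))).
    apply/measurable_fun_pairP; split; last exact: measurable_snd.
    exact: (measurableT_comp (@measurable_invr R) measurable_fst).
  have mh : measurable_fun setT (fun p : R * 'rV[R]_N =>
      (\1_P p.1 * p.1 ^- N.+1 * \1_B (p.1^-1 *: p.2))%:E).
    apply/measurable_EFinP; apply: measurable_funM.
      apply: measurable_funM; first exact: (measurableT_comp mP measurable_fst).
      apply: (measurableT_comp (@measurable_invr R)).
      by apply: measurable_funX; exact: measurable_fst.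
    exact: (measurableT_comp mI mV).
  split=> //; apply: emeasurable_funM => //; apply: emeasurable_funM.
  - apply/measurable_EFinP; apply: measurable_funM => //.
    exact: (measurableT_comp (@measurable_enorm R N) measurable_snd).
  - exact: (measurableT_comp mg measurable_snd).
transitivity (N%:R%:E * \int[lebesgue_rV R N]_x \int[lebesgue_measure]_l f (x, l))%E;
  last first.
  congr (_ * _)%E; rewrite [RHS]integral_indicE; apply: eq_integral => x _.
  rewrite muleA -EFinM -ge0_integralZl//.
  - rewrite [RHS]integral_indicE; apply: eq_integral => l _; rewrite /f /=.
    by rewrite !muleA -!EFinM; congr (_%:E * _)%E; rewrite /B /P; ring.
  - apply: measurable_funTS; apply: emeasurable_funM.
      apply/measurable_EFinP; apply: (measurableT_comp mI).
      exact: (measurableT_comp mS' (pair1_measurable _)).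
    apply: (measurableT_comp mg).
    exact: (measurableT_comp mS' (pair1_measurable _)).
  - by move=> l _; rewrite !mule_ge0// lee_fin indicE.
  - by rewrite lee_fin mulr_ge0 ?enorm_ge0// indicE.
have -> : (\int[lebesgue_rV R N]_x \int[lebesgue_measure]_l f (x, l) =
    \int[lebesgue_measure]_l \int[lebesgue_rV R N]_x f (x, l))%E.
  exact: (@fubini_tonelli _ _ _ (measurableTypeR R) _ (lebesgue_rV R N)
    lebesgue_measure f mf f0).
transitivity (N%:R%:E * \int[lebesgue_measure]_l \int[lebesgue_rV R N]_y f2 (l, y))%E;
  last first.
  congr (_ * _)%E; apply: eq_integral => l _.
  have [l0|l0] := leP l 0.
    have Pl := P0 _ l0.
    by rewrite !integral0_eq// => y _; rewrite /f /f2 /= Pl ?(mulr0, mul0r, mul0e, mule0).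
  have Pl := P1 _ l0.
  pose G y : \bar R := ((\1_B (l^-1 *: y) * enorm (l^-1 *: y) * \1_B y)%:E * g y)%E.
  have l0' : l != 0 by rewrite gt_eqF.
  have G0 y : (0 <= G y)%E.
    by rewrite mule_ge0// lee_fin !mulr_ge0 ?enorm_ge0// indicE.
  have mG : measurable_fun setT G.
    apply: emeasurable_funM => //; apply/measurable_EFinP; apply: measurable_funM => //.
    have mV : measurable_fun setT (fun y : 'rV[R]_N => l^-1 *: y).
      exact: (measurableT_comp mS (pair1_measurable _)).
    apply: measurable_funM; first exact: (measurableT_comp mI).
    exact: (measurableT_comp (@measurable_enorm R N)).
  have -> : (\int[lebesgue_rV R N]_x f (x, l) = \int[lebesgue_rV R N]_x G (l *: x + 0)%R)%E.
    apply: eq_integral => x _; rewrite /f /G addr0 /= Pl mulr1.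
    by rewrite scalerA mulVf// scale1r.
  rewrite ge0_integral_affine// -ge0_integralZl//; last first.
    by rewrite lee_fin exprn_ge0// invr_ge0 ltW.
  apply: eq_integral => y _; rewrite /G /f2 /= Pl mul1r.
  rewrite [LHS]muleAC -EFinM [RHS]muleA -EFinM; congr (_%:E * _)%E.
  rewrite enormZ gtr0_norm ?invr_gt0// exprVn exprS invfM; ring.
have -> : (\int[lebesgue_measure]_l \int[lebesgue_rV R N]_y f2 (l, y) =
    \int[lebesgue_rV R N]_y \int[lebesgue_measure]_l f2 (l, y))%E.
  exact: (@fubini_tonelli _ _ (measurableTypeR R) _ _ lebesgue_measure
    (lebesgue_rV R N) f2 mf2 f20).
rewrite -ge0_integralZl//; last 2 first.
- exact: (@measurable_fun_fubini_tonelli_G _ _ (measurableTypeR R) _ _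
    lebesgue_measure f2 mf2 f20).
- by move=> y _; exact: integral_ge0.
rewrite [LHS]integral_indicE; apply: eq_integral => y _.
have [->|y0] := eqVneq y 0.
  rewrite enorm0 integral0_eq ?mule0; last first.
    by move=> l _; rewrite /f2/= enorm0 mulr0 !mul0e.
  have N1' : (N.-1 == 0)%N = false by case: (N) N1 => [|[|]].
  by rewrite expr0n N1' invr0 !mule0.
have y0' : 0 < enorm y by rewrite enorm_gt0.
have -> : (\int[lebesgue_measure]_l f2 (l, y) = (\1_B y * enorm y)%:E * g y *
    \int[lebesgue_measure]_l (\1_P l * l ^- N.+1 * \1_B (l^-1 *: y))%:E)%E.
  rewrite -ge0_integralZl//.
  - exact: (measurableT_comp mh (pair2_measurable y)).
  - move=> l _; have [/P0 ->|l0] := leP l 0; first by rewrite !mul0r.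
    by rewrite P1// lee_fin !mulr_ge0// ?indicE// invr_ge0 exprn_ge0// ltW.
  - by rewrite mule_ge0// lee_fin mulr_ge0 ?enorm_ge0// indicE.
have -> : (\int[lebesgue_measure]_l (\1_P l * l ^- N.+1 * \1_B (l^-1 *: y))%:E =
    \int[lebesgue_measure]_(l in `]enorm y, +oo[) (l ^- N.+1)%:E)%E.
  rewrite [RHS]integral_indicE; apply: eq_integral => l _.
  rewrite -EFinM; congr (_%:E).
  have [l0|l0] := leP l 0.
    rewrite P0// !mul0r [X in X * _]indicE memNset ?mul0r//=.
    by rewrite in_itv/= andbT; apply/negP; rewrite -leNgt (le_trans l0)// ltW.
  rewrite P1// mul1r mulrC; congr (_ * _); rewrite !indicE; congr (nat_of_bool _)%:R.
  by apply/idP/idP; rewrite !inE /= in_itv/= andbT => /unit_ball_scale; apply.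
rewrite integral_tail_power//; last exact: ltnW.
rewrite muleC -muleA -!EFinM [RHS]muleA [RHS]muleAC -EFinM.
rewrite [RHS]muleA -EFinM [RHS]muleC; congr (_ * _%:E)%E.
have -> : enorm y ^+ N = enorm y * enorm y ^+ N.-1.
  by rewrite -exprS prednK// ltnW.
have N0 : N%:R != 0 :> R by rewrite pnatr_eq0 -lt0n ltnW.
have y1 : enorm y ^+ N.-1 != 0 by rewrite expf_neq0// gt_eqF.
by rewrite /B; field; rewrite y1 N0 gt_eqF.
Qed.

(** Rescaling the ray through [x] from the parameter [l] to the radius [s = l
    |x|] shows that the inner integral in [ge0_integral_polar] depends only on
    the direction of [x]. *)
Lemma ge0_integral_ray (R : realType) (N : nat) (x : 'rV[R]_N)
    (g : 'rV[R]_N -> \bar R) :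
  x != 0 -> measurable_fun setT g -> (forall x, 0 <= g x)%E ->
  ((enorm x)%:E * \int[lebesgue_measure]_(l in `]0%R, +oo[)
     ((\1_(@unit_ball R N) (l *: x)%R)%:E * g (l *: x)%R) =
   \int[lebesgue_measure]_(s in `]0%R, 1%R[) g (s *: ((enorm x)^-1 *: x))%R)%E.
Proof.
move=> x0 mg g0.
have ex0 : 0 < enorm x by rewrite enorm_gt0.
have mS := @measurable_scale_rV R N.
have mray (y : 'rV[R]_N) : measurable_fun setT (fun s : R => g (s *: y)).
  apply: (measurableT_comp mg).
  exact: (measurableT_comp mS (pair2_measurable y)).
rewrite [in RHS]integral_indicE.
pose G (s : R) : \bar R :=
  ((\1_(`]0, 1[%classic : set R) s)%:E * g (s *: ((enorm x)^-1 *: x))%R)%E.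
have G0 s : (0 <= G s)%E by rewrite mule_ge0// lee_fin indicE.
have mG : measurable_fun setT G.
  apply: emeasurable_funM => //; apply/measurable_EFinP.
  by apply: measurable_indic; exact: measurable_itv.
have := ge0_integral_affine1 0 ex0 mG G0.
move=> /(congr1 (fun z => (enorm x)%:E * z)%E).
rewrite muleA -EFinM mulfV ?gt_eqF// mul1e => <-.
congr (_ * _)%E; rewrite [LHS]integral_indicE; apply: eq_integral => l _.
rewrite /G addr0 scalerA (mulrC (enorm x)) mulfK ?gt_eqF//.
rewrite muleA -EFinM; congr (_%:E * _)%E.
rewrite !indicE -natrM mulnb; congr (nat_of_bool _)%:R.
apply/andP/idP; rewrite !inE /= !in_itv/= andbT /unit_ball/= enormZ.
  by move=> [l0]; rewrite gtr0_norm// => ->; rewrite andbT mulr_gt0.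
by rewrite pmulr_lgt0// => /andP[l0 l1]; rewrite gtr0_norm.
Qed.

Lemma measurable_ray_integral (R : realType) (N : nat) (g : 'rV[R]_N -> \bar R) :
  measurable_fun setT g -> (forall x, 0 <= g x)%E ->
  measurable_fun setT (fun x : 'rV[R]_N =>
    \int[lebesgue_measure]_(s in `]0%R, 1%R[) g (s *: ((enorm x)^-1 *: x))%R)%E.
Proof.
move=> mg g0.
have mS := @measurable_scale_rV R N.
have mItv (D : set R) : measurable D -> measurable_fun setT (fun p : 'rV[R]_N * R => \1_D p.2 : R).
  by move=> mD; apply: (measurableT_comp (measurable_indic mD) measurable_snd).
pose h (p : 'rV[R]_N * R) := ((\1_(`]0%R, 1%R[%classic : set R) p.2)%:E *
  g (p.2 *: ((enorm p.1)^-1 *: p.1))%R)%E.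
apply: (eq_measurable_fun (fun x => \int[lebesgue_measure]_l h (x, l))%E) => [x _|].
  by rewrite [RHS]integral_indicE.
apply: (@measurable_fun_fubini_tonelli_F _ _ _ (measurableTypeR R) _ lebesgue_measure h).
  apply: emeasurable_funM; first by apply/measurable_EFinP; exact: mItv.
  apply: (measurableT_comp mg).
  apply: (measurableT_comp mS (_ : measurable_fun setT
    (fun p : 'rV[R]_N * R => (p.2, (enorm p.1)^-1 *: p.1)))).
  apply/measurable_fun_pairP; split; first exact: measurable_snd.
  apply: (measurableT_comp mS (_ : measurable_fun setT
    (fun p : 'rV[R]_N * R => ((enorm p.1)^-1, p.1)))).
  apply/measurable_fun_pairP; split; last exact: measurable_fst.
  apply: (measurableT_comp (@measurable_invr R)).
  exact: (measurableT_comp (@measurable_enorm R N) measurable_fst).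
by move=> p; rewrite !mule_ge0// lee_fin indicE.
Qed.

Lemma ge0_integral_polar_ae (R : realType) (N : nat) (g : 'rV[R]_N -> \bar R) :
  (1 < N)%N -> measurable_fun setT g -> (forall x, 0 <= g x)%E ->
  (\int[lebesgue_rV R N]_(y in @unit_ball R N) (g y * (enorm y ^- N.-1)%:E) =
   N%:R%:E * \int[lebesgue_rV R N]_(x in @unit_ball R N)
     \int[lebesgue_measure]_(s in `]0%R, 1%R[) g (s *: ((enorm x)^-1 *: x))%R)%E.
Proof.
move=> N1 mg g0; rewrite ge0_integral_polar//; congr (_ * _)%E.
have mS := @measurable_scale_rV R N.
have mS' : measurable_fun setT (fun p : 'rV[R]_N * R => p.2 *: p.1).
  apply: (measurableT_comp mS (_ : measurable_fun setT (fun p : 'rV[R]_N * R => (p.2, p.1)))).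
  exact: measurable_swap.
have mI := @measurable_indic_ball R N.
have mItv (D : set R) : measurable D -> measurable_fun setT (fun p : 'rV[R]_N * R => \1_D p.2 : R).
  by move=> mD; apply: (measurableT_comp (measurable_indic mD) measurable_snd).
apply: ge0_ae_eq_integral.
- exact: measurable_unit_ball.
- apply: measurable_funTS; apply: emeasurable_funM.
    by apply/measurable_EFinP; exact: measurable_enorm.
  pose h (p : 'rV[R]_N * R) := ((\1_(`]0%R, +oo[%classic : set R) p.2)%:E *
    ((\1_(@unit_ball R N) (p.2 *: p.1)%R)%:E * g (p.2 *: p.1)%R))%E.
  apply: (eq_measurable_fun (fun x => \int[lebesgue_measure]_l h (x, l))%E) => [x _|].
    by rewrite [RHS]integral_indicE.
  apply: (@measurable_fun_fubini_tonelli_F _ _ _ (measurableTypeR R) _ lebesgue_measure h).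
    apply: emeasurable_funM; first by apply/measurable_EFinP; exact: mItv.
    apply: emeasurable_funM; last exact: (measurableT_comp mg mS').
    by apply/measurable_EFinP; exact: (measurableT_comp mI mS').
  by move=> p; rewrite !mule_ge0// lee_fin indicE.
- by apply: measurable_funTS; exact: measurable_ray_integral.
- move=> x _; rewrite mule_ge0 ?lee_fin ?enorm_ge0//; apply: integral_ge0 => l _.
  by rewrite mule_ge0// lee_fin indicE.
- by move=> x _; exact: integral_ge0.
exists [set 0]; split; first exact: measurable_rV_set0.
  by apply: lebesgue_rV_set0; exact: ltnW.
move=> x /= h; apply/eqP/negPn/negP => x0; apply: h => _.
exact: ge0_integral_ray.
Qed.

(** * Integrals of radial functions *)

Lemma integral_ball_cst (R : realType) N (c : \bar R) :
  (0 <= c)%E -> (\int[lebesgue_rV R N]_(x in @unit_ball R N) c =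
   lebesgue_rV R N (@unit_ball R N) * c)%E.
Proof.
move=> c0; rewrite muleC.
by rewrite (integral_cst _ (@measurable_unit_ball R N)).
Qed.

Lemma unit_ball_ae (R : realType) N (P : 'rV[R]_N -> Prop) : (0 < N)%N ->
  (forall x, x != 0 -> unit_ball x -> P x) ->
  {ae lebesgue_rV R N, forall x, unit_ball x -> P x}.
Proof.
move=> N0 h; exists [set 0]; split; first exact: measurable_rV_set0.
  exact: lebesgue_rV_set0.
move=> x /= nP; apply/eqP/negPn/negP => x0; apply: nP; exact: h.
Qed.

Lemma measurable_ray (R : realType) N (y : 'rV[R]_N) :
  measurable_fun setT (fun s : R => s *: y).
Proof.
exact: (measurableT_comp (@measurable_scale_rV R N) (pair2_measurable y)).
Qed.

Lemma enorm_normalize (R : realType) N (x : 'rV[R]_N) : x != 0 ->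
  enorm ((enorm x)^-1 *: x) = 1.
Proof.
move=> x0; have ex0 : 0 < enorm x by rewrite enorm_gt0.
by rewrite enormZ gtr0_norm ?invr_gt0// mulVf// gt_eqF.
Qed.

(** The polar formula for a radial function, whose integral along a ray is the
    same for all rays. *)
Lemma ge0_integral_radial (R : realType) N (G : R -> \bar R) :
  (1 < N)%N -> measurable_fun setT G -> (forall x, 0 <= G x)%E ->
  (\int[lebesgue_rV R N]_(y in @unit_ball R N) G (enorm y) =
   N%:R%:E * (lebesgue_rV R N (@unit_ball R N) *
     \int[lebesgue_measure]_(s in `]0%R, 1%R[) (G s * (s ^+ N.-1)%:E)))%E.
Proof.
move=> N1 mG G0.
pose G1 s := (G s * (`|s| ^+ N.-1)%:E)%E.
have G10 s : (0 <= G1 s)%E by rewrite mule_ge0// lee_fin exprn_ge0.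
have mG1 : measurable_fun setT G1.
  apply: emeasurable_funM => //; apply/measurable_EFinP.
  by apply: measurable_funX; exact: normr_measurable.
have mE := @measurable_enorm R N.
have mG1E : measurable_fun setT (G1 \o @enorm R N) by exact: measurableT_comp.
have N0 : (0 < N)%N by exact: ltnW.
have := ge0_integral_polar_ae N1 mG1E (fun x => G10 _).
rewrite (_ : (\int[_]_(y in _) _ = \int[lebesgue_rV R N]_(y in @unit_ball R N) G (enorm y))%E);
  last first.
  apply: ge0_ae_eq_integral.
  - exact: measurable_unit_ball.
  - apply: measurable_funTS; apply: emeasurable_funM => //.
    apply/measurable_EFinP; apply: (measurableT_comp (@measurable_invr R)).
    exact: measurable_funX.
  - by apply: measurable_funTS; exact: measurableT_comp.
  - move=> x _; rewrite mule_ge0//; first exact: G10.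
    by rewrite lee_fin invr_ge0 exprn_ge0// enorm_ge0.
  - by move=> x _.
  apply: unit_ball_ae => // x x0 _ /=.
  rewrite /G1 ger0_norm ?enorm_ge0// -muleA -EFinM mulfV ?mule1//.
  by rewrite expf_neq0// enorm_eq0.
move=> ->; congr (_ * _)%E.
rewrite -integral_ball_cst; last first.
  apply: integral_ge0 => s /=; rewrite in_itv/= => /andP[s0 _].
  by rewrite mule_ge0// lee_fin exprn_ge0// ltW.
apply: ge0_ae_eq_integral.
- exact: measurable_unit_ball.
- apply: measurable_funTS; apply: measurable_ray_integral => // x; exact: G10.
- exact: measurable_cst.
- by move=> x _; apply: integral_ge0 => s _; exact: G10.
- move=> x _; apply: integral_ge0 => s /=; rewrite in_itv/= => /andP[s0 _].
  by rewrite mule_ge0// lee_fin exprn_ge0// ltW.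
apply: unit_ball_ae => // x x0 _; apply: eq_integral => s.
rewrite inE/= in_itv/= => /andP[s0 _].
by rewrite /G1 enormZ enorm_normalize// mulr1 normr_id gtr0_norm.
Qed.

(** By polar coordinates, almost every ray meets a null set in a null set.
    Along such a ray a radial function has a measurable profile. *)
Lemma generic_ray (R : realType) N (Z : set 'rV[R]_N) : (1 < N)%N ->
  measurable Z -> lebesgue_rV R N Z = 0%E ->
  (0 < lebesgue_rV R N (@unit_ball R N))%E ->
  exists2 e : 'rV[R]_N, enorm e = 1 &
    (\int[lebesgue_measure]_(s in `]0%R, 1%R[) (\1_Z (s *: e)%R)%:E = 0)%E.
Proof.
move=> N1 mZ Z0 B0.
pose g (x : 'rV[R]_N) : \bar R := (\1_Z x)%:E.
have mg : measurable_fun setT g.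
  by apply/measurable_EFinP; exact: measurable_indic.
have g0 x : (0 <= g x)%E by rewrite lee_fin indicE.
have N0 : (0 < N)%N by exact: ltnW.
have := ge0_integral_polar_ae N1 mg g0.
rewrite (_ : (\int[_]_(y in _) (g y * _) = 0)%E); last first.
  rewrite (ge0_negligible_integral mZ)//.
  - apply: integral0_eq => x [_ nZ].
    by rewrite /g indicE memNset// mul0e.
  - exact: measurable_unit_ball.
  - apply: measurable_funTS; apply: emeasurable_funM => //; apply/measurable_EFinP.
    apply: (measurableT_comp (@measurable_invr R)); apply: measurable_funX.
    exact: measurable_enorm.
  - move=> x _; rewrite mule_ge0// lee_fin invr_ge0 exprn_ge0// enorm_ge0//.
pose F (x : 'rV[R]_N) :=
  (\int[lebesgue_measure]_(s in `]0%R, 1%R[) g (s *: ((enorm x)^-1 *: x))%R)%E.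
move=> /esym/eqP; rewrite mule_eq0 eqe pnatr_eq0 eqn0Ngt N0/= => /eqP F0.
have mB := @measurable_unit_ball R N.
have mF : measurable_fun (@unit_ball R N) F.
  by apply: measurable_funTS; exact: measurable_ray_integral.
have Fge0 x : (0 <= F x)%E by exact: integral_ge0.
have [+ _] := @ae_eq_integral_abs _ _ _ (lebesgue_rV R N) _ mB _ mF.
under eq_integral do rewrite gee0_abs//.
move=> /(_ F0)[M [mM M0 FM]].
apply: contrapT => nray; move: B0; apply/negP; rewrite -leNgt.
rewrite -(adde0 0%E) -{1}M0 -(@lebesgue_rV_set0 R N N0).
apply: le_trans (measureU2 _ mM (@measurable_rV_set0 R N)).
apply: le_measure; rewrite ?inE//.
  by apply: measurableU => //; exact: measurable_rV_set0.
move=> x Bx; have [->|x0] := eqVneq x 0; [by right|left].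
apply: FM => /= /(_ Bx) Fx; apply: nray.
by exists ((enorm x)^-1 *: x); [exact: enorm_normalize|exact: Fx].
Qed.

(** The positive and the negative part of [G] are treated separately, so that
    no integrability has to be known beforehand. *)
Lemma integral_radial (R : realType) N (G : R -> R) :
  (1 < N)%N -> measurable_fun setT G ->
  (\int[lebesgue_rV R N]_(y in @unit_ball R N) (G (enorm y))%:E =
   N%:R%:E * (lebesgue_rV R N (@unit_ball R N) *
     \int[lebesgue_measure]_(s in `]0%R, 1%R[) (G s * s ^+ N.-1)%:E))%E.
Proof.
move=> N1 mG.
have mE : measurable_fun setT (EFin \o G) by exact/measurable_EFinP.
have Bf : lebesgue_rV R N (@unit_ball R N) \is a fin_num.
  by rewrite ge0_fin_numE ?lebesgue_rV_unit_ball_lty//; exact: measure_ge0.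
rewrite integralE [in RHS]integralE.
have E1 := @ge0_integral_radial R N _ N1 (measurable_funepos mE) (fun x => funepos_ge0 _ _).
have E2 := @ge0_integral_radial R N _ N1 (measurable_funeneg mE) (fun x => funeneg_ge0 _ _).
have -> : (\int[lebesgue_rV R N]_(x in @unit_ball R N)
    (fun x0 => (G (enorm x0))%:E)^\+ x = \int[lebesgue_rV R N]_(x in @unit_ball R N)
    (EFin \o G)^\+ (enorm x))%E.
  by apply: eq_integral => x _; rewrite !funeposE.
have -> : (\int[lebesgue_rV R N]_(x in @unit_ball R N)
    (fun x0 => (G (enorm x0))%:E)^\- x = \int[lebesgue_rV R N]_(x in @unit_ball R N)
    (EFin \o G)^\- (enorm x))%E.
  by apply: eq_integral => x _; rewrite !funenegE.
rewrite E1 E2.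
have P s : s \in (`]0, 1[%classic : set R) -> 0 <= s ^+ N.-1.
  by rewrite inE/= in_itv/= => /andP[s0 _]; rewrite exprn_ge0// ltW.
have -> : (\int[lebesgue_measure]_(s in `]0%R, 1%R[) (fun s => (G s * s ^+ N.-1)%:E)^\+ s =
   \int[lebesgue_measure]_(s in `]0%R, 1%R[) ((EFin \o G)^\+ s * (s ^+ N.-1)%:E))%E.
  apply: eq_integral => s /P s0; rewrite !funeposE /=.
  by rewrite -EFin_max -EFin_max -EFinM maxr_pMl// mul0r.
have -> : (\int[lebesgue_measure]_(s in `]0%R, 1%R[) (fun s => (G s * s ^+ N.-1)%:E)^\- s =
   \int[lebesgue_measure]_(s in `]0%R, 1%R[) ((EFin \o G)^\- s * (s ^+ N.-1)%:E))%E.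
  apply: eq_integral => s /P s0; rewrite !funenegE /=.
  by rewrite -EFin_max -EFin_max -EFinM maxr_pMl// mul0r mulNr.
have I0 (F : R -> \bar R) : (forall s, 0 <= F s)%E ->
    (0 <= \int[lebesgue_measure]_(s in `]0%R, 1%R[) (F s * (s ^+ N.-1)%:E))%E.
  move=> F0; apply: integral_ge0 => s /=; rewrite in_itv/= => /andP[s0 _].
  by rewrite mule_ge0// lee_fin exprn_ge0// ltW.
have := I0 _ (fun s => funepos_ge0 (EFin \o G) s).
have := I0 _ (fun s => funeneg_ge0 (EFin \o G) s).
move: (\int[_]_(s in _) _)%E (\int[_]_(s in _) _)%E => a b b0 a0.
rewrite !muleA -(fineK Bf) -EFinM.
have : 0 <= N%:R * fine (lebesgue_rV R N (@unit_ball R N)).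
  by rewrite mulr_ge0// fine_ge0// measure_ge0.
rewrite le_eqVlt => /predU1P[<-|]; first by rewrite !mul0e sube0.
move: (N%:R * _) => c c0.
case: a a0 => [a| |] a0 //; case: b b0 => [b| |] b0 //=.
- by change ((c * a - c * b)%:E = (c * (a - b))%:E); rewrite mulrBr.
- by rewrite gt0_muley ?gt0_muleNy.
- by rewrite gt0_muley.
- by rewrite gt0_muley ?gt0_muleNy.
Qed.

Lemma EFin_Rintegral d (T : measurableType d) (R : realType)
    (mu : {measure set T -> \bar R}) (D : set T) (f : T -> R) : measurable D ->
  mu.-integrable D (EFin \o f) ->
  (\int[mu]_(x in D) f x)%:E = (\int[mu]_(x in D) (f x)%:E)%E.
Proof. by move=> mD fi; rewrite fineK// integrable_fin_num. Qed.

Lemma integrable_measurable d (T : measurableType d) (R : realType)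
    (mu : {measure set T -> \bar R}) (D : set T) (f : T -> R) :
  mu.-integrable D (EFin \o f) -> measurable_fun D f.
Proof. by move=> fi; apply/measurable_EFinP/(measurable_int mu). Qed.

Lemma integrable_indic_mul d (T : measurableType d) (R : realType)
    (mu : {measure set T -> \bar R}) (D : set T) (f : T -> R) : measurable D ->
  mu.-integrable D (EFin \o f) ->
  mu.-integrable setT (fun x => ((\1_D x)%:E * (f x)%:E)%E).
Proof.
move=> mD; rewrite integrable_mkcond//; apply: eq_integrable => // x _.
by rewrite patchE indicE /=; case: ifPn => _; rewrite ?mul1e ?mul0e.
Qed.

Lemma integrable_mulb d (T : measurableType d) (R : realType)
    (mu : {measure set T -> \bar R}) (D : set T) (g m : T -> R) (K : R) :
  measurable D -> mu.-integrable D (EFin \o g) -> measurable_fun D m ->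
  (forall x, D x -> `|m x| <= K) ->
  mu.-integrable D (EFin \o (fun x => g x * m x)).
Proof.
move=> mD ig mm mK.
have mg := integrable_measurable ig.
apply: (le_integrable mD (f := EFin \o (fun x => g x * m x))
  (g := fun x => (K%:E * (g x)%:E)%E)) => //.
- by apply/measurable_EFinP; exact: measurable_funM.
- move=> x Dx /=; rewrite lee_fin !normrM mulrC ler_wpM2r//.
  by apply: le_trans (mK _ Dx) _; exact: ler_norm.
- exact: integrableZl.
Qed.

Lemma integrable_bounded d (T : measurableType d) (R : realType)
    (mu : {measure set T -> \bar R}) (D : set T) (m : T -> R) (K : R) :
  measurable D -> (mu D < +oo)%E -> measurable_fun D m ->
  (forall x, D x -> `|m x| <= K) -> mu.-integrable D (EFin \o m).
Proof.
move=> mD Dy mm mK; apply: measurable_bounded_integrable => //.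
exists K; split; first exact: num_real.
by move=> M KM x Dx; exact: le_trans (mK _ Dx) (ltW KM).
Qed.

Lemma lebesgue_itv01 (R : realType) :
  (lebesgue_measure (`]0%R, 1%R[%classic : set R) = 1)%E.
Proof. by rewrite lebesgue_measure_itv/= lte_fin ltr01 -EFinB subr0. Qed.

Lemma lebesgue_itv01_lty (R : realType) :
  (lebesgue_measure (`]0%R, 1%R[%classic : set R) < +oo)%E.
Proof. by rewrite lebesgue_measure_itv/= lte_fin ltr01 ltry. Qed.

(** Fubini's theorem in the form used for primitives: the kernels will be the
    indicators of [s <= |x|] and [|x| < s]. *)
Lemma fubini_kernel (R : realType) N (g : 'rV[R]_N -> R) (chi : R -> R)
    (k : 'rV[R]_N -> R -> R) (C : R) :
  (lebesgue_rV R N).-integrable (@unit_ball R N) (EFin \o g) ->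
  measurable_fun setT chi -> (forall s, `|chi s| <= C) ->
  measurable_fun setT (fun p : 'rV[R]_N * R => k p.1 p.2) ->
  (forall x s, `|k x s| <= 1) ->
  \int[lebesgue_rV R N]_(x in @unit_ball R N)
    (g x * \int[lebesgue_measure]_(s in `]0, 1[) (chi s * k x s)) =
  \int[lebesgue_measure]_(s in `]0, 1[)
    (chi s * \int[lebesgue_rV R N]_(x in @unit_ball R N) (g x * k x s)).
Proof.
move=> ig mchi chiC mk k1.
pose B := @unit_ball R N; pose I : set R := `]0, 1[%classic.
have mB : measurable B by exact: measurable_unit_ball.
have mI : measurable I by exact: measurable_itv.
pose gB := g \_ B.
have mgB : measurable_fun setT gB.
  exact: (measurable_restrictT g mB).1 (integrable_measurable ig).
pose f (p : 'rV[R]_N * R) : \bar R := (gB p.1 * (\1_I p.2 * (chi p.2 * k p.1 p.2)))%:E.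
have mf : measurable_fun setT f.
  apply/measurable_EFinP; apply: measurable_funM.
    exact: (measurableT_comp mgB measurable_fst).
  apply: measurable_funM; first exact: (measurableT_comp (measurable_indic mI) measurable_snd).
  by apply: measurable_funM => //; exact: (measurableT_comp mchi measurable_snd).
have igB : (lebesgue_rV R N).-integrable setT (EFin \o gB).
  by rewrite /gB -restrict_EFin -integrable_mkcond.
have mk1 x : measurable_fun setT (k x).
  exact: (measurableT_comp mk (pair1_measurable x)).
have mk2 s : measurable_fun setT (k ^~ s).
  exact: (measurableT_comp mk (pair2_measurable s)).
have ick x : lebesgue_measure.-integrable I (EFin \o (fun s => chi s * k x s)).
  apply: (integrable_bounded (K := C)) => //.
  - exact: lebesgue_itv01_lty.
  - by apply: measurable_funTS; apply: measurable_funM => //; exact: mk1.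
  - move=> s _; rewrite normrM -[leRHS]mulr1.
    by rewrite ler_pM.
have igk s : (lebesgue_rV R N).-integrable B (EFin \o (fun x => g x * k x s)).
  by apply: (integrable_mulb (K := 1)) => //; exact: measurable_funTS.
have E1 x : (\int[lebesgue_measure]_s f (x, s) =
    (gB x * \int[lebesgue_measure]_(s in I) (chi s * k x s))%:E)%E.
  rewrite EFinM (EFin_Rintegral (mI : measurable (I : set (measurableTypeR R))) (ick x)).
  rewrite [in RHS]integral_indicE.
  rewrite -integralZl//; last exact: integrable_indic_mul.
have E2 s : (\int[lebesgue_rV R N]_x f (x, s) =
    (\1_I s * (chi s * \int[lebesgue_rV R N]_(x in B) (g x * k x s)))%:E)%E.
  rewrite mulrA EFinM (EFin_Rintegral mB (igk s)) [in RHS]integral_indicE.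
  rewrite -integralZl//; last exact: integrable_indic_mul.
  apply: eq_integral => x _; rewrite /f /= -!EFinM; congr (_%:E).
  have -> : gB x = \1_B x * g x.
    by rewrite /gB patchE indicE; case: ifP; rewrite /= ?mul1r ?mul0r.
  by ring.
have fi : (lebesgue_rV R N \x lebesgue_measure)%E.-integrable setT f.
  apply/(@integrable12ltyP _ _ _ (measurableTypeR R) _ (lebesgue_rV R N) lebesgue_measure f mf).
  have C0 : 0 <= C by apply: le_trans (chiC 0).
  apply: (@le_lt_trans _ _ (\int[lebesgue_rV R N]_x (C%:E * `|gB x|%:E))%E).
    apply: ge0_le_integral => //.
    - by move=> x _; exact: integral_ge0.
    - have maf : measurable_fun setT (fun p => `|f p|%E) by exact: measurableT_comp.
      exact: (@measurable_fun_fubini_tonelli_F _ _ _ (measurableTypeR R) _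
        lebesgue_measure _ maf).
    - by apply: measurable_funeM; apply/measurable_EFinP; exact: measurableT_comp.
    - move=> x _.
      apply: (@le_trans _ _ (\int[lebesgue_measure]_(s in I) (C * `|gB x|)%:E)%E).
        rewrite [leRHS]integral_indicE; apply: ge0_le_integral => //.
        + apply: measurableT_comp => //.
          exact: (measurableT_comp mf (pair1_measurable x)).
        + by apply: emeasurable_funM => //; apply/measurable_EFinP; exact: measurable_indic.
        + move=> s _; rewrite /f -EFinM abse_EFin lee_fin !normrM mulrCA.
          rewrite [`|\1_I s|]ger0_norm ?indicE// ler_wpM2l// mulrC ler_wpM2r//.
          by rewrite -[leRHS]mulr1 ler_pM.
      rewrite integral_cst// [X in (_ * X)%E](_ : _ = 1%E) ?mule1//.
      exact: lebesgue_itv01.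
  rewrite ge0_integralZl//.
  - rewrite lte_mul_pinfty//.
    by have /integrableP[] := igB.
  - by apply/measurable_EFinP; exact: measurableT_comp.
have := @Fubini _ _ _ (measurableTypeR R) _ (lebesgue_rV R N) lebesgue_measure f fi.
under eq_integral do rewrite E1; under [in RHS]eq_integral do rewrite E2.
move=> /(congr1 fine) E.
rewrite [LHS]Rintegral_mkcond [RHS]Rintegral_mkcond.
transitivity (fine (\int[lebesgue_rV R N]_x
   (gB x * \int[lebesgue_measure]_(s in I) (chi s * k x s))%:E)%E).
  congr fine; apply: eq_integral => x _.
  by rewrite /gB !patchE; case: ifP; rewrite ?mul0r.
rewrite E; congr fine; apply: eq_integral => s _.
by rewrite patchE indicE; case: ifP; rewrite /= ?mul0r ?mul1r.
Qed.

(** * Smooth functions *)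

Lemma is_derive_of_line (R : realType) (V : normedModType R) (F : V -> R)
    (x v : V) (d : R) :
  is_derive (0 : R) (1 : R) (fun t : R => F (x + t *: v)) d -> is_derive x v F d.
Proof.
move=> [dF dE].
have E : (fun t : R => t^-1 *: (((fun t => F (x + t *: v)) \o shift 0) (t *: 1)
    - F (x + 0 *: v))) =
  (fun t => t^-1 *: ((F \o shift x) (t *: v) - F x)).
  apply/funext => t /=; rewrite addr0 scale0r addr0.
  have -> : t *: (1 : R) = t by exact: mulr1.
  by rewrite (addrC x).
split; first by rewrite /derivable -E.
by rewrite /derive -E.
Qed.

(** Used at the points where a formula for the derivative breaks down but the
    function is flat: the origin for [exp (- 1 / y)] and for [|y|^(q+2)]. *)
Lemma der_quadratic (R : realType) (f : R -> R) (C : R) :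
  (forall h, `|f h| <= C * h ^+ 2) -> is_derive (0 : R) (1 : R) f 0.
Proof.
move=> fC.
have C0 : 0 <= C by have := fC 1; rewrite expr1n mulr1; exact: le_trans.
have f0 : f 0 = 0.
  by apply/eqP; rewrite -normr_le0; have := fC 0; rewrite expr0n mulr0.
have : h^-1 *: ((f \o shift 0) (h *: 1) - f 0) @[h --> 0^'] --> (0 : R).
  apply/cvgrPdist_le => e e0; near=> h.
  have h0 : h != 0 by near: h; exact: nbhs_dnbhs_neq.
  have -> : h *: (1 : R) = h by exact: mulr1.
  rewrite sub0r normrN f0 subr0 /= addr0 normrM normfV.
  rewrite mulrC ler_pdivrMr ?normr_gt0//.
  apply: (le_trans (fC h)); rewrite -real_normK ?num_real// expr2 mulrA.
  rewrite ler_wpM2r//.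
  apply: (@le_trans _ _ ((C + 1) * `|h|)); first by rewrite ler_wpM2r// lerDl.
  rewrite mulrC -ler_pdivlMr ?ltr_wpDl//.
  near: h; apply: dnbhs0_le; by rewrite divr_gt0// ltr_wpDl.
move=> h; split; first by apply/cvg_ex; exists 0.
exact: (cvg_lim (@Rhausdorff R) h).
Unshelve. all: by end_near. Qed.

(** [flat k] is [y ^- k * exp (- 1 / y)] extended by zero: the derivatives of
    [flat 0] are combinations of these functions. *)
Definition flat (R : realType) (k : nat) (y : R) : R :=
  if 0 < y then y ^- k * expR (- y^-1) else 0.

(** The exponential series dominates any power of [1 / y]. *)
Lemma flat_le (R : realType) k (y : R) :
  `|flat k y| <= (k.+2)`!%:R * y ^+ 2.
Proof.
rewrite /flat; case: ifPn => y0; last first.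
  by rewrite normr0 mulr_ge0// sqr_ge0.
rewrite ger0_norm; last by rewrite mulr_ge0 ?expR_ge0// invr_ge0 exprn_ge0// ltW.
have : y^-1 ^+ k.+2 / (k.+2)`!%:R <= expR y^-1.
  have yi : 0 <= y^-1 by rewrite invr_ge0 ltW.
  by have := expR_ge1Dxn k.+1 yi; apply: le_trans; rewrite lerDr.
rewrite expRN ler_pdivrMr// => h.
rewrite ler_pdivrMr ?expR_gt0//.
have -> : y ^- k = y ^+ 2 * y^-1 ^+ k.+2.
  by rewrite exprVn -[k.+2]addn2 exprD; field; rewrite expf_neq0 gt_eqF.
apply: (le_trans (ler_wpM2l (sqr_ge0 y) h)).
by rewrite le_eqVlt; apply/orP; left; apply/eqP; ring.
Qed.

Lemma is_derive_flat (R : realType) k (y : R) :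
  is_derive y 1 (@flat R k) (- k%:R * flat k.+1 y + flat k.+2 y).
Proof.
have [y0|y0|->] := ltgtP y 0.
- have F0 j z : z < 0 -> @flat R j z = 0 by move=> z0; rewrite /flat ltNge ltW.
  rewrite !F0// mulr0 addr0.
  apply: (near_eq_is_derive (f := cst (0 : R))) => //.
    near=> z; rewrite F0//; near: z; exact: lt_nbhsl.
- have yn0 : y != 0 by rewrite gt_eqF.
  have yk0 j : y ^+ j != 0 by rewrite expf_neq0.
  apply: (near_eq_is_derive (f := fun z : R => (z ^+ k)^-1 * expR (- z^-1))) => //.
    near=> z; rewrite /flat ifT//; near: z; exact: lt_nbhsr.
  apply: is_derive_eq (derM (derV (f := fun z => z ^+ k) (yk0 k) (derX k (der_id y)))
    (der_exp (derN (derV (f := fun z => z) yn0 (der_id y))))) _.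
  rewrite /flat !ifT//.
  case: k => [|k]; first by rewrite !expr0; field.
  rewrite -[k.+1.-1]/k !exprS.
  move: (k.+1%:R : R) (y ^+ k) (yk0 k) (expR (- y^-1)) => m z z0 e; field.
  by rewrite yn0 z0.
have F0 j : @flat R j 0 = 0 by rewrite /flat ltxx.
rewrite !F0 mulr0 addr0.
apply: der_quadratic; exact: flat_le.
Unshelve. all: by end_near. Qed.

(** A class of smooth functions of one variable that contains bumps and their
    primitives and is stable under differentiation. Division by the variable
    is included, for functions vanishing near the origin, because
    differentiating [chi (|x|)] produces [chi' (|x|) / |x|]. *)
Inductive sm (R : realType) : (R -> R) -> Prop :=
| sm_cst c : sm (fun=> c)
| sm_flat k c d : sm (fun s => flat k (c * s + d))
| sm_add f g : sm f -> sm g -> sm (fun s => f s + g s)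
| sm_mul f g : sm f -> sm g -> sm (fun s => f s * g s)
| sm_prim f F : sm f -> (forall s : R, is_derive s 1 F (f s)) -> sm F
| sm_div f a : sm f -> 0 < a -> (forall s, s < a -> f s = 0) ->
    sm (fun s => f s / s).

Lemma sm_derive (R : realType) (f : R -> R) : sm f ->
  exists2 g, sm g & forall s : R, is_derive s 1 f (g s).
Proof.
elim=> {f} [c|k c d|f g _ [f' sf' df] _ [g' sg' dg]|f g sf [f' sf' df] sg [g' sg' dg]
  |f F sf _ dF|f a sf [f' sf' df] a0 fa].
- exists (fun=> 0); [exact: sm_cst|move=> s; exact: der_cst].
- exists (fun s => (- k%:R * flat k.+1 (c * s + d) + flat k.+2 (c * s + d)) * c).
    apply: sm_mul; last exact: sm_cst.
    apply: sm_add; last exact: sm_flat.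
    by apply: sm_mul; [exact: sm_cst|exact: sm_flat].
  move=> s; apply: is_derive_eq (der_comp (is_derive_flat _ _)
    (derD (derZ c (der_id s)) (der_cst d s))) _.
  by rewrite mulr1 addr0.
- exists (fun s => f' s + g' s); first exact: sm_add.
  by move=> s; exact: derD.
- exists (fun s => f' s * g s + f s * g' s).
    by apply: sm_add; exact: sm_mul.
  by move=> s; exact: derM.
- by exists f.
have f'a s : s < a -> f' s = 0.
  move=> sa; have h0 : is_derive s 1 f 0.
    apply: (near_eq_is_derive (f := cst (0 : R))) => //.
      near=> z; rewrite fa//; near: z; exact: lt_nbhsl.
  by rewrite -(@derive_val _ _ _ _ _ _ _ (df s)) (@derive_val _ _ _ _ _ _ _ h0).
exists (fun s => f' s / s + -1 * (f s / s / s)).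
  apply: sm_add; first exact: (sm_div sf' a0).
  apply: sm_mul; first exact: sm_cst.
  by apply: (sm_div (sm_div sf a0 fa) a0) => s sa; rewrite fa// mul0r.
move=> s; have [sa|sa] := ltP s a.
  rewrite f'a// fa// !mul0r mulr0 addr0.
  apply: (near_eq_is_derive (f := cst (0 : R))) => //.
    near=> z; rewrite fa ?mul0r//; near: z; exact: lt_nbhsl.
have s0 : s != 0 by rewrite gt_eqF// (lt_le_trans a0).
apply: is_derive_eq (derM (df s) (derV (f := fun z => z) s0 (der_id s))) _.
by field.
Unshelve. all: by end_near. Qed.

Lemma sm_continuous (R : realType) (f : R -> R) : sm f -> continuous f.
Proof. by move=> /sm_derive[g _ df] x; exact: der_cvg (df x). Qed.

(** [bump a b n] increases with [n] to the indicator of [`]a, b[]. *)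
Definition bump (R : realType) (a b : R) (n : nat) (s : R) : R :=
  flat 0 (n.+1%:R * s + - (n.+1%:R * a)) * flat 0 (- n.+1%:R * s + n.+1%:R * b).

Lemma sm_bump (R : realType) (a b : R) n : sm (bump a b n).
Proof. by apply: sm_mul; exact: sm_flat. Qed.

Lemma flat0_ge0 (R : realType) (y : R) : 0 <= flat 0 y.
Proof.
by rewrite /flat; case: ifP => // y0; rewrite expr0 invr1 mul1r expR_ge0.
Qed.

Lemma flat0_le1 (R : realType) (y : R) : flat 0 y <= 1.
Proof.
rewrite /flat; case: ifP => // y0; rewrite expr0 invr1 mul1r expR_le1.
by rewrite oppr_le0 invr_ge0 ltW.
Qed.

Lemma bump_ge0 (R : realType) (a b : R) n s : 0 <= bump a b n s.
Proof. by rewrite mulr_ge0// flat0_ge0. Qed.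

Lemma bump_le1 (R : realType) (a b : R) n s : bump a b n s <= 1.
Proof. by rewrite -[leRHS]mulr1 ler_pM ?flat0_ge0 ?flat0_le1. Qed.

Lemma bump_eq0l (R : realType) (a b : R) n s : s <= a -> bump a b n s = 0.
Proof.
move=> sa; rewrite /bump {1}/flat ifF ?mul0r//; apply/negbTE; rewrite -leNgt.
by rewrite -mulrBr pmulr_rle0// subr_le0.
Qed.

Lemma bump_eq0r (R : realType) (a b : R) n s : b <= s -> bump a b n s = 0.
Proof.
move=> sa; rewrite /bump {2}/flat ifF ?mulr0//; apply/negbTE; rewrite -leNgt.
by rewrite mulNr addrC -mulrBr pmulr_rle0// subr_le0.
Qed.

Lemma cvg_flat0 (R : realType) (y : R) : 0 < y ->
  flat 0 (n.+1%:R * y) @[n --> \oo] --> (1 : R).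
Proof.
move=> y0.
have -> : (fun n => flat 0 (n.+1%:R * y)) = (fun n => expR (- (y^-1 * (n.+1%:R)^-1))).
  apply/funext => n; rewrite /flat ifT ?mulr_gt0//.
  by rewrite expr0 invr1 mul1r invfM mulrC.
have h : - (y^-1 * n.+1%:R^-1) @[n --> \oo] --> (0 : R).
  rewrite -[X in _ --> X]oppr0; apply: cvgN; rewrite -[X in _ --> X](mulr0 y^-1).
  by apply: cvgM; [exact: cvg_cst|exact: cvg_harmonic].
have := cvg_comp _ _ h (@continuous_expR R 0).
by rewrite expR0.
Qed.

Lemma cvg_bump (R : realType) (a b s : R) :
  bump a b n s @[n --> \oo] --> (\1_(`]a, b[%classic : set R) s : R).
Proof.
have [sa|sa] := leP s a.
  rewrite indicE memNset; last by rewrite /= in_itv/= ltNge sa.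
  by under eq_fun do rewrite bump_eq0l//; exact: cvg_cst.
have [sb|sb] := leP b s.
  rewrite indicE memNset; last by rewrite /= in_itv/= [s < b]ltNge sb andbF.
  by under eq_fun do rewrite bump_eq0r//; exact: cvg_cst.
rewrite indicE mem_set/=; last by rewrite in_itv/= sa.
rewrite -[X in _ --> X]mulr1; apply: cvgM.
  under eq_fun do rewrite -mulrBr.
  by apply: cvg_flat0; rewrite subr_gt0.
under eq_fun do rewrite mulNr addrC -mulrBr.
by apply: cvg_flat0; rewrite subr_gt0.
Qed.

(** Partial derivatives of smooth radial functions are no longer radial;
    adding the coordinates makes the class stable under differentiation,
    whence its members are smooth. *)
Inductive elem (R : realType) N : ('rV[R]_N -> R) -> Prop :=
| elem_cst c : elem (fun=> c)
| elem_coord i : elem (fun x => x ord0 i)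
| elem_rad chi a : sm chi -> 0 < a -> (forall s, s < a -> chi s = 0) ->
    elem (fun x => chi (enorm x))
| elem_add f g : elem f -> elem g -> elem (fun x => f x + g x)
| elem_mul f g : elem f -> elem g -> elem (fun x => f x * g x).

Lemma sqnorm_line (R : realType) N (i : 'I_N) (x : 'rV[R]_N) (t : R) :
  sqnorm (x + t *: delta_mx ord0 i) = sqnorm x + 2 * t * x ord0 i + t ^+ 2.
Proof.
rewrite /sqnorm (bigD1 i)//= [in RHS](bigD1 i)//=.
rewrite (eq_bigr (fun j => x ord0 j ^+ 2)).
  by rewrite !mxE !eqxx/=; ring.
by move=> j ji; rewrite !mxE eqxx (negbTE ji)/= mulr0 addr0.
Qed.

Lemma is_derive_sqnorm (R : realType) N (i : 'I_N) (x : 'rV[R]_N) :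
  is_derive x (delta_mx ord0 i) (@sqnorm R N) (2 * x ord0 i).
Proof.
apply: is_derive_of_line; under eq_fun do rewrite sqnorm_line.
apply: is_derive_eq (derD (derD (der_cst (sqnorm x) (0 : R))
  (derM (derZ 2 (der_id (0 : R))) (der_cst (x ord0 i) 0))) (derX 2 (der_id (0 : R)))) _.
by rewrite /=; ring.
Qed.

Lemma is_derive_compR (R : realType) N (i : 'I_N) (f : R -> R) (g : 'rV[R]_N -> R) (x : 'rV[R]_N)
    (a b : R) :
  is_derive (g x) 1 f a -> is_derive x (delta_mx ord0 i) g b ->
  is_derive x (delta_mx ord0 i) (fun y => f (g y)) (a * b).
Proof.
move=> df dg; apply: is_derive_of_line.
have dgl : is_derive (0 : R) (1 : R) (fun t : R => g (x + t *: delta_mx ord0 i)) b.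
  have := @is_derive_line R _ g x (delta_mx ord0 i) 0.
  rewrite scale0r addr0 => h.
  apply: is_derive_eq (h (@ex_derive _ _ _ _ _ _ _ dg)) _.
  exact: (@derive_val _ _ _ _ _ _ _ dg).
apply: (der_comp (g := fun t => g (x + t *: delta_mx ord0 i)) _ dgl).
by rewrite scale0r addr0.
Qed.

Lemma is_derive_enorm (R : realType) N (i : 'I_N) (x : 'rV[R]_N) : x != 0 ->
  is_derive x (delta_mx ord0 i) (@enorm R N) (x ord0 i / enorm x).
Proof.
move=> x0; have sx : 0 < sqnorm x by rewrite -enorm_sqr exprn_gt0// enorm_gt0.
apply: is_derive_eq (is_derive_compR (is_derive1_sqrt sx) (is_derive_sqnorm i x)) _.
rewrite -/(enorm x) invfM; field.
by rewrite enorm_eq0.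
Qed.

Lemma continuous_sqnorm (R : realType) N : continuous (@sqnorm R N).
Proof.
apply: continuous_big => [|i _]; first exact: add_continuous.
move=> x; apply: (@cvg_comp _ _ _ (fun x : 'rV[R]_N => x ord0 i) (fun y => y ^+ 2)).
  exact: coord_continuous.
exact: exprn_continuous.
Qed.

Lemma continuous_enorm (R : realType) N : continuous (@enorm R N).
Proof.
move=> x; exact: (continuous_comp (@continuous_sqnorm R N x) (@sqrt_continuous R _)).
Qed.

Lemma elem_continuous (R : realType) N (f : 'rV[R]_N -> R) : elem f -> continuous f.
Proof.
elim=> {f} [c|i|chi a schi _ _|f g _ cf _ cg|f g _ cf _ cg] x.
- exact: cst_continuous.
- exact: coord_continuous.
- rewrite /continuous_at; apply: (cvg_comp (@enorm R N) chi).
    exact: continuous_enorm.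
  exact: sm_continuous.
- by apply: continuousD; [exact: cf|exact: cg].
- by apply: continuousM; [exact: cf|exact: cg].
Qed.

Lemma is_derive_coord (R : realType) N (i j : 'I_N) (x : 'rV[R]_N) :
  is_derive x (delta_mx ord0 i) (fun y : 'rV[R]_N => y ord0 j) (j == i)%:R.
Proof.
apply: is_derive_of_line.
have -> : (fun t : R => (x + t *: delta_mx ord0 i) ord0 j) =
    (fun t => x ord0 j + (j == i)%:R * t).
  by apply/funext => t; rewrite !mxE eqxx/= mulrC.
apply: is_derive_eq (derD (der_cst (x ord0 j) (0 : R)) (derZ _ (der_id (0 : R)))) _.
by rewrite mulr1 add0r.
Qed.

Lemma sm_derive_eq0 (R : realType) (f f' : R -> R) (a c : R) :
  (forall s : R, is_derive s 1 f (f' s)) -> (forall s, s < a -> f s = c) ->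
  forall s, s < a -> f' s = 0.
Proof.
move=> df fa s sa; have h0 : is_derive s 1 f 0.
  apply: (near_eq_is_derive (f := cst c)) => //.
  by near=> z; rewrite fa//; near: z; exact: lt_nbhsl.
by rewrite -(@derive_val _ _ _ _ _ _ _ (df s)) (@derive_val _ _ _ _ _ _ _ h0).
Unshelve. all: by end_near. Qed.

(** At the origin, where the norm is not differentiable, the function is
    locally constant. *)
Lemma is_derive_radial (R : realType) N (i : 'I_N) (f f' : R -> R) (a c : R)
    (x : 'rV[R]_N) : 0 < a ->
  (forall s : R, is_derive s 1 f (f' s)) -> (forall s, s < a -> f s = c) ->
  is_derive x (delta_mx ord0 i) (fun y => f (enorm y)) (f' (enorm x) / enorm x * x ord0 i).
Proof.
move=> a0 df fa; have [->|x0] := eqVneq x 0.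
  rewrite mxE mulr0.
  apply: (near_eq_is_derive (f := cst c)) => //.
  near=> z; rewrite fa//; near: z.
  have : \forall y \near enorm (0 : 'rV[R]_N), y < a.
    by apply: lt_nbhsl; rewrite enorm0.
  exact: (@continuous_enorm R N 0).
apply: is_derive_eq (is_derive_compR (df _) (is_derive_enorm i x0)) _.
by rewrite mulrCA mulrC.
Unshelve. all: by end_near. Qed.

Lemma elem_derive (R : realType) N (f : 'rV[R]_N -> R) (i : 'I_N) : elem f ->
  exists2 g, elem g & forall x, is_derive x (delta_mx ord0 i) f (g x).
Proof.
elim=> {f} [c|j|chi a schi a0 chia|f g _ [f' sf' df] _ [g' sg' dg]|
  f g sf [f' sf' df] sg [g' sg' dg]].
- exists (fun=> 0); first exact: elem_cst.
  by move=> x; exact: is_derive_cst.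
- exists (fun=> (j == i)%:R); first exact: elem_cst.
  by move=> x; exact: is_derive_coord.
- have [chi' schi' dchi] := sm_derive schi.
  have chi'a := sm_derive_eq0 dchi chia.
  exists (fun x => chi' (enorm x) / enorm x * x ord0 i).
    apply: elem_mul; last exact: elem_coord.
    have chi'a' s : s < a -> chi' s / s = 0 by move=> sa; rewrite chi'a// mul0r.
    exact: (@elem_rad R N (fun s => chi' s / s) a (sm_div schi' a0 chi'a) a0 chi'a').
  by move=> x; exact: is_derive_radial dchi chia.
- by exists (fun x => f' x + g' x); [exact: elem_add|move=> x; exact: is_deriveD].
- exists (fun x => f' x * g x + f x * g' x).
    by apply: elem_add; exact: elem_mul.
  move=> x; apply: is_derive_eq (is_deriveM (df x) (dg x)) _.
  by rewrite addrC mulrC.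
Qed.

Lemma elem_partial (R : realType) N (f : 'rV[R]_N -> R) (i : 'I_N) : elem f ->
  elem (partial i f) /\ forall x, derivable f x (delta_mx ord0 i).
Proof.
move=> /(elem_derive i)[g eg dg].
have -> : partial i f = g.
  by apply/funext => x; exact: (@derive_val _ _ _ _ _ _ _ (dg x)).
by split=> // x; exact: (@ex_derive _ _ _ _ _ _ _ (dg x)).
Qed.

Lemma elem_smooth (R : realType) N (f : 'rV[R]_N -> R) : elem f -> smooth f.
Proof.
move=> ef s /=.
have es : elem (foldr (@partial R N) f s).
  by elim: s => //= i s IH; exact: (elem_partial i IH).1.
split; first exact: elem_continuous.
by move=> i x; exact: (elem_partial i es).2.
Qed.

Lemma normr_le_enorm (R : realType) N (x : 'rV[R]_N) : `|x| <= enorm x.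
Proof.
rewrite [`|x|]mx_normrE; apply: bigmax_le; first exact: enorm_ge0.
by move=> [i j] _ /=; rewrite (ord1 i); exact: normr_coord_le_enorm.
Qed.

Lemma closed_enorm_le (R : realType) N (b : R) :
  closed [set x : 'rV[R]_N | enorm x <= b].
Proof.
have := @preimage_closed _ _ (@enorm R N) [set y | y <= b].
apply; last exact: closed_le.
by move=> x _; exact: continuous_enorm.
Qed.

(** Constancy near the origin is enough: only the value [c] has to be
    subtracted to enter the class [elem]. *)
Lemma test_function_radial (R : realType) N (f : R -> R) (a b c : R) :
  sm f -> 0 < a -> b < 1 -> (forall s, s < a -> f s = c) ->
  (forall s, b < s -> f s = 0) ->
  test_function (fun x : 'rV[R]_N => f (enorm x)).
Proof.
move=> sf a0 b1 fa fb.
have ef : elem (fun x : 'rV[R]_N => f (enorm x)).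
  have -> : (fun x : 'rV[R]_N => f (enorm x)) = (fun x => c + (f (enorm x) + - c)).
    by apply/funext => x; rewrite addrC subrK.
  apply: elem_add; first exact: elem_cst.
  apply: (@elem_rad _ _ (fun s => f s + - c) a) => //.
    by apply: sm_add => //; exact: sm_cst.
  by move=> s sa; rewrite fa// subrr.
have supp : closure [set x : 'rV[R]_N | f (enorm x) != 0] `<=` [set x | enorm x <= b].
  rewrite [X in _ `<=` X]((closure_id _).1 (@closed_enorm_le R N b)).
  apply: closureS => x /=.
  by apply: contraNT; rewrite -ltNge => /fb ->.
split; first exact: elem_smooth.
- apply: (subclosed_compact _ (_ : compact [set x : 'rV[R]_N | enorm x <= b]) supp).
    exact: closed_closure.
  apply: bounded_closed_compact; last exact: closed_enorm_le.
  exists b; split; first exact: num_real.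
  move=> M bM x /= xb; apply: le_trans (normr_le_enorm x) _.
  exact: le_trans xb (ltW bM).
- by apply: (subset_trans supp) => x /= xb; exact: le_lt_trans b1.
Qed.

Lemma sm_primitive (R : realType) (f : R -> R) (a : R) : 0 < a -> sm f ->
  (forall s, s < a -> f s = 0) ->
  exists F, [/\ sm F, forall s : R, is_derive s 1 F (f s) &
    forall s, s < a -> F s = 0].
Proof.
move=> a0 sf fa.
pose F s := \int[lebesgue_measure]_(t in `[0, s]) f t.
have F0 s : s < a -> F s = 0.
  move=> sa; rewrite /F /Rintegral integral0_eq// => t /=.
  by rewrite in_itv/= => /andP[_ ts]; rewrite fa// (le_lt_trans ts).
have dF (s : R) : is_derive s 1 F (f s).
  have [sa|sa] := ltP s a.
    rewrite fa//; apply: (near_eq_is_derive (f := cst (0 : R))) => //.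
    by near=> z; rewrite F0//; near: z; exact: lt_nbhsl.
  have s0 : 0 < s by exact: lt_le_trans sa.
  have cf := sm_continuous sf.
  have s1 : s < s + 1 by rewrite ltrDl.
  have fi : lebesgue_measure.-integrable `[0, s + 1] (EFin \o f).
    apply: continuous_compact_integrable; first exact: segment_compact.
    exact: continuous_subspaceT.
  have [dF Fs] := continuous_FTC1_closed s1 fi s0 (cf s).
  by split; [exact: dF|rewrite -derive1E; exact: Fs].
exists F; split=> //.
exact: sm_prim dF.
Unshelve. all: by end_near. Qed.

(** * Integration by parts in H^1_0 of the ball *)

Lemma continuous_addf (R : realType) (T : topologicalType) (f g : T -> R) :
  continuous f -> continuous g -> continuous (fun x => f x + g x).
Proof. by move=> cf cg x; apply: continuousD; [exact: cf|exact: cg]. Qed.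

Lemma continuous_mulf (R : realType) (T : topologicalType) (f g : T -> R) :
  continuous f -> continuous g -> continuous (fun x => f x * g x).
Proof. by move=> cf cg x; apply: continuousM; [exact: cf|exact: cg]. Qed.

Lemma continuous_invf (R : realType) (T : topologicalType) (f : T -> R) :
  (forall x, f x != 0) -> continuous f -> continuous (fun x => (f x)^-1).
Proof.
move=> f0 cf x; rewrite /continuous_at; apply: (cvg_comp f (fun y => y^-1)); first exact: cf.
exact: inv_continuous.
Qed.

Lemma integrable_addr d (T : measurableType d) (R : realType)
    (mu : {measure set T -> \bar R}) (D : set T) (f g : T -> R) : measurable D ->
  mu.-integrable D (EFin \o f) -> mu.-integrable D (EFin \o g) ->
  mu.-integrable D (EFin \o (fun x => f x + g x)).
Proof. by move=> mD fi gi; apply: (integrableD mD fi gi). Qed.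

Lemma integrable_subr d (T : measurableType d) (R : realType)
    (mu : {measure set T -> \bar R}) (D : set T) (f g : T -> R) : measurable D ->
  mu.-integrable D (EFin \o f) -> mu.-integrable D (EFin \o g) ->
  mu.-integrable D (EFin \o (fun x => f x - g x)).
Proof. by move=> mD fi gi; apply: (integrableB mD fi gi). Qed.

Lemma integrable_mulrl d (T : measurableType d) (R : realType)
    (mu : {measure set T -> \bar R}) (D : set T) (f : T -> R) (c : R) : measurable D ->
  mu.-integrable D (EFin \o f) ->
  mu.-integrable D (EFin \o (fun x => c * f x)).
Proof. by move=> mD fi; apply: (integrableZl mD c fi). Qed.

(** Only the derivative in the direction [i] is required, since each component
    of a vector field is integrated by parts separately. *)
Definition C1c (R : realType) N (i : 'I_N) (phi : 'rV[R]_N -> R) :=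
  [/\ continuous phi, forall x, derivable phi x (delta_mx ord0 i),
      continuous (partial i phi), compact (closure [set x | phi x != 0]) &
      closure [set x | phi x != 0] `<=` @unit_ball R N].

Lemma test_function_C1c (R : realType) N (i : 'I_N) (phi : 'rV[R]_N -> R) :
  test_function phi -> C1c i phi.
Proof.
move=> [sphi cphi bphi]; split => //.
- exact: (sphi [::]).1.
- exact: (sphi [::]).2.
- exact: (sphi [:: i]).1.
Qed.

Lemma continuous_bounded_on (R : realType) N (K : set 'rV[R]_N) (f : 'rV[R]_N -> R) :
  compact K -> continuous f -> exists C, forall x, K x -> `|f x| <= C.
Proof.
move=> cK cf.
have cfK : compact (f @` K).
  by apply: continuous_compact => //; exact: continuous_subspaceT.
have [M [_ MP]] := compact_bounded cfK.
exists (M + 1) => x Kx; apply: (MP (M + 1)); first by rewrite ltrDl.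
by exists x.
Qed.

Lemma continuous_bounded_ball (R : realType) N (f : 'rV[R]_N -> R) :
  continuous f -> exists C, forall x, unit_ball x -> `|f x| <= C.
Proof.
move=> cf; have cK : compact [set x : 'rV[R]_N | enorm x <= 1].
  apply: bounded_closed_compact; last exact: closed_enorm_le.
  exists 1; split; first exact: num_real.
  move=> M bM x /= xb; apply: le_trans (normr_le_enorm x) _.
  exact: le_trans xb (ltW bM).
have [C CP] := continuous_bounded_on cK cf.
by exists C => x Bx; apply: CP => /=; exact: ltW.
Qed.

Lemma C1c_bounded (R : realType) N (i : 'I_N) (phi : 'rV[R]_N -> R) :
  C1c i phi -> exists C, forall x, `|phi x| <= C /\ `|partial i phi x| <= C.
Proof.
move=> [c1 d1 cp cK KB].
have [C1 C1P] := continuous_bounded_on cK c1.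
have [C2 C2P] := continuous_bounded_on cK cp.
pose C := Num.max 0 (Num.max C1 C2).
have C0 : 0 <= C by rewrite le_max lexx.
exists C => x; have [Kx|nKx] := pselect (closure [set x | phi x != 0] x).
  by split; rewrite !le_max ?C1P ?C2P ?orbT.
rewrite partial_eq0// normr0; split => //.
suff -> : phi x = 0 by rewrite normr0.
by apply/eqP/negPn/negP => px; apply: nKx; exact: subset_closure.
Qed.

(** The product with a field that is differentiable along [i] stays in the
    class, which turns the divergence theorem into integration by parts. *)
Lemma C1c_mul (R : realType) N (i : 'I_N) (phi X dX : 'rV[R]_N -> R) :
  C1c i phi -> continuous X -> continuous dX ->
  (forall x, is_derive x (delta_mx ord0 i) X (dX x)) ->
  C1c i (fun x => phi x * X x) /\
  forall x, partial i (fun x => phi x * X x) x = partial i phi x * X x + phi x * dX x.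
Proof.
move=> [c1 d1 cp cK KB] cX cdX ddX.
have dphi x : is_derive x (delta_mx ord0 i) phi (partial i phi x).
  exact: derivableP.
have dM x : is_derive x (delta_mx ord0 i) (fun x => phi x * X x)
    (partial i phi x * X x + phi x * dX x).
  apply: is_derive_eq (is_deriveM (dphi x) (ddX x)) _.
  by rewrite addrC mulrC.
have pE x : partial i (fun x => phi x * X x) x = partial i phi x * X x + phi x * dX x.
  exact: (@derive_val _ _ _ _ _ _ _ (dM x)).
have sub : closure [set x | phi x * X x != 0] `<=` closure [set x | phi x != 0].
  by apply: closureS => x /=; apply: contraNN => /eqP ->; rewrite mul0r.
split; last exact: pE.
split.
- exact: continuous_mulf.
- by move=> x; exact: (@ex_derive _ _ _ _ _ _ _ (dM x)).
- rewrite (_ : partial i _ = fun x => partial i phi x * X x + phi x * dX x); last first.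
    by apply/funext.
  by apply: continuous_addf; exact: continuous_mulf.
- by apply: (subclosed_compact _ cK sub); exact: closed_closure.
- exact: subset_trans KB.
Qed.

Lemma continuous_integrable_ball (R : realType) N (f : 'rV[R]_N -> R) :
  continuous f -> (lebesgue_rV R N).-integrable (@unit_ball R N) (EFin \o f).
Proof.
move=> cf; have [C CP] := continuous_bounded_ball cf.
apply: (integrable_bounded (K := C)) => //.
- exact: measurable_unit_ball.
- exact: lebesgue_rV_unit_ball_lty.
- by apply: measurable_funTS; exact: continuous_measurable_rV.
Qed.

Lemma integral_C1c (R : realType) N (i : 'I_N) (phi : 'rV[R]_N -> R) :
  C1c i phi -> \int[lebesgue_rV R N]_(x in @unit_ball R N) partial i phi x = 0.
Proof.
move=> h; have [c1 d1 cp cK KB] := h; have [C CP] := C1c_bounded h.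
rewrite /Rintegral (@integral_partial_eq0 _ _ _ _ C)//.
- exact: continuous_measurable_rV.
- exact: continuous_measurable_rV.
- by move=> x; exact: (CP x).2.
- by move=> x; exact: (CP x).1.
Qed.

Lemma C1c_pairing (R : realType) N (i : 'I_N) (phi X dX : 'rV[R]_N -> R) :
  C1c i phi -> continuous X -> continuous dX ->
  (forall x, is_derive x (delta_mx ord0 i) X (dX x)) ->
  \int[lebesgue_rV R N]_(x in @unit_ball R N) (phi x * dX x) =
  - \int[lebesgue_rV R N]_(x in @unit_ball R N) (partial i phi x * X x).
Proof.
move=> h cX cdX ddX; have [c1 d1 cp _ _] := h.
have [hM pM] := C1c_mul h cX cdX ddX.
have mB := @measurable_unit_ball R N.
have i1 : (lebesgue_rV R N).-integrable (@unit_ball R N) (EFin \o (fun x => phi x * dX x)).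
  by apply: continuous_integrable_ball; exact: continuous_mulf.
have i2 : (lebesgue_rV R N).-integrable (@unit_ball R N)
    (EFin \o (fun x => partial i phi x * X x)).
  by apply: continuous_integrable_ball; exact: continuous_mulf.
apply/eqP; rewrite -addr_eq0 -RintegralD//.
have := integral_C1c hM; under eq_Rintegral do rewrite pM.
by move=> <-; apply/eqP; apply: eq_Rintegral => x _; rewrite addrC.
Qed.

Lemma L2_measurable (R : realType) N (u : 'rV[R]_N -> R) : L2 u ->
  measurable_fun (@unit_ball R N) u.
Proof. by case. Qed.

Lemma L2_sqr_integrable (R : realType) N (u : 'rV[R]_N -> R) : L2 u ->
  (lebesgue_rV R N).-integrable (@unit_ball R N) (EFin \o (fun x => u x ^+ 2)).
Proof.
move=> [mu ui]; apply/integrableP; split.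
  by apply/measurable_EFinP; exact: measurable_funX.
by under eq_integral do rewrite /= ger0_norm ?sqr_ge0//.
Qed.

Lemma L2_mul_integrable (R : realType) N (u v : 'rV[R]_N -> R) : L2 u -> L2 v ->
  (lebesgue_rV R N).-integrable (@unit_ball R N) (EFin \o (fun x => u x * v x)).
Proof.
move=> hu hv; have mB := @measurable_unit_ball R N.
have := integrableD mB (L2_sqr_integrable hu) (L2_sqr_integrable hv).
apply: le_integrable => //.
  apply/measurable_EFinP; apply: measurable_funM; exact: L2_measurable.
move=> x Bx /=; rewrite lee_fin [leRHS]ger0_norm ?addr_ge0 ?sqr_ge0//.
rewrite ler_norml; apply/andP; split; have := sqr_ge0 (u x - v x);
  have := sqr_ge0 (u x + v x); move: (u x) (v x) => a b; nra.
Qed.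

Lemma L2_cst (R : realType) N (c : R) : L2 (fun _ : 'rV[R]_N => c).
Proof.
split; first exact: measurable_cst.
have mB := @measurable_unit_ball R N.
by rewrite integral_cst// lte_mul_pinfty ?lee_fin ?sqr_ge0// lebesgue_rV_unit_ball_lty.
Qed.

Lemma L2_integrable (R : realType) N (u : 'rV[R]_N -> R) : L2 u ->
  (lebesgue_rV R N).-integrable (@unit_ball R N) (EFin \o u).
Proof.
move=> hu; have := L2_mul_integrable hu (L2_cst N 1).
by congr (_.-integrable _ _); apply/funext => x /=; rewrite mulr1.
Qed.

Lemma L2_bounded (R : realType) N (u : 'rV[R]_N -> R) (C : R) :
  measurable_fun (@unit_ball R N) u -> (forall x, unit_ball x -> `|u x| <= C) -> L2 u.
Proof.
move=> mu uC; split => //; have mB := @measurable_unit_ball R N.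
apply: (@le_lt_trans _ _ (\int[lebesgue_rV R N]_(x in @unit_ball R N) (C ^+ 2)%:E)%E).
  apply: ge0_le_integral => //.
  - by move=> x _; rewrite lee_fin sqr_ge0.
  - by apply/measurable_EFinP; exact: measurable_funX.
  - move=> x Bx; rewrite lee_fin -[leLHS]real_normK ?num_real//.
    by rewrite lerXn2r ?nnegrE// ?(le_trans _ (uC _ Bx))// uC.
by rewrite integral_cst// lte_mul_pinfty ?lee_fin ?sqr_ge0// lebesgue_rV_unit_ball_lty.
Qed.

Lemma L2_continuous (R : realType) N (u : 'rV[R]_N -> R) : continuous u -> L2 u.
Proof.
move=> cu; have [C CP] := continuous_bounded_ball cu.
by apply: (L2_bounded (C := C)) => //; apply: measurable_funTS; exact: continuous_measurable_rV.
Qed.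

Lemma L2_sub (R : realType) N (u v : 'rV[R]_N -> R) : L2 u -> L2 v ->
  L2 (fun x => u x - v x).
Proof.
move=> hu hv; have mB := @measurable_unit_ball R N.
have mu := L2_measurable hu; have mv := L2_measurable hv.
split; first exact: measurable_funB.
apply: (@le_lt_trans _ _ (\int[lebesgue_rV R N]_(x in @unit_ball R N)
    (2 * u x ^+ 2 + 2 * v x ^+ 2)%:E)%E).
  apply: ge0_le_integral => //.
  - by move=> x _; rewrite lee_fin sqr_ge0.
  - by apply/measurable_EFinP; apply: measurable_funX; exact: measurable_funB.
  - apply/measurable_EFinP; apply: measurable_funD; apply: measurable_funM => //;
      exact: measurable_funX.
  - move=> x _; rewrite lee_fin; have := sqr_ge0 (u x + v x).
    by move: (u x) (v x) => a b; nra.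
have h1 : (lebesgue_rV R N).-integrable (@unit_ball R N)
    (fun x => (2%:E * (u x ^+ 2)%:E + 2%:E * (v x ^+ 2)%:E)%E).
  by apply: integrableD => //; apply: integrableZl => //; exact: L2_sqr_integrable.
have := integrable_lty mB h1.
by apply: le_lt_trans; apply: le_refl.
Qed.

Lemma Rintegral_sum d (T : measurableType d) (R : realType)
    (mu : {measure set T -> \bar R}) (D : set T) n (f : 'I_n -> T -> R) :
  measurable D -> (forall i, mu.-integrable D (EFin \o f i)) ->
  mu.-integrable D (EFin \o (fun x => \sum_(i < n) f i x)) /\
  \int[mu]_(x in D) (\sum_(i < n) f i x) = \sum_(i < n) \int[mu]_(x in D) f i x.
Proof.
move=> mD; elim: n f => [|n IH] f fi.
  split.
    rewrite (_ : _ \o _ = cst 0%E); first exact: integrable0.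
    by apply/funext => x /=; rewrite big_ord0.
  by under eq_Rintegral do rewrite big_ord0; rewrite Rintegral_cst// mul0r big_ord0.
have [i1 e1] := IH (fun i => f (lift ord0 i)) (fun i => fi _).
split.
  rewrite (_ : _ \o _ = fun x => ((f ord0 x)%:E + (\sum_(i < n) f (lift ord0 i) x)%:E)%E).
    by apply: integrableD => //; exact: fi.
  by apply/funext => x /=; rewrite big_ord_recl.
by under eq_Rintegral do rewrite big_ord_recl; rewrite RintegralD// e1 big_ord_recl.
Qed.

Lemma H10_L2 (R : realType) N (u : 'rV[R]_N -> R) Du : H10 u Du ->
  L2 u /\ forall i, L2 (fun x => Du x ord0 i).
Proof. by move=> [[? ? _] _]. Qed.

Lemma H10_approx (R : realType) N (u : 'rV[R]_N -> R) Du (e : R) : H10 u Du ->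
  0 < e -> exists2 phi, test_function phi &
   \int[lebesgue_rV R N]_(x in @unit_ball R N)
     ((phi x - u x) ^+ 2 + sqnorm (grad phi x - Du x)) < e ^+ 2.
Proof.
move=> [_ h] /h[phi tphi hphi]; exists phi => //.
rewrite /Rintegral -lte_fin fineK//.
rewrite ge0_fin_numE; first exact: lt_trans hphi (ltry _).
by apply: integral_ge0 => x _; rewrite lee_fin addr_ge0 ?sqr_ge0// sqnorm_ge0.
Qed.

Lemma H10_approx_integrable (R : realType) N (u : 'rV[R]_N -> R) Du phi : H10 u Du ->
  test_function phi ->
  [/\ L2 (fun x => phi x - u x), forall i, L2 (fun x => partial i phi x - Du x ord0 i) &
   (lebesgue_rV R N).-integrable (@unit_ball R N)
     (EFin \o (fun x => (phi x - u x) ^+ 2 + sqnorm (grad phi x - Du x)))].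
Proof.
move=> /H10_L2[hu hDu] tphi; have mB := @measurable_unit_ball R N.
have h1 : L2 (fun x => phi x - u x).
  by apply: L2_sub => //; apply: L2_continuous; case: tphi => h _ _; exact: (h [::]).1.
have h2 i : L2 (fun x => partial i phi x - Du x ord0 i).
  by apply: L2_sub => //; apply: L2_continuous; case: tphi => h _ _; exact: (h [:: i]).1.
split => //.
have [h3 _] := @Rintegral_sum _ _ _ (lebesgue_rV R N) _ _
  (fun i x => (partial i phi x - Du x ord0 i) ^+ 2) mB (fun i => L2_sqr_integrable (h2 i)).
have := integrableD mB (L2_sqr_integrable h1) h3.
apply: eq_integrable => // x _ /=; congr ((_ + _)%:E).
by apply: eq_bigr => i _; rewrite !mxE.
Qed.

(** Elements of H^1_0 need no boundary term, whatever the values of [X] on the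
    sphere: this is how the vanishing trace is used. The formula holds for
    test functions, and both sides are continuous for the H^1 norm. *)
Lemma H10_pairing (R : realType) N (i : 'I_N) (u : 'rV[R]_N -> R) Du
    (X dX : 'rV[R]_N -> R) :
  H10 u Du -> continuous X -> continuous dX ->
  (forall x, is_derive x (delta_mx ord0 i) X (dX x)) ->
  \int[lebesgue_rV R N]_(x in @unit_ball R N) (u x * dX x) =
  - \int[lebesgue_rV R N]_(x in @unit_ball R N) (Du x ord0 i * X x).
Proof.
move=> hu cX cdX ddX; have [u2 Du2] := H10_L2 hu.
have mB := @measurable_unit_ball R N.
have iu : (lebesgue_rV R N).-integrable (@unit_ball R N) (EFin \o (fun x => u x * dX x)).
  by apply: L2_mul_integrable => //; exact: L2_continuous.
have iDu : (lebesgue_rV R N).-integrable (@unit_ball R N)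
    (EFin \o (fun x => Du x ord0 i * X x)).
  by apply: L2_mul_integrable => //; exact: L2_continuous.
apply/eqP; rewrite -addr_eq0 -RintegralD// -normr_le0.
have [C1 C1P] := continuous_bounded_ball cX.
have [C2 C2P] := continuous_bounded_ball cdX.
pose C := `|C1| + `|C2|; pose w := fine (lebesgue_rV R N (@unit_ball R N)).
have w0 : 0 <= w by rewrite fine_ge0// measure_ge0.
have C0 : 0 <= C by rewrite addr_ge0.
have XC x : unit_ball x -> `|X x| <= C.
  by move=> /C1P h; rewrite (le_trans h)// (le_trans (ler_norm _))// lerDl.
have dXC x : unit_ball x -> `|dX x| <= C.
  by move=> /C2P h; rewrite (le_trans h)// (le_trans (ler_norm _))// lerDr.
apply/ler_addgt0Pr => d d0; rewrite add0r.
have K0 : 0 < C * (1 + w) + 1 by rewrite ltr_wpDl// mulr_ge0// addr_ge0.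
(* With this [e] the bound [e * (C * (1 + w))] obtained below is at most
   [d]. *)
pose e := d / (C * (1 + w) + 1).
have e0 : 0 < e by rewrite divr_gt0.
have [phi tphi phie] := H10_approx hu e0.
have [d1 d2 i12] := H10_approx_integrable hu tphi.
have cphi : C1c i phi by exact: test_function_C1c.
have := C1c_pairing cphi cX cdX ddX.
have [c1 _ c2 _ _] := cphi.
have ip : (lebesgue_rV R N).-integrable (@unit_ball R N) (EFin \o (fun x => phi x * dX x)).
  by apply: continuous_integrable_ball; exact: continuous_mulf.
have iDp : (lebesgue_rV R N).-integrable (@unit_ball R N)
    (EFin \o (fun x => partial i phi x * X x)).
  by apply: continuous_integrable_ball; exact: continuous_mulf.
move/eqP; rewrite -addr_eq0 -RintegralD// => /eqP p0.
rewrite -[X in `|X|]subr0 -p0 -RintegralB//; last 2 first.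
- exact: integrable_addr.
- exact: integrable_addr.
have id : (lebesgue_rV R N).-integrable (@unit_ball R N)
    (EFin \o (fun x => u x * dX x + Du x ord0 i * X x -
                (phi x * dX x + partial i phi x * X x))).
  by apply: integrable_subr => //; exact: integrable_addr.
apply: le_trans (le_normr_Rintegral mB id) _.
pose S x := (phi x - u x) ^+ 2 + sqnorm (grad phi x - Du x).
have iS : (lebesgue_rV R N).-integrable (@unit_ball R N)
    (EFin \o (fun x => C * e^-1 * S x)).
  exact: integrable_mulrl.
have iC : (lebesgue_rV R N).-integrable (@unit_ball R N) (EFin \o cst (C * e)).
  by apply: continuous_integrable_ball; exact: cst_continuous.
apply: (@le_trans _ _ (\int[lebesgue_rV R N]_(x in @unit_ball R N) (C * e + C * e^-1 * S x))).
  apply: le_Rintegral => //.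
  - exact: integrable_norm.
  - exact: integrable_addr.
  move=> x Bx.
  have bS : (partial i phi x - Du x ord0 i) ^+ 2 <= sqnorm (grad phi x - Du x).
    rewrite /sqnorm (bigD1 i)//= !mxE lerDl; apply: sumr_ge0 => j _; exact: sqr_ge0.
  have -> : u x * dX x + Du x ord0 i * X x - (phi x * dX x + partial i phi x * X x) =
    - ((phi x - u x) * dX x + (partial i phi x - Du x ord0 i) * X x) by ring.
  rewrite normrN (le_trans (ler_normD _ _))// !normrM.
  (* Weighted so that the squared distance, of order [e^2], costs only [e]. *)
  have amgm (t : R) : `|t| <= 2^-1 * e + 2^-1 * e^-1 * t ^+ 2.
    rewrite -[t ^+ 2]real_normK ?num_real//; move: `|t| => y.
    have e2 : 0 < 2 * e by apply: mulr_gt0.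
    rewrite -(ler_pM2r e2).
    have -> : (2^-1 * e + 2^-1 * e^-1 * y ^+ 2) * (2 * e) = e ^+ 2 + y ^+ 2.
      by field; rewrite gt_eqF.
    have := sqr_ge0 (y - e); nra.
  apply: (@le_trans _ _ (C * (`|phi x - u x| + `|partial i phi x - Du x ord0 i|))).
    rewrite mulrDr; apply: lerD; rewrite mulrC ler_wpM2r//.
      exact: dXC.
    exact: XC.
  rewrite -mulrA -mulrDr ler_wpM2l//.
  apply: (le_trans (lerD (amgm _) (amgm _))).
  have ei : 0 <= e^-1 by rewrite invr_ge0 ltW.
  rewrite /S; move: bS (sqr_ge0 (phi x - u x)) (sqr_ge0 (partial i phi x - Du x ord0 i)).
  move: (sqnorm _) (_ ^+ 2) (_ ^+ 2) => s b a bs a0 b0.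
  have : e^-1 * a <= e^-1 * s by rewrite ler_wpM2l.
  have : 0 <= e^-1 * a by rewrite mulr_ge0.
  have : 0 <= e^-1 * b by rewrite mulr_ge0.
  by lra.
rewrite RintegralD//.
have -> : Rintegral (lebesgue_rV R N) (@unit_ball R N) (fun=> C * e) = C * e * w.
  exact: Rintegral_cst.
rewrite RintegralZl//.
apply: (@le_trans _ _ (C * e * w + C * e^-1 * e ^+ 2)).
  rewrite lerD2l ler_wpM2l ?mulr_ge0 ?invr_ge0 ?(ltW e0)//.
  exact: ltW.
have -> : C * e * w + C * e^-1 * e ^+ 2 = e * (C * (1 + w)).
  by field; rewrite gt_eqF.
rewrite /e mulrAC ler_pdivrMr//.
by apply: ler_wpM2l; [exact: ltW|rewrite lerDl].
Qed.

(** * Hardy inequality *)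

Definition dot (R : realType) N (v x : 'rV[R]_N) : R := \sum_(i < N) v ord0 i * x ord0 i.

Lemma sqr_dot_le (R : realType) N (v x : 'rV[R]_N) :
  dot v x ^+ 2 <= sqnorm v * sqnorm x.
Proof.
have h t : 0 <= sqnorm v - 2 * t * dot v x + t ^+ 2 * sqnorm x.
  have -> : sqnorm v - 2 * t * dot v x + t ^+ 2 * sqnorm x =
      \sum_(i < N) (v ord0 i - t * x ord0 i) ^+ 2.
    rewrite /sqnorm /dot !mulr_sumr -sumrB -big_split/=.
    by apply: eq_bigr => i _; ring.
  by apply: sumr_ge0 => i _; exact: sqr_ge0.
have [x0|x0] := eqVneq (sqnorm x) 0.
  have -> : x = 0.
    by apply/eqP; rewrite -enorm_eq0 -sqrf_eq0 enorm_sqr x0.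
  rewrite (_ : dot v 0 = 0) ?expr0n ?mulr_ge0 ?sqnorm_ge0//.
  by rewrite /dot big1// => i _; rewrite mxE mulr0.
have sx : 0 < sqnorm x by rewrite lt_neqAle eq_sym x0 sqnorm_ge0.
have := h (dot v x / sqnorm x).
have -> : sqnorm v - 2 * (dot v x / sqnorm x) * dot v x +
    (dot v x / sqnorm x) ^+ 2 * sqnorm x = sqnorm v - dot v x ^+ 2 / sqnorm x.
  by field.
by rewrite subr_ge0 ler_pdivrMr.
Qed.

(** Integrate [phi^2] against the divergence of [x / (|x|^2 + d)] and complete
    a square; [d > 0] removes the singularity of the field. *)
Lemma hardy_test (R : realType) N (phi : 'rV[R]_N -> R) (d : R) : (2 < N)%N ->
  0 < d -> test_function phi ->
  (N%:R - 2) ^+ 2 / 4 * \int[lebesgue_rV R N]_(x in @unit_ball R N)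
     (phi x ^+ 2 / (sqnorm x + d)) <=
  \int[lebesgue_rV R N]_(x in @unit_ball R N) sqnorm (grad phi x).
Proof.
move=> N2 d0 tphi; have mB := @measurable_unit_ball R N.
have sd (x : 'rV[R]_N) : 0 < sqnorm x + d by rewrite ltr_wpDl// sqnorm_ge0.
have sdn (x : 'rV[R]_N) : sqnorm x + d != 0 by rewrite gt_eqF.
pose X (i : 'I_N) (x : 'rV[R]_N) := x ord0 i * (sqnorm x + d)^-1.
pose dX (i : 'I_N) (x : 'rV[R]_N) :=
  (sqnorm x + d)^-1 + - (2 * (x ord0 i * x ord0 i) * ((sqnorm x + d)^-1 * (sqnorm x + d)^-1)).
have cw : continuous (fun x : 'rV[R]_N => (sqnorm x + d)^-1).
  apply: continuous_invf => //; apply: continuous_addf; first exact: continuous_sqnorm.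
  exact: cst_continuous.
have cc i : continuous (fun x : 'rV[R]_N => x ord0 i) by move=> x; exact: coord_continuous.
have cX i : continuous (X i) by exact: continuous_mulf.
have cdX i : continuous (dX i).
  apply: continuous_addf => //.
  suff : continuous (fun x : 'rV[R]_N => (- 2) * (x ord0 i * x ord0 i) * ((sqnorm x + d)^-1 * (sqnorm x + d)^-1)).
    by under eq_fun do rewrite 2!mulNr.
  apply: continuous_mulf; last exact: continuous_mulf.
  apply: continuous_mulf; last exact: continuous_mulf.
  exact: cst_continuous.
have ddX i x : is_derive x (delta_mx ord0 i) (X i) (dX i x).
  have dw : is_derive x (delta_mx ord0 i) (fun x : 'rV[R]_N => (sqnorm x + d)^-1)
      (- (2 * x ord0 i) / (sqnorm x + d) ^+ 2).
    have := is_derive_compR (f := fun y => (y + d)^-1) _ (is_derive_sqnorm i x).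
    move=> /(_ (-1 / (sqnorm x + d) ^+ 2)) h.
    apply: is_derive_eq (h _) _; last by field.
    apply: is_derive_eq (derV (f := fun y => y + d) (sdn x) (derD (der_id (sqnorm x)) (der_cst d _))) _.
    by rewrite addr0.
  apply: is_derive_eq (is_deriveM (is_derive_coord i i x) dw) _.
  by rewrite eqxx /GRing.scale/= /dX; field.
have [cphi dphi] : continuous phi /\ forall i, continuous (partial i phi).
  by case: tphi => h _ _; split; [exact: (h [::]).1|move=> i; exact: (h [:: i]).1].
have pair i : \int[lebesgue_rV R N]_(x in @unit_ball R N)
    (phi x * phi x * dX i x + 2 * phi x * partial i phi x * X i x) = 0.
  have h1 := test_function_C1c i tphi.
  have ddphi x : is_derive x (delta_mx ord0 i) phi (partial i phi x).
    by apply: derivableP; case: h1.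
  have [h2 h2E] := C1c_mul h1 cphi (dphi i) ddphi.
  have := C1c_pairing h2 (cX i) (cdX i) (ddX i).
  move/eqP; rewrite -addr_eq0 -RintegralD//; last 2 first.
  - apply: continuous_integrable_ball; apply: continuous_mulf => //.
    exact: continuous_mulf.
  - apply: continuous_integrable_ball; apply: continuous_mulf => //.
    by case: h2.
  move=> /eqP <-; apply: eq_Rintegral => x _; rewrite h2E; ring.
have ii i : (lebesgue_rV R N).-integrable (@unit_ball R N) (EFin \o
    (fun x => phi x * phi x * dX i x + 2 * phi x * partial i phi x * X i x)).
  apply: continuous_integrable_ball; apply: continuous_addf.
    by apply: continuous_mulf => //; exact: continuous_mulf.
  apply: continuous_mulf => //; apply: continuous_mulf => //; apply: continuous_mulf => //.
  exact: cst_continuous.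
have [iS ES] := Rintegral_sum mB ii.
have {}ES : \int[lebesgue_rV R N]_(x in @unit_ball R N) (\sum_(i < N)
    (phi x * phi x * dX i x + 2 * phi x * partial i phi x * X i x)) = 0.
  by rewrite ES big1// => i _; exact: pair.
have ig : (lebesgue_rV R N).-integrable (@unit_ball R N)
    (EFin \o (fun x => sqnorm (grad phi x))).
  have [+ _] := @Rintegral_sum _ _ _ (lebesgue_rV R N) _ _
    (fun i x => (partial i phi x) ^+ 2) mB (fun i => L2_sqr_integrable (L2_continuous (dphi i))).
  apply: eq_integrable => // x _ /=; congr (_%:E).
  by apply: eq_bigr => i _; rewrite mxE.
have iw : (lebesgue_rV R N).-integrable (@unit_ball R N)
    (EFin \o (fun x => phi x ^+ 2 / (sqnorm x + d))).
  apply: continuous_integrable_ball; apply: continuous_mulf => //.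
  by under eq_fun do rewrite expr2; exact: continuous_mulf.
(* The best multiple of the field. *)
pose k : R := (N%:R - 2) / 2.
have k0 : 0 < k by rewrite divr_gt0// subr_gt0 ltr_nat.
have kE : (N%:R - 2) ^+ 2 / 4 = k ^+ 2 by rewrite /k; field.
have i1 := integrable_mulrl (k ^+ 2) mB iw.
have i2 := integrable_mulrl k mB iS.
rewrite kE -RintegralZl// -[leRHS]addr0 -[X in _ + X](mulr0 k) -ES -RintegralZl//.
rewrite -RintegralD//; apply: le_Rintegral => //; first exact: integrable_addr.
move=> x Bx.
have -> : \sum_(i < N) (phi x * phi x * dX i x + 2 * phi x * partial i phi x * X i x) =
    phi x ^+ 2 * (N%:R / (sqnorm x + d) - 2 * sqnorm x / (sqnorm x + d) ^+ 2) +
    2 * phi x * dot (grad phi x) x / (sqnorm x + d).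
  have -> : 2 * phi x * dot (grad phi x) x / (sqnorm x + d) =
      \sum_(i < N) 2 * phi x * partial i phi x * X i x.
    rewrite /dot mulr_sumr mulr_suml; apply: eq_bigr => i _.
    by rewrite mxE /X; ring.
  rewrite big_split/=; congr (_ + _).
  rewrite -mulr_sumr -expr2; congr (_ * _).
  rewrite /dX big_split/= sumr_const card_ord; congr (_ + _); first by rewrite mulr_natl.
  by rewrite sumrN -mulr_suml -mulr_sumr -expr2 exprVn; congr (- (_ * _ * _)).
have := sqr_dot_le (grad phi x) x; have := sqnorm_ge0 (grad phi x).
have := sqnorm_ge0 x; have := sd x.
move: (sqnorm x) (sqnorm (grad phi x)) (dot _ _) (phi x) => r g t f rd0 r0 g0 tg.
have N2k : N%:R = 2 * k + 2 by rewrite /k; field.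
rewrite N2k; set w := (r + d)^-1.
have w0 : 0 < w by rewrite invr_gt0.
have rw : r * w <= 1 by rewrite ler_pdivrMr// mul1r lerDl ltW.
have -> : 2 * r / (r + d) ^+ 2 = 2 * r * w ^+ 2 by rewrite exprVn.
have tw : (t * w) ^+ 2 <= g * w.
  rewrite exprMn; apply: (@le_trans _ _ (g * r * w ^+ 2)).
    by rewrite ler_wpM2r// sqr_ge0.
  have -> : g * r * w ^+ 2 = (g * w) * (r * w) by ring.
  by rewrite ler_piMr// mulr_ge0// ltW.
have h1 : 0 <= g + 2 * k * f * (t * w) + k ^+ 2 * f ^+ 2 * w.
  rewrite -(pmulr_rge0 _ w0).
  have : 0 <= (t * w + k * f * w) ^+ 2 by exact: sqr_ge0.
  move: (t * w) tw => T; nra.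
have h2 : 0 <= k * (f ^+ 2 * w) * (1 - r * w).
  apply: mulr_ge0; last by rewrite subr_ge0.
  by apply: mulr_ge0; [exact: ltW|apply: mulr_ge0; [exact: sqr_ge0|exact: ltW]].
rewrite -subr_ge0; have := addr_ge0 h1 (mulr_ge0 (ler0n R 2) h2).
by congr (_ <= _); ring.
Qed.

Lemma sqnormB_le (R : realType) N (x y : 'rV[R]_N) :
  sqnorm x <= 2 * sqnorm y + 2 * sqnorm (x - y).
Proof.
rewrite /sqnorm !mulr_sumr -big_split/=; apply: ler_sum => i _; rewrite !mxE.
have := sqr_ge0 (x ord0 i - 2 * y ord0 i).
move: (x ord0 i) (y ord0 i) => a b; nra.
Qed.

Lemma H10_grad_integrable (R : realType) N (u : 'rV[R]_N -> R) Du : H10 u Du ->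
  (lebesgue_rV R N).-integrable (@unit_ball R N) (EFin \o (fun x => sqnorm (Du x))).
Proof.
move=> /H10_L2[_ h]; have mB := @measurable_unit_ball R N.
by have [+ _] := @Rintegral_sum _ _ _ (lebesgue_rV R N) _ _
  (fun i x => (Du x ord0 i) ^+ 2) mB (fun i => L2_sqr_integrable (h i)).
Qed.

(** The inequality for test functions passes to [u] at fixed [d], and [d] then
    tends to [0] by monotone convergence. Only integrability is recorded, not
    the constant. *)
Lemma hardy (R : realType) N (u : 'rV[R]_N -> R) Du : (2 < N)%N -> H10 u Du ->
  (lebesgue_rV R N).-integrable (@unit_ball R N)
    (EFin \o (fun x => u x ^+ 2 / enorm x ^+ 2)).
Proof.
move=> N2 hu; have mB := @measurable_unit_ball R N.
have [u2 Du2] := H10_L2 hu; have mu := L2_measurable u2.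
have iG := H10_grad_integrable hu.
pose k : R := (N%:R - 2) ^+ 2 / 4.
have k0 : 0 < k by rewrite divr_gt0// exprn_gt0// subr_gt0 ltr_nat.
pose G := \int[lebesgue_rV R N]_(x in @unit_ball R N) sqnorm (Du x).
pose C := 2 * (k^-1 * (2 * G + 2)) + 2.
have mw (d : R) : 0 < d -> measurable_fun (@unit_ball R N) (fun x => u x ^+ 2 / (sqnorm x + d)).
  move=> d0; apply: measurable_funM; first exact: measurable_funX.
  apply: measurable_funTS; apply: (measurableT_comp (@measurable_invr R)).
  by apply: measurable_funD => //; exact: measurable_sqnorm.
have iw (d : R) : 0 < d -> (lebesgue_rV R N).-integrable (@unit_ball R N)
    (EFin \o (fun x => u x ^+ 2 / (sqnorm x + d))).
  move=> d0; apply: (integrable_mulb (K := d^-1)) => //; first exact: L2_sqr_integrable.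
    apply: measurable_funTS; apply: (measurableT_comp (@measurable_invr R)).
    by apply: measurable_funD => //; exact: measurable_sqnorm.
  move=> x _; rewrite ger0_norm ?invr_ge0 ?addr_ge0 ?sqnorm_ge0 ?(ltW d0)//.
  by rewrite lef_pV2 ?posrE ?ltr_wpDl ?sqnorm_ge0// lerDr sqnorm_ge0.
have bound (d : R) : 0 < d -> d <= 1 ->
    \int[lebesgue_rV R N]_(x in @unit_ball R N) (u x ^+ 2 / (sqnorm x + d)) <= C.
  (* The approximation is within [d] in norm, so that its squared error
     survives a division by [|x|^2 + d]. *)
  move=> d0 d1; have [phi tphi] := H10_approx hu d0.
  have [e1 e2 iS] := H10_approx_integrable hu tphi.
  set E := Rintegral _ _ _ => Ed.
  have Ed' : E <= d by rewrite (le_trans (ltW Ed))// expr2 ler_piMl// ltW.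
  have h := hardy_test N2 d0 tphi.
  have [cphi dphi] : continuous phi /\ forall i, continuous (partial i phi).
    by case: tphi => h' _ _; split; [exact: (h' [::]).1|move=> i; exact: (h' [:: i]).1].
  have sd (x : 'rV[R]_N) : 0 < sqnorm x + d by rewrite ltr_wpDl// sqnorm_ge0.
  have iph : (lebesgue_rV R N).-integrable (@unit_ball R N)
      (EFin \o (fun x => phi x ^+ 2 / (sqnorm x + d))).
    apply: continuous_integrable_ball; apply: continuous_mulf => //.
      by under eq_fun do rewrite expr2; exact: continuous_mulf.
    apply: continuous_invf; first by move=> x; rewrite gt_eqF.
    by apply: continuous_addf; [exact: continuous_sqnorm|exact: cst_continuous].
  have ig : (lebesgue_rV R N).-integrable (@unit_ball R N)
      (EFin \o (fun x => sqnorm (grad phi x))).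
    have [+ _] := @Rintegral_sum _ _ _ (lebesgue_rV R N) _ _
      (fun i x => (partial i phi x) ^+ 2) mB (fun i => L2_sqr_integrable (L2_continuous (dphi i))).
    apply: eq_integrable => // x _ /=; congr (_%:E).
    by apply: eq_bigr => i _; rewrite mxE.
  have h1 : \int[lebesgue_rV R N]_(x in @unit_ball R N) sqnorm (grad phi x) <= 2 * G + 2 * E.
    rewrite /G /E -!RintegralZl// -RintegralD//; last 2 first.
    - exact: integrable_mulrl.
    - exact: integrable_mulrl.
    apply: le_Rintegral => //.
      by apply: integrable_addr => //; exact: integrable_mulrl.
    move=> x _; apply: le_trans (sqnormB_le _ (Du x)) _.
    by rewrite lerD2l ler_wpM2l// lerDr sqr_ge0.
  have h2 : \int[lebesgue_rV R N]_(x in @unit_ball R N) (u x ^+ 2 / (sqnorm x + d)) <=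
      2 * \int[lebesgue_rV R N]_(x in @unit_ball R N) (phi x ^+ 2 / (sqnorm x + d)) +
      2 * d^-1 * E.
    rewrite /E -!RintegralZl// -RintegralD//; last 2 first.
    - exact: integrable_mulrl.
    - exact: integrable_mulrl.
    apply: le_Rintegral => //.
    - exact: iw.
    - by apply: integrable_addr => //; exact: integrable_mulrl.
    move=> x _.
    have wd : (sqnorm x + d)^-1 <= d^-1 by rewrite lef_pV2 ?posrE// lerDr sqnorm_ge0.
    have w0 : 0 <= (sqnorm x + d)^-1 by rewrite invr_ge0 ltW.
    apply: (@le_trans _ _ (2 * (phi x ^+ 2 / (sqnorm x + d)) +
        2 * ((phi x - u x) ^+ 2 / (sqnorm x + d)))).
      have hu2 : u x ^+ 2 <= 2 * phi x ^+ 2 + 2 * (phi x - u x) ^+ 2.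
        have := sqr_ge0 (u x - 2 * phi x); move: (u x) (phi x) => a b; nra.
      apply: (le_trans (ler_wpM2r w0 hu2)).
      by rewrite le_eqVlt; apply/orP; left; apply/eqP; ring.
    rewrite lerD2l -(mulrA 2 d^-1); apply: ler_wpM2l => //; rewrite [leRHS]mulrC.
    apply: (@le_trans _ _ ((phi x - u x) ^+ 2 * d^-1)).
      by apply: ler_wpM2l => //; exact: sqr_ge0.
    by rewrite ler_wpM2r ?invr_ge0 ?(ltW d0)// lerDl sqnorm_ge0.
  apply: (le_trans h2); rewrite /C; apply: lerD.
    rewrite ler_wpM2l// mulrC -ler_pdivrMr ?invr_gt0// invrK mulrC.
    apply: (le_trans h); apply: (le_trans h1).
    by rewrite lerD2l -[leRHS]mulr1 ler_wpM2l// (le_trans Ed').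
  by rewrite -mulrA -[leRHS]mulr1 ler_wpM2l// mulrC ler_pdivrMr// mul1r.
pose d (n : nat) : R := n.+1%:R^-1.
have d0 n : 0 < d n by rewrite invr_gt0.
have d1 n : d n <= 1 by rewrite invf_le1// ler1n.
pose f (n : nat) (x : 'rV[R]_N) : \bar R :=
  (u x ^+ 2 / enorm x ^+ 2 * (sqnorm x / (sqnorm x + d n)))%:E.
have sd (x : 'rV[R]_N) n : 0 < sqnorm x + d n by rewrite ltr_wpDl// sqnorm_ge0.
have f0 n x : (0 <= f n x)%E.
  rewrite lee_fin; apply: mulr_ge0; first by rewrite divr_ge0 ?sqr_ge0.
  by apply: divr_ge0; [exact: sqnorm_ge0|exact: ltW].
have fu n x : (f n x <= (u x ^+ 2 / (sqnorm x + d n))%:E)%E.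
  rewrite lee_fin mulrA ler_wpM2r//; first by rewrite invr_ge0 ltW.
  rewrite enorm_sqr; have [->|s0] := eqVneq (sqnorm x) 0.
    by rewrite mulr0 sqr_ge0.
  by rewrite divfK.
have mq : measurable_fun (@unit_ball R N) (fun x => u x ^+ 2 / enorm x ^+ 2).
  apply: measurable_funM; first exact: measurable_funX.
  apply: measurable_funTS; apply: (measurableT_comp (@measurable_invr R)).
  by apply: measurable_funX; exact: measurable_enorm.
have mf n : measurable_fun (@unit_ball R N) (f n).
  apply/measurable_EFinP; apply: measurable_funM => //; apply: measurable_funTS.
  apply: measurable_funM; first exact: measurable_sqnorm.
  apply: (measurableT_comp (@measurable_invr R)).
  by apply: measurable_funD => //; exact: measurable_sqnorm.
have q0 x : 0 <= u x ^+ 2 / enorm x ^+ 2 by rewrite mulr_ge0 ?invr_ge0 ?sqr_ge0.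
apply/integrableP; split; first exact/measurable_EFinP.
under eq_integral do rewrite /= ger0_norm//.
have -> : (\int[lebesgue_rV R N]_(x in @unit_ball R N) (u x ^+ 2 / enorm x ^+ 2)%:E =
    \int[lebesgue_rV R N]_(x in @unit_ball R N) limn (f ^~ x))%E.
  apply: eq_integral => x _; apply/esym/cvg_lim => //.
  apply: cvg_EFin; first exact: nearW.
  have [x0|x0] := eqVneq (enorm x) 0.
    rewrite (_ : fine \o _ = cst 0); first by rewrite x0 expr0n invr0 mulr0; exact: cvg_cst.
    by apply/funext => n; rewrite /f /= x0 expr0n invr0 mulr0 mul0r.
  have s0 : sqnorm x != 0 by rewrite -enorm_sqr sqrf_eq0.
  rewrite -[X in _ --> X]mulr1; apply: cvgM; first exact: cvg_cst.
  rewrite -(mulfV s0); apply: cvgM; first exact: cvg_cst.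
  apply: cvgV => //; rewrite -[X in _ --> X]addr0; apply: cvgD; first exact: cvg_cst.
  exact: cvg_harmonic.
have nd x : {homo f ^~ x : n m / (n <= m)%N >-> (n <= m)%E}.
  move=> n m nm; rewrite lee_fin ler_wpM2l// ler_wpM2l ?sqnorm_ge0//.
  by rewrite lef_pV2 ?posrE// lerD2l lef_pV2 ?posrE// ler_nat.
rewrite monotone_convergence//.
apply: (@le_lt_trans _ _ C%:E); last exact: ltry.
apply: lime_le.
  apply: ereal_nondecreasing_is_cvgn => n m nm.
  by apply: ge0_le_integral => // x _; exact: nd.
apply: nearW => n; apply: (@le_trans _ _ (\int[lebesgue_rV R N]_(x in @unit_ball R N)
    (u x ^+ 2 / (sqnorm x + d n))%:E)%E).
  apply: ge0_le_integral => //.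
  by apply/measurable_EFinP; exact: mw.
by rewrite -EFin_Rintegral ?lee_fin ?bound//; exact: iw.
Qed.

(** * Radial functions of H^1_0 are determined by their flux *)

Lemma sm_divX (R : realType) (f : R -> R) (a : R) (m : nat) : sm f -> 0 < a ->
  (forall s, s < a -> f s = 0) -> sm (fun s => f s / s ^+ m).
Proof.
move=> sf a0 f0; elim: m => [|m IH].
  by rewrite (_ : (fun s => _) = f)//; apply/funext => s; rewrite expr0 divr1.
rewrite (_ : (fun s => _) = fun s => f s / s ^+ m / s).
  by apply: sm_div IH a0 _ => s sa; rewrite f0// mul0r.
by apply/funext => s; rewrite exprS invfM [in LHS]mulrCA mulrC.
Qed.

(** For a radial function, the derivative of the profile divided by [r ^+
    N.-1]: the integral over a shell is then, up to the area of the unit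
    sphere, the increment of the profile. *)
Definition flux_density (R : realType) N (Du : 'rV[R]_N -> 'rV[R]_N) (x : 'rV[R]_N) : R :=
  dot (Du x) x / enorm x ^+ N.

(** The vector field is [eta (|x|) / |x|^N x], whose divergence is
    [|x|^(1-N) chi (|x|)] when [chi] is the derivative of [eta]. *)
Lemma H10_radial_pairing (R : realType) N (u : 'rV[R]_N -> R) Du (chi eta : R -> R) (a : R) :
  (0 < N)%N -> H10 u Du -> 0 < a -> sm eta ->
  (forall s : R, is_derive s 1 eta (chi s)) -> (forall s, s < a -> eta s = 0) ->
  (forall s, s < a -> chi s = 0) ->
  \int[lebesgue_rV R N]_(x in @unit_ball R N)
    (u x * (chi (enorm x) / enorm x ^+ N.-1)) =
  - \int[lebesgue_rV R N]_(x in @unit_ball R N) (flux_density Du x * eta (enorm x)).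
Proof.
move=> N0 hu a0 seta deta eta0 chi0; have mB := @measurable_unit_ball R N.
have [u2 Du2] := H10_L2 hu.
pose A s := eta s / s ^+ N.
have sA : sm A by exact: (sm_divX N seta a0 eta0).
have A0 s : s < a -> A s = 0 by move=> sa; rewrite /A eta0// mul0r.
have [A' sA' dA] := sm_derive sA.
have A'0 := sm_derive_eq0 dA A0.
have AE s : A' s * s ^+ N + A s * (N%:R * s ^+ N.-1) = chi s.
  have h1 := derM (dA s) (derX N (der_id s)).
  have h2 : (fun y => A y * y ^+ N) = eta.
    apply/funext => y; rewrite /A; have [->|y0] := eqVneq y 0.
      by rewrite expr0n eqn0Ngt N0 mulr0 eta0.
    by rewrite divfK// expf_neq0.
  have := @derive_val _ _ _ _ _ _ _ h1; rewrite h2 (@derive_val _ _ _ _ _ _ _ (deta s)) => ->.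
  by rewrite mulr1.
pose X i (x : 'rV[R]_N) := x ord0 i * A (enorm x).
pose dX i (x : 'rV[R]_N) := A (enorm x) + x ord0 i * (A' (enorm x) / enorm x * x ord0 i).
have eX i : elem (X i) 
    by exact: (@elem_mul R N (fun x => x ord0 i) (fun x => A (enorm x)) (@elem_coord R N i) (@elem_rad R N A a sA a0 A0)).
have ddX i x : is_derive x (delta_mx ord0 i) (X i) (dX i x).
  apply: is_derive_eq (is_deriveM (is_derive_coord i i x) (is_derive_radial i x a0 dA A0)) _.
  by rewrite eqxx /GRing.scale/= /dX mulr1 addrC.
have cdX i : continuous (dX i).
  have [g /elem_continuous cg dg] := elem_derive i (eX i).
  suff -> : dX i = g by [].
  apply/funext => x; rewrite -(@derive_val _ _ _ _ _ _ _ (dg x)).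
  by rewrite (@derive_val _ _ _ _ _ _ _ (ddX i x)).
have cX i : continuous (X i) := elem_continuous (eX i).
have pair i := H10_pairing hu (cX i) (cdX i) (ddX i).
have i1 i : (lebesgue_rV R N).-integrable (@unit_ball R N) (EFin \o (fun x => u x * dX i x)).
  by apply: L2_mul_integrable => //; exact: L2_continuous.
have i2 i : (lebesgue_rV R N).-integrable (@unit_ball R N)
    (EFin \o (fun x => Du x ord0 i * X i x)).
  by apply: L2_mul_integrable => //; exact: L2_continuous.
have [_ S1] := Rintegral_sum mB i1; have [_ S2] := Rintegral_sum mB i2.
transitivity (\int[lebesgue_rV R N]_(x in @unit_ball R N) (\sum_(i < N) u x * dX i x)).
  apply: eq_Rintegral => x _; rewrite -mulr_sumr; congr (_ * _).
  have [x0|x0] := eqVneq (enorm x) 0.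
    rewrite x0 chi0// mul0r big1// => i _.
    by rewrite /dX x0 A0// A'0// !mul0r mulr0 addr0.
  rewrite /dX big_split/= sumr_const card_ord -AE.
  have -> : \sum_(i < N) x ord0 i * (A' (enorm x) / enorm x * x ord0 i) =
      A' (enorm x) * enorm x.
    transitivity (A' (enorm x) / enorm x * sqnorm x).
      by rewrite /sqnorm mulr_sumr; apply: eq_bigr => i _; ring.
    by rewrite -enorm_sqr; field.
  rewrite -mulr_natl; move: x0; move: (enorm x) => r r0; move: (A r) (A' r) => y y'.
  have : (0 < N)%N by []; case: (N) => // n _ /=.
  by rewrite exprS; field; rewrite expf_neq0.
rewrite S1 (eq_bigr _ (fun i _ => pair i)) sumrN -S2; congr (- _).
apply: eq_Rintegral => x _; rewrite /flux_density /dot 2!mulr_suml.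
by apply: eq_bigr => i _; rewrite /X /A; ring.
Qed.

Lemma radial_null (R : realType) N (S : set R) : (1 < N)%N -> measurable S ->
  (\int[lebesgue_measure]_(s in `]0%R, 1%R[) (\1_S s)%:E = 0)%E ->
  {ae lebesgue_rV R N, forall x, unit_ball x -> ~ S (enorm x)}.
Proof.
move=> N1 mS S0; have mB := @measurable_unit_ball R N.
have mI : measurable_fun setT (fun s : R => (\1_S s : R)%:E).
  by apply/measurable_EFinP; exact: measurable_indic.
have : (\int[lebesgue_rV R N]_(y in @unit_ball R N) (\1_S (enorm y))%:E = 0)%E.
  rewrite (ge0_integral_radial N1 mI); last by move=> x; rewrite lee_fin.
  suff -> : (\int[lebesgue_measure]_(s in `]0%R, 1%R[) ((\1_S s)%:E * (s ^+ N.-1)%:E) = 0)%E.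
    by rewrite !mule0.
  apply/eqP; rewrite eq_le; apply/andP; split; last first.
    apply: integral_ge0 => s /=; rewrite in_itv/= => /andP[s0 _].
    by rewrite -EFinM lee_fin mulr_ge0// exprn_ge0// ltW.
  rewrite -S0; apply: ge0_le_integral => //.
  - move=> s /=; rewrite in_itv/= => /andP[s0 _].
    by rewrite -EFinM lee_fin mulr_ge0// exprn_ge0// ltW.
  - by apply: measurable_funTS; apply: emeasurable_funM => //; apply/measurable_EFinP; exact: exprn_measurable.
  - by apply: measurable_funTS.
  - move=> s /=; rewrite in_itv/= => /andP[s0 s1].
    rewrite -EFinM lee_fin ler_piMr// exprn_ile1// ltW//.
move=> S1.
have mS' : measurable_fun (@unit_ball R N) (fun y => (\1_S (enorm y) : R)%:E).
  apply: measurable_funTS; apply/measurable_EFinP.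
  exact: (measurableT_comp (measurable_indic mS) (@measurable_enorm R N)).
have /(ae_eq_integral_abs _ mB mS') : (\int[lebesgue_rV R N]_(y in @unit_ball R N)
    `|(\1_S (enorm y))%:E| = 0)%E by under eq_integral do rewrite gee0_abs ?lee_fin//.
apply: filterS => x /= h /h /eqP; rewrite eqe indicE.
by have [xS|] := boolP (enorm x \in S); [rewrite oner_eq0|move/negP => nS _ Sx; apply: nS; rewrite inE].
Qed.

(** The fundamental lemma of the calculus of variations in the radial
    variable: indicators of intervals are limits of bumps, and an integrable
    function is almost everywhere the derivative of its indefinite integral. *)
Lemma bump_ae0 (R : realType) (F : R -> R) (a : R) : 0 <= a -> a < 1 ->
  (@lebesgue_measure R).-integrable setT (EFin \o F) ->
  (forall s, ~~ (a < s < 1) -> F s = 0) ->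
  (forall n (b : R), a < b -> b <= 1 ->
    \int[lebesgue_measure]_(s in `]0, 1[) (bump a b n s * F s) = 0) ->
  {ae (@lebesgue_measure R), forall s, F s = 0}.
Proof.
move=> a0 a1 iF F0 hF.
have mF : measurable_fun setT F by exact: integrable_measurable iF.
have m01 : measurable (`]0%R, 1%R[%classic : set R) by exact: measurable_itv.
have ind b : a < b -> b <= 1 ->
    (\int[lebesgue_measure]_(s in `]0%R, 1%R[) (\1_(`]a, b[%classic : set R) s * F s)%:E = 0)%E.
  move=> ab b1.
  have mb n : measurable_fun setT (bump a b n).
    by apply: continuous_measurable_fun; exact: sm_continuous (sm_bump a b n).
  have mbF n : measurable_fun setT (fun s => (bump a b n s * F s)%:E).
    by apply/measurable_EFinP; exact: measurable_funM.
  have mbF' : measurable_fun setT (fun s => (\1_(`]a, b[%classic : set R) s * F s)%:E).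
    have mI : measurable_fun setT (\1_(`]a, b[%classic : set R) : R -> R).
      by apply: measurable_indic; exact: measurable_itv.
    by apply/measurable_EFinP; exact: measurable_funM mI mF.
  have [] := @dominated_convergence _ _ _ (@lebesgue_measure R) _ m01
    (fun n s => (bump a b n s * F s)%:E)
    (fun s => (\1_(`]a, b[%classic : set R) s * F s)%:E) (fun s => `|(F s)%:E|%E).
  - by move=> n; exact: measurable_funTS (mbF n).
  - exact: measurable_funTS mbF'.
  - apply: aeW => s _; apply: cvg_EFin; first exact: nearW.
    by apply: cvgM; [exact: cvg_bump|exact: cvg_cst].
  - by apply: integrable_abse; apply: integrableS iF.
  - apply: aeW => s n _; rewrite abse_EFin lee_fin normrM ler_piMl//.
    by rewrite ger0_norm ?bump_ge0// bump_le1.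
  move=> _ _ h; apply/esym; apply: (cvg_unique _ _ h) => //.
  apply: (@cvg_trans _ (cst 0%E @ \oo)); last exact: cvg_cst.
  apply: near_eq_cvg; apply: nearW => n /=; rewrite -EFin_Rintegral//; first by rewrite hF.
  rewrite (_ : EFin \o _ = EFin \o (fun s => F s * bump a b n s)); last first.
    by apply/funext => s /=; rewrite mulrC.
  apply: (integrable_mulb (K := 1)) => //.
  - by apply: integrableS iF.
  - exact: (measurable_funTS (mb n)).
  - by move=> s _; rewrite ger0_norm ?bump_ge0// bump_le1.
have F1 x : \int[lebesgue_measure]_(t in `]-oo, x]) F t = 0.
  rewrite /Rintegral -integral_itv_bndo_bndc; last by apply: measurable_funTS; apply/measurable_EFinP.
  have [xa|ax] := leP x a.
    rewrite (eq_integral (cst 0%E)) ?integral0// => s; rewrite inE/= in_itv/= => sx.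
    by rewrite F0// negb_and -leNgt (ltW (lt_le_trans sx xa)).
  suff -> : (\int[lebesgue_measure]_(t in `]-oo, x[) (F t)%:E =
     \int[lebesgue_measure]_(s in `]0%R, 1%R[)
        (\1_(`]a, Num.min x 1[%classic : set R) s * F s)%:E)%E.
    by rewrite ind// ?lt_min ?ax// ge_min lexx orbT.
  rewrite [LHS]integral_indicE [RHS]integral_indicE; apply: eq_integral => s _.
  rewrite -!EFinM; congr (_%:E); rewrite !indicE !mem_setE !in_itv/= lt_min.
  have [/andP[as_ s1]|/F0 ->] := boolP (a < s < 1); last by rewrite !mulr0.
  by rewrite (le_lt_trans a0 as_) as_ s1 mul1r andbT.
have := @FTC1Ny R F.
case.
- by move=> y; apply: integrableS iF.
- split => //; first exact: openT.
  move=> K _ cK; have /integrableP[_] := iF; apply: le_lt_trans.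
  apply: ge0_subset_integral => //; first exact: compact_measurable.
  by apply/measurable_EFinP; apply: measurableT_comp.
move=> Z [mZ Z0 ZP]; exists Z; split => //; apply: subset_trans ZP.
apply: subsetC => s /= [_ <-]; rewrite (_ : (fun x => _) = cst 0); last first.
  by apply/funext => x; exact: F1.
by rewrite derive1_cst.
Qed.

(** The profile of a radial function is only known to exist as a function; its
    restriction to a generic ray is a measurable one. *)
Lemma radial_measurable (R : realType) N (u : 'rV[R]_N -> R) : (1 < N)%N ->
  (0 < lebesgue_rV R N (@unit_ball R N))%E ->
  measurable_fun (@unit_ball R N) u -> radial u ->
  exists2 f : R -> R, measurable_fun setT f &
    {ae lebesgue_rV R N, forall x, unit_ball x -> u x = f (enorm x)}.
Proof.
move=> N1 B0 mu [f0 [Z [mZ Z0 Zsub]]]; have mB := @measurable_unit_ball R N.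
have [e e1 eZ] := generic_ray N1 mZ Z0 B0.
pose U x := \1_(@unit_ball R N) x * u x.
have mU : measurable_fun setT U.
  rewrite (_ : U = u \_ (@unit_ball R N)); first by apply/(measurable_restrictT _ mB).
  by apply/funext => x; rewrite /U patchE indicE; case: ifP => _; rewrite ?mul1r ?mul0r.
have mr := measurable_ray e.
exists (fun s => U (s *: e)); first exact: (measurableT_comp mU mr).
have mS : measurable [set s : R | Z (s *: e)].
  by rewrite -[X in measurable X]setTI; exact: mr.
have h1 := radial_null N1 mS.
have h2 : {ae lebesgue_rV R N, forall x, unit_ball x -> ~ [set s : R | Z (s *: e)] (enorm x)}.
  apply: h1; rewrite -[RHS]eZ; apply: eq_integral => s _; congr (_%:E).
have h3 : {ae lebesgue_rV R N, forall x, unit_ball x -> u x = f0 (enorm x)} by exists Z.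
near=> x.
move=> Bx; have -> : u x = f0 (enorm x) by move: Bx; near: x.
have nZ : ~ Z (enorm x *: e) by move: Bx; near: x.
have Be : unit_ball (enorm x *: e).
  by rewrite /unit_ball/= enormZ e1 mulr1 ger0_norm ?enorm_ge0.
rewrite /U indicE mem_set// mul1r.
have -> : u (enorm x *: e) = f0 (enorm (enorm x *: e)).
  apply: contrapT => uf; apply: nZ; apply: Zsub => /= /(_ Be); exact: uf.
by rewrite enormZ e1 mulr1 ger0_norm ?enorm_ge0.
Unshelve. all: by end_near.
Qed.

Lemma measurable_natb d (T : measurableType d) (R : realType) (D : set T) (b : T -> bool) :
  measurable_fun D b -> measurable_fun D (fun x => (b x)%:R : R).
Proof.
move=> mb; apply: (measurableT_comp (f := fun b : bool => b%:R : R)) => //.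
Qed.

(** The kernel that turns a function of the radius, integrated over [s], into
    its primitive at [|x|]. *)
Definition reached (R : realType) N (x : 'rV[R]_N) (s : R) : R := (s <= enorm x)%R%:R.

Lemma measurable_reached (R : realType) N :
  measurable_fun setT (fun p : 'rV[R]_N * R => reached p.1 p.2).
Proof.
apply: measurable_natb; apply: measurable_fun_ler; first exact: measurable_snd.
exact: (measurableT_comp (@measurable_enorm R N) measurable_fst).
Qed.

Lemma measurable_reachedl (R : realType) N (s : R) :
  measurable_fun setT (fun x : 'rV[R]_N => reached x s).
Proof.
apply: measurable_natb; apply: measurable_fun_ler; first exact: measurable_cst.
exact: (@measurable_enorm R N).
Qed.

Lemma reached_ge0 (R : realType) N (x : 'rV[R]_N) (s : R) : 0 <= reached x s.
Proof. by rewrite ler0n. Qed.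

Lemma reached_le1 (R : realType) N (x : 'rV[R]_N) (s : R) : `|reached x s| <= 1.
Proof. by rewrite ger0_norm ?reached_ge0// /reached; case: (s <= enorm x); rewrite ?ler01. Qed.

Lemma integral_reached (R : realType) N (x : 'rV[R]_N) (chi eta : R -> R) (a : R) :
  0 < a -> 0 < enorm x -> enorm x < 1 -> continuous chi ->
  (forall s : R, is_derive s 1 eta (chi s)) -> (forall s, s < a -> eta s = 0) ->
  \int[lebesgue_measure]_(s in `]0, 1[) (chi s * reached x s) = eta (enorm x).
Proof.
move=> a0 r0 r1 cchi deta eta0; rewrite /reached; move: (enorm x) r0 r1 => r r0 r1.
have ceta : continuous eta by move=> s; exact: der_cvg (deta s).
have mchi : measurable_fun setT chi by exact: continuous_measurable_fun.
rewrite /Rintegral.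
have -> : (\int[lebesgue_measure]_(s in `]0%R, 1%R[) (chi s * (s <= r)%R%:R)%:E =
  \int[lebesgue_measure]_(s in `[0%R, r]) (chi s)%:E)%E.
  rewrite -[RHS]integral_itv_obnd_cbnd; last first.
    by apply: measurable_funTS; apply/measurable_EFinP.
  rewrite [LHS]integral_indicE [RHS]integral_indicE; apply: eq_integral => s _.
  rewrite -!EFinM; congr (_%:E); rewrite !indicE !mem_setE !in_itv/=.
  have [sr|rs] := leP s r; last by rewrite andbF !mulr0 mul0r.
  by rewrite (le_lt_trans sr r1) mulr1.
rewrite (@continuous_FTC2 _ chi eta)//; first by rewrite (eta0 0)// sube0.
- exact: continuous_subspaceT.
- split; first by move=> s _; exact: (@ex_derive _ _ _ _ _ _ _ (deta s)).
  + by apply: cvg_at_right_filter; exact: ceta.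
  + by apply: cvg_at_left_filter; exact: ceta.
- by move=> s _; rewrite derive1E (@derive_val _ _ _ _ _ _ _ (deta s)).
Qed.

Lemma integral_01_primitive (R : realType) (chi eta : R -> R) :
  continuous chi -> (forall s : R, is_derive s 1 eta (chi s)) -> eta 0 = 0 ->
  \int[lebesgue_measure]_(s in `]0, 1[) chi s = eta 1.
Proof.
move=> cchi deta eta0.
have ceta : continuous eta by move=> s; exact: der_cvg (deta s).
have mchi : measurable_fun setT chi by exact: continuous_measurable_fun.
have mE : measurable_fun setT (EFin \o chi) by apply/measurable_EFinP.
rewrite /Rintegral integral_itv_obnd_cbnd; last exact: measurable_funTS.
rewrite integral_itv_bndo_bndc; last exact: measurable_funTS.
rewrite (@continuous_FTC2 _ chi eta)//; first by rewrite eta0 sube0.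
- exact: continuous_subspaceT.
- split; first by move=> s _; exact: (@ex_derive _ _ _ _ _ _ _ (deta s)).
  + by apply: cvg_at_right_filter; exact: ceta.
  + by apply: cvg_at_left_filter; exact: ceta.
- by move=> s _; rewrite derive1E (@derive_val _ _ _ _ _ _ _ (deta s)).
Qed.

(** Up to the area of the sphere, the integral from [s] to [1] of the
    derivative of the profile, hence minus the profile at [s] for functions
    vanishing on the boundary. *)
Definition flux (R : realType) N (Du : 'rV[R]_N -> 'rV[R]_N) (s : R) : R :=
  \int[lebesgue_rV R N]_(x in @unit_ball R N) (flux_density Du x * reached x s).

(** Away from the origin the factor [x / |x|^N] is bounded. *)
Lemma flux_density_integrable (R : realType) N (Du : 'rV[R]_N -> 'rV[R]_N) (a : R) :
  0 < a -> (forall i, L2 (fun x => Du x ord0 i)) ->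
  (lebesgue_rV R N).-integrable (@unit_ball R N)
    (EFin \o (fun x => flux_density Du x * reached x a)).
Proof.
move=> a0 Du2; have mB := @measurable_unit_ball R N.
have h i : (lebesgue_rV R N).-integrable (@unit_ball R N)
    (EFin \o (fun x => Du x ord0 i * (x ord0 i / enorm x ^+ N * reached x a))).
  apply: L2_mul_integrable => //; apply: (L2_bounded (C := a ^- N)).
    apply: measurable_funTS; apply: measurable_funM; last exact: measurable_reachedl.
    apply: measurable_funM; first exact: measurable_coord.
    apply: (measurableT_comp (@measurable_invr R)).
    by apply: measurable_funX; exact: measurable_enorm.
  move=> x Bx; rewrite /reached; have [ax|] := leP a (enorm x); last first.
    by rewrite mulr0 normr0 invr_ge0 exprn_ge0// ltW.
  rewrite mulr1 normrM -[leRHS]mul1r; apply: ler_pM => //.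
    by rewrite (le_trans (normr_coord_le_enorm _ _))// ltW.
  rewrite ger0_norm ?invr_ge0 ?exprn_ge0 ?enorm_ge0// lef_pV2 ?posrE ?exprn_gt0//.
    by rewrite lerXn2r ?nnegrE ?enorm_ge0// ltW.
  exact: lt_le_trans ax.
have [+ _] := Rintegral_sum mB h; apply: eq_integrable => // x _ /=; congr (_%:E).
rewrite /flux_density /dot 2!mulr_suml; apply: eq_bigr => i _; ring.
Qed.

(** As a function of [s] the integral is a difference of two monotone
    functions. *)
Lemma measurable_flux (R : realType) N (g : 'rV[R]_N -> R) :
  (lebesgue_rV R N).-integrable (@unit_ball R N) (EFin \o g) ->
  measurable_fun setT (fun s => \int[lebesgue_rV R N]_(x in @unit_ball R N) (g x * reached x s))
  /\ exists C, forall s,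
    `|\int[lebesgue_rV R N]_(x in @unit_ball R N) (g x * reached x s)| <= C.
Proof.
move=> ig; have mB := @measurable_unit_ball R N.
have mul f s : (lebesgue_rV R N).-integrable (@unit_ball R N) (EFin \o f) ->
    (lebesgue_rV R N).-integrable (@unit_ball R N) (EFin \o (fun x => f x * reached x s)).
  move=> fi; apply: (integrable_mulb (K := 1)) => //.
    by apply: measurable_funTS; exact: measurable_reachedl.
  by move=> x _; exact: reached_le1.
have ing : (lebesgue_rV R N).-integrable (@unit_ball R N) (EFin \o (fun x => `|g x|)).
  exact: integrable_norm.
have idg := integrable_subr mB ing ig.
have mono f : (lebesgue_rV R N).-integrable (@unit_ball R N) (EFin \o f) ->
    (forall x, 0 <= f x) -> measurable_fun setT
      (fun s => \int[lebesgue_rV R N]_(x in @unit_ball R N) (f x * reached x s)).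
  move=> fi f0; apply: nonincreasing_measurable => // s t st.
  apply: le_Rintegral => //; [exact: mul|exact: mul|].
  move=> x _; rewrite ler_wpM2l// ler_nat /reached.
  by have [tx|//] := leP t (enorm x); rewrite (le_trans st tx).
split.
  have -> : (fun s => \int[lebesgue_rV R N]_(x in @unit_ball R N) (g x * reached x s)) =
      (fun s => \int[lebesgue_rV R N]_(x in @unit_ball R N) (`|g x| * reached x s) -
        \int[lebesgue_rV R N]_(x in @unit_ball R N) ((`|g x| - g x) * reached x s)).
    apply/funext => s; rewrite -RintegralB//; [|exact: mul|exact: mul].
    by apply: eq_Rintegral => x _; ring.
  by apply: measurable_funB; apply: mono => // x; rewrite subr_ge0 ler_norm.
exists (\int[lebesgue_rV R N]_(x in @unit_ball R N) `|g x|) => s.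
apply: le_trans (le_normr_Rintegral mB (mul _ s ig)) _.
apply: le_Rintegral => //; first exact: (integrable_norm (mul _ s ig)).
by move=> x _; rewrite normrM ler_piMr// reached_le1.
Qed.

Lemma ae_eq_integrable d (T : measurableType d) (R : realType)
    (mu : {measure set T -> \bar R}) (D : set T) (f g : T -> R) :
  measurable D -> measurable_fun D g -> {ae mu, forall x, D x -> f x = g x} ->
  mu.-integrable D (EFin \o f) -> mu.-integrable D (EFin \o g).
Proof.
move=> mD mg fg /integrableP[mf fi]; apply/integrableP.
have mEg : measurable_fun D (EFin \o g) by apply/measurable_EFinP.
split => //; suff -> : (\int[mu]_(x in D) `|(EFin \o g) x| =
  \int[mu]_(x in D) `|(EFin \o f) x|)%E by [].
apply: ae_eq_integral => //; [exact: measurableT_comp|exact: measurableT_comp|].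
by apply: filterS fg => x h Dx /=; rewrite h.
Qed.

Lemma radial_integrable01 (R : realType) N (f : R -> R) : (1 < N)%N ->
  (0 < lebesgue_rV R N (@unit_ball R N))%E -> measurable_fun setT f ->
  (lebesgue_rV R N).-integrable (@unit_ball R N) (EFin \o (fun x => f (enorm x))) ->
  (@lebesgue_measure R).-integrable `]0, 1[%classic (EFin \o (fun s => f s * s ^+ N.-1)).
Proof.
move=> N1 B0 mf /integrableP[_ fi].
have mnf : measurable_fun setT (fun s => `|f s|%:E).
  by apply/measurable_EFinP; exact: measurableT_comp.
have := ge0_integral_radial N1 mnf (fun s => _).
rewrite /= => /(_ (fun s => normr_ge0 _)) h; move: fi; rewrite /= h => {}h.
apply/integrableP; split.
  by apply: measurable_funTS; apply/measurable_EFinP; apply: measurable_funM => //; exact: exprn_measurable.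
have Eq : (\int[lebesgue_measure]_(s in `]0%R, 1%R[) `|(f s * s ^+ N.-1)%R%:E| =
    \int[lebesgue_measure]_(s in `]0%R, 1%R[) (`|f s|%:E * (s ^+ N.-1)%:E))%E.
  apply: eq_integral => s; rewrite inE/= in_itv/= => /andP[s0 _].
  by rewrite normrM EFinM [X in (_ * X%:E)%E]ger0_norm// exprn_ge0// ltW.
have I0 : (0 <= \int[lebesgue_measure]_(s in `]0%R, 1%R[) (`|f s|%:E * (s ^+ N.-1)%:E))%E.
  apply: integral_ge0 => s /=; rewrite in_itv/= => /andP[s0 _].
  by rewrite -EFinM lee_fin mulr_ge0// exprn_ge0// ltW.
rewrite [X in (X < _)%E]Eq; move: I0 h.
case: (\int[_]_(_ in _) _)%E => // [r _ _|_]; first exact: ltry.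
rewrite gt0_muley// gt0_muley ?ltxx// lte_fin ltr0n.
by rewrite (leq_trans _ N1).
Qed.

(** Away from the origin the Jacobian [s ^+ N.-1] is bounded below. *)
Lemma radial_integrable (R : realType) N (f : R -> R) (a : R) : (1 < N)%N ->
  (0 < lebesgue_rV R N (@unit_ball R N))%E -> 0 < a -> measurable_fun setT f ->
  (lebesgue_rV R N).-integrable (@unit_ball R N) (EFin \o (fun x => f (enorm x))) ->
  (@lebesgue_measure R).-integrable `]a, 1[%classic (EFin \o f).
Proof.
move=> N1 B0 a0 mf fi; have i01 := radial_integrable01 N1 B0 mf fi.
have ma : measurable (`]a, 1[%classic : set (measurableTypeR R)) by exact: measurable_itv.
have ia : (@lebesgue_measure R).-integrable `]a, 1[%classic (EFin \o (fun s => f s * s ^+ N.-1)).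
  apply: integrableS i01 => //.
  by move=> s /=; rewrite !in_itv/= => /andP[as_ ->]; rewrite (lt_trans a0).
have mi : measurable_fun (`]a, 1[%classic : set R) (fun s : R => s ^- N.-1).
  by apply: measurable_funTS; apply: (measurableT_comp (@measurable_invr R)); exact: exprn_measurable.
have bi s : (`]a, 1[%classic : set R) s -> `|s ^- N.-1| <= a ^- N.-1.
  rewrite /= in_itv/= => /andP[as_ _]; have s0 := lt_trans a0 as_.
  rewrite ger0_norm ?invr_ge0 ?exprn_ge0 ?(ltW s0)//.
  by rewrite lef_pV2 ?posrE ?exprn_gt0// lerXn2r ?nnegrE// ltW.
have := integrable_mulb ma ia mi bi; apply: eq_integrable => // s.
rewrite inE/= in_itv/= => /andP[as_ _]; congr (_%:E).
by rewrite mulfK// expf_neq0// gt_eqF// (lt_trans a0).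
Qed.

Lemma Rintegral_radial (R : realType) N (G : R -> R) :
  (1 < N)%N -> measurable_fun setT G ->
  (lebesgue_measure).-integrable (`]0%R, 1%R[%classic : set R) (EFin \o (fun s => G s * s ^+ N.-1)) ->
  \int[lebesgue_rV R N]_(y in @unit_ball R N) G (enorm y) =
   N%:R * fine (lebesgue_rV R N (@unit_ball R N)) *
     \int[lebesgue_measure]_(s in `]0, 1[) (G s * s ^+ N.-1).
Proof.
move=> N1 mG iG; rewrite {1}/Rintegral integral_radial// -EFin_Rintegral//.
have Bfin : lebesgue_rV R N (@unit_ball R N) \is a fin_num.
  by rewrite ge0_fin_numE// lebesgue_rV_unit_ball_lty.
by rewrite -{1}(fineK Bfin) -!EFinM /= mulrA.
Qed.

(** The area of the unit sphere is [N] times the volume of the ball. *)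
Definition sphere_area (R : realType) N : R := N%:R * fine (lebesgue_rV R N (@unit_ball R N)).

Lemma sphere_area_gt0 (R : realType) N : (1 < N)%N ->
  (0 < lebesgue_rV R N (@unit_ball R N))%E -> 0 < sphere_area R N.
Proof.
move=> N1 B0; rewrite mulr_gt0 ?ltr0n ?(leq_trans _ N1)// fine_gt0// B0.
exact: lebesgue_rV_unit_ball_lty.
Qed.

(** Integration by parts against the radial field gives the identity in the
    sense of distributions, and the fundamental lemma makes it pointwise. *)
Lemma radial_flux (R : realType) N (u : 'rV[R]_N -> R) Du : (1 < N)%N ->
  (0 < lebesgue_rV R N (@unit_ball R N))%E -> H10 u Du -> radial u ->
  {ae lebesgue_rV R N, forall x, unit_ball x -> u x = - flux Du (enorm x) / sphere_area R N}.
Proof.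
move=> N1 B0 hu ru; have mB := @measurable_unit_ball R N.
have N0 : (0 < N)%N by exact: leq_trans N1.
have [u2 Du2] := H10_L2 hu; have mu := L2_measurable u2.
have w0 := sphere_area_gt0 N1 B0; set w := sphere_area R N in w0 *.
have [f mf uf] := radial_measurable N1 B0 mu ru.
have mfe : measurable_fun setT (fun x : 'rV[R]_N => f (enorm x)).
  exact: (measurableT_comp mf (@measurable_enorm R N)).
have ife : (lebesgue_rV R N).-integrable (@unit_ball R N) (EFin \o (fun x => f (enorm x))).
  apply: (ae_eq_integrable (f := u)) => //; first exact: measurable_funTS.
  exact: L2_integrable.
(* Away from the origin the flux is an integrable function of the radius;
   the countably many [a n] below then exhaust the ball. *)
have key (a : R) : 0 < a -> a < 1 -> {ae lebesgue_rV R N, forall x, unit_ball x ->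
    a < enorm x -> u x = - flux Du (enorm x) / w}.
  move=> a0 a1.
  have ia := flux_density_integrable a0 Du2.
  have [mh [C hC]] := measurable_flux ia.
  set h := fun s => Rintegral _ _ _ in mh hC.
  pose F s := (w * f s + h s) * \1_(`]a, 1[%classic : set R) s.
  have m1 : measurable (`]a, 1[%classic : set (measurableTypeR R)) by exact: measurable_itv.
  have loo : (lebesgue_measure (`]a, 1%R[%classic : set R) < +oo)%E.
    by rewrite lebesgue_measure_itv/=; case: ifP => _; rewrite ?ltry.
  have ifa := radial_integrable N1 B0 a0 mf ife.
  have iha : (@lebesgue_measure R).-integrable `]a, 1[%classic (EFin \o h).
    apply: (integrable_bounded (K := C)) => //; last by move=> s _; exact: hC.
    exact: (measurable_funTS mh).
  have iF1 : (@lebesgue_measure R).-integrable `]a, 1[%classic (EFin \o (fun s => w * f s + h s)).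
    by apply: integrable_addr => //; exact: integrable_mulrl.
  have iF : (@lebesgue_measure R).-integrable setT (EFin \o F).
    have := integrable_indic_mul m1 iF1; apply: eq_integrable => // s _.
    by rewrite -EFinM /= /F mulrC.
  have Fout s : ~~ (a < s < 1) -> F s = 0.
    by move=> ns; rewrite /F indicE mem_setE in_itv/= (negbTE ns) mulr0.
  have hF n (b : R) : a < b -> b <= 1 ->
      \int[lebesgue_measure]_(s in `]0, 1[) (bump a b n s * F s) = 0.
    move=> ab b1; pose chi := bump a b n.
    have schi : sm chi := sm_bump a b n.
    have cchi : continuous chi := sm_continuous schi.
    have mchi : measurable_fun setT chi by exact: continuous_measurable_fun.
    have chi0 s : s < a -> chi s = 0 by move=> sa; apply: bump_eq0l; exact: ltW.
    have chi1 s : `|chi s| <= 1 by rewrite ger0_norm ?bump_ge0// bump_le1.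
    have [eta [seta deta eta0]] := sm_primitive a0 schi chi0.
    have := H10_radial_pairing N0 hu a0 seta deta eta0 chi0.
    have i0 : lebesgue_measure.-integrable (`]0%R, 1%R[%classic : set R)
        (EFin \o (fun s => f s * chi s)).
      have := integrable_mulb (K := 1) m1 ifa (measurable_funTS mchi) (fun s _ => chi1 s).
      move=> /(integrable_indic_mul m1) /(@integrableS _ _ _ _ _ _ _ measurableT).
      move=> /(_ `]0, 1[%classic (measurable_itv _) (fun _ _ => I)).
      apply: eq_integrable => // s; rewrite inE/= in_itv/= => /andP[s0 s1].
      rewrite -EFinM indicE mem_setE in_itv/= s1 andbT.
      have [//|sa] := ltP a s; first by rewrite mul1r.
      by rewrite /chi bump_eq0l// !mulr0.
    have ih0 : lebesgue_measure.-integrable (`]0%R, 1%R[%classic : set R)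
        (EFin \o (fun s => chi s * h s)).
      apply: (integrable_bounded (K := C)) => //.
      - exact: lebesgue_itv01_lty.
      - by apply: measurable_funTS; exact: measurable_funM.
      - move=> s _; rewrite normrM (le_trans _ (hC s))// ler_piMl//.
    have -> : \int[lebesgue_rV R N]_(x in @unit_ball R N)
       (u x * (chi (enorm x) / enorm x ^+ N.-1)) =
       w * \int[lebesgue_measure]_(s in `]0, 1[) (f s * chi s).
      pose G s := f s * (chi s / s ^+ N.-1).
      have mG : measurable_fun setT G.
        apply: measurable_funM => //; apply: measurable_funM => //.
        by apply: (measurableT_comp (@measurable_invr R)); exact: exprn_measurable.
      have GE s : 0 < s -> G s * s ^+ N.-1 = f s * chi s.
        by move=> s0; rewrite /G mulrA divfK// expf_neq0// gt_eqF.
      transitivity (\int[lebesgue_rV R N]_(x in @unit_ball R N) G (enorm x)).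
        rewrite /Rintegral; congr fine; apply: ae_eq_integral => //.
        - apply/measurable_EFinP; apply: measurable_funM => //.
          apply: measurable_funTS; apply: (measurableT_comp (f := fun s => chi s / s ^+ N.-1)).
            apply: measurable_funM => //.
            by apply: (measurableT_comp (@measurable_invr R)); exact: exprn_measurable.
          exact: (@measurable_enorm R N).
        - apply: measurable_funTS; apply/measurable_EFinP.
          exact: (measurableT_comp mG (@measurable_enorm R N)).
        - by apply: filterS uf => x /= hx Bx; rewrite /G hx.
      rewrite Rintegral_radial//.
        congr (_ * _); apply: eq_Rintegral => s; rewrite inE/= in_itv/= => /andP[s0 _].
        by rewrite GE.
      apply: eq_integrable i0 => // s; rewrite inE/= in_itv/= => /andP[s0 _].
      by rewrite GE.
    have -> : \int[lebesgue_rV R N]_(x in @unit_ball R N)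
        (flux_density Du x * eta (enorm x)) =
        \int[lebesgue_measure]_(s in `]0, 1[) (chi s * h s).
      rewrite -(fubini_kernel ia mchi chi1 (@measurable_reached R N) (@reached_le1 R N)).
      apply: eq_Rintegral => x; rewrite inE => Bx.
      have [ax|xa] := leP a (enorm x).
        rewrite (integral_reached a0 _ Bx cchi deta eta0) ?(lt_le_trans a0 ax)//.
        by rewrite /reached ax mulr1.
      by rewrite eta0// /reached leNgt xa/= !mulr0 mul0r.
    move=> /eqP; rewrite -addr_eq0 => /eqP E.
    rewrite -[RHS]E -RintegralZl// -RintegralD//; last exact: integrable_mulrl.
    apply: eq_Rintegral => s; rewrite inE/= in_itv/= => /andP[s0 s1].
    rewrite /F indicE mem_setE in_itv/= s1 andbT.
    have [as_|sa] := ltP a s; first by rewrite mulr1 -/chi; ring.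
    by rewrite /chi bump_eq0l// !(mul0r, mulr0) addr0.
  have [Z [mZ Z0 Zsub]] := bump_ae0 (ltW a0) a1 iF Fout hF.
  have Z1 : (\int[lebesgue_measure]_(s in `]0%R, 1%R[) (\1_Z s)%:E = 0)%E.
    rewrite integral_indic//; apply/eqP; rewrite eq_le measure_ge0 andbT -Z0.
    by apply: le_measure; rewrite ?inE//; exact: measurableI.
  have nz := radial_null N1 mZ Z1.
  apply: filterS2 uf nz => x /= ufx nzx Bx ax; have := nzx Bx => nZ.
  have F0 : F (enorm x) = 0 by apply: contrapT => h0; apply: nZ; exact: Zsub.
  move: F0; rewrite /F indicE mem_setE in_itv/= ax Bx mulr1 ufx// => F0.
  have -> : flux Du (enorm x) = h (enorm x).
    rewrite /flux /h; apply: eq_Rintegral => y _; rewrite /reached.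
    have [xy|] := leP (enorm x) (enorm y); last by rewrite !mulr0.
    by rewrite (le_trans (ltW ax) xy) !mulr1.
  apply: (mulfI (lt0r_neq0 w0)); rewrite mulrCA mulfV ?lt0r_neq0// mulr1.
  by apply/eqP; rewrite -addr_eq0 F0.
pose a n : R := n.+2%:R^-1.
have a0 n : 0 < a n by rewrite invr_gt0.
have a1 n : a n < 1 by rewrite invf_lt1// ltr1n.
have all_a := ae_foralln (fun n => key (a n) (a0 n) (a1 n)).
have nz := unit_ball_ae (P := fun x : 'rV[R]_N => x != 0) N0 (fun x h _ => h).
apply: filterS2 all_a nz => x hx x0 Bx.
have r0 : 0 < enorm x by rewrite enorm_gt0 x0.
have [n ne] : exists n, a n < enorm x.
  have [n hn] := ltr_add_invr r0; exists n; rewrite add0r in hn.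
  by apply: le_lt_trans hn; rewrite lef_pV2 ?posrE// ler_nat.
exact: (hx n).
Qed.

(** * Bounds on the flux *)

Lemma quadratic_ge0 (R : realType) (a b c : R) : 0 <= a ->
  (forall t : R, 0 <= a - 2 * t * b + t ^+ 2 * c) -> b ^+ 2 <= a * c.
Proof.
move=> a0 h; have [c0|c0|c0] := ltgtP c 0.
- exfalso; have := h ((a + 1 + 2 * `|b|) / - c + 1).
  have cn : 0 < - c by rewrite oppr_gt0.
  set t := _ + 1; have t1 : 1 <= t.
    by rewrite lerDr divr_ge0// ?addr_ge0// ltW.
  have tc : t * c <= - (a + 1 + 2 * `|b|) + c.
    rewrite /t mulrDl mul1r lerD2r le_eqVlt; apply/orP; left; apply/eqP.
    by field; rewrite lt_eqF.
  have b1 : - b <= `|b| by rewrite -normrN ler_norm.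
  have : t * (t * c) <= t * (- (a + 1 + 2 * `|b|) + c) by rewrite ler_wpM2l// (le_trans _ t1).
  have : t * - b <= t * `|b| by rewrite ler_wpM2l// (le_trans _ t1).
  have : a <= t * a by rewrite ler_peMl.
  move: `|b| => B; nra.
- have := h (b / c); have -> : a - 2 * (b / c) * b + (b / c) ^+ 2 * c = (a * c - b ^+ 2) / c.
    by field; rewrite gt_eqF.
  by rewrite pmulr_lge0 ?invr_gt0// subr_ge0.
- have [->|b0] := eqVneq b 0; first by rewrite expr0n/= mulr_ge0// c0.
  have := h ((a + 1) / (2 * b)); rewrite c0 mulr0 addr0.
  have -> : a - 2 * ((a + 1) / (2 * b)) * b = - 1 by field.
  by rewrite oppr_ge0 ler10.
Qed.

(** The discriminant of [t -> |f - t g|^2] is non-positive. *)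
Lemma L2_cauchy_schwarz (R : realType) N (f g : 'rV[R]_N -> R) : L2 f -> L2 g ->
  (\int[lebesgue_rV R N]_(x in @unit_ball R N) (f x * g x)) ^+ 2 <=
  (\int[lebesgue_rV R N]_(x in @unit_ball R N) (f x ^+ 2)) *
  (\int[lebesgue_rV R N]_(x in @unit_ball R N) (g x ^+ 2)).
Proof.
move=> hf hg; have mB := @measurable_unit_ball R N.
have f2 := L2_sqr_integrable hf; have g2 := L2_sqr_integrable hg.
have fg := L2_mul_integrable hf hg.
apply: quadratic_ge0 => [|t]; first by apply: Rintegral_ge0 => x _; rewrite sqr_ge0.
have i1 : (lebesgue_rV R N).-integrable (@unit_ball R N)
  (EFin \o (fun x => 2 * t * (f x * g x))) by exact: integrable_mulrl.
have i2 : (lebesgue_rV R N).-integrable (@unit_ball R N)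
  (EFin \o (fun x => t ^+ 2 * g x ^+ 2)) by exact: integrable_mulrl.
have i3 := integrable_subr mB f2 i1.
rewrite -!RintegralZl// -RintegralB// -RintegralD//.
apply: Rintegral_ge0 => x _.
have -> : f x ^+ 2 - 2 * t * (f x * g x) + t ^+ 2 * g x ^+ 2 = (f x - t * g x) ^+ 2 by ring.
exact: sqr_ge0.
Qed.

Definition annulus (R : realType) N (s t : R) (x : 'rV[R]_N) : R := reached x s - reached x t.

Lemma annulusE (R : realType) N (s t : R) (x : 'rV[R]_N) : s <= t ->
  annulus s t x = (s <= enorm x < t)%R%:R.
Proof.
move=> st; rewrite /annulus /reached; have [tx|] := leP t (enorm x).
  by rewrite (le_trans st tx) subrr andbF.
by rewrite subr0 andbT.
Qed.

Lemma annulus_sqr (R : realType) N (s t : R) (x : 'rV[R]_N) : s <= t ->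
  annulus s t x ^+ 2 = annulus s t x.
Proof. by move=> st; rewrite annulusE//; case: (_ && _); rewrite ?expr1n ?expr0n. Qed.

Lemma annulus_norm_le1 (R : realType) N (s t : R) (x : 'rV[R]_N) : s <= t ->
  `|annulus s t x| <= 1.
Proof. by move=> st; rewrite annulusE//; case: (_ && _); rewrite ?normr1 ?normr0 ?ler01. Qed.

Lemma annulus_ge0 (R : realType) N (s t : R) (x : 'rV[R]_N) : s <= t -> 0 <= annulus s t x.
Proof. by move=> st; rewrite annulusE. Qed.

Lemma measurable_annulus (R : realType) N (s t : R) :
  measurable_fun setT (@annulus R N s t).
Proof. by apply: measurable_funB; exact: measurable_reachedl. Qed.

Lemma integral_power (R : realType) (n : nat) (s t : R) : (2 < n)%N -> 0 < s -> s <= t ->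
  \int[lebesgue_measure]_(r in `[s, t]) (r ^- n.-1) =
  (s ^- n.-2 - t ^- n.-2) / (n%:R - 2).
Proof.
move=> n2 s0; rewrite le_eqVlt => /predU1P[<-|st].
  by rewrite subrr mul0r set_itv1 Rintegral_set1.
have m0 : n%:R - 2 != 0 :> R by rewrite subr_eq0 gt_eqF// ltr_nat.
case: n n2 m0 => [//|[//|m]] /=; rewrite !ltnS => m0 mn0.
pose F (r : R) := - (r ^- m / (m.+2%:R - 2)).
have dF (r : R) : r != 0 -> is_derive r 1 F (r ^- m.+1).
  move=> r0; have h1 := derX m (der_id r).
  have h2 := derV (f := fun y : R => y ^+ m) (expf_neq0 m r0) h1.
  have h3 := derN (derM h2 (der_cst (m.+2%:R - 2)^-1 r)).
  apply: is_derive_eq h3 _.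
  have mE : m.+2%:R - 2 = m%:R :> R by rewrite -addn2 natrD addrK.
  rewrite mE in mn0 *; case: m m0 mn0 {mE h1 h2 F} => // m _ mn0 /=.
  rewrite !exprS; field; rewrite r0 expf_neq0//=.
rewrite /Rintegral (@continuous_FTC2 _ (fun r : R => r ^- m.+1) F)//.
- by rewrite /F -EFinB/=; ring.
- apply: continuous_in_subspaceT => r; rewrite inE/= in_itv/= => /andP[sr _].
  have r0 : r != 0 by rewrite gt_eqF// (lt_le_trans s0).
  have h1 := derX m.+1 (der_id r).
  exact: der_cvg (derV (f := fun y : R => y ^+ m.+1) (expf_neq0 _ r0) h1).
- split.
  + move=> r; rewrite in_itv/= => /andP[sr _].
    by apply: (@ex_derive _ _ _ _ _ _ _ (dF r _)); rewrite gt_eqF// (lt_trans s0).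
  + by apply: cvg_at_right_filter; apply: der_cvg (dF s _); rewrite gt_eqF.
  + by apply: cvg_at_left_filter; apply: der_cvg (dF t _); rewrite gt_eqF// (lt_trans s0).
- move=> r; rewrite in_itv/= => /andP[sr _].
  by rewrite derive1E (@derive_val _ _ _ _ _ _ _ (dF r _))// gt_eqF// (lt_trans s0).
Qed.

Lemma integral_annulus_power (R : realType) N (s t : R) : (2 < N)%N -> 0 < s -> s <= t -> t <= 1 ->
  \int[lebesgue_rV R N]_(x in @unit_ball R N) (enorm x ^- (2 * N.-1) * annulus s t x) =
  sphere_area R N * ((s ^- N.-2 - t ^- N.-2) / (N%:R - 2)).
Proof.
move=> N2 s0 st t1; have m01 : measurable (`]0%R, 1%R[%classic : set (measurableTypeR R)).
  exact: measurable_itv.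
have powb (r : R) : s <= r -> r ^- N.-1 <= s ^- N.-1.
  move=> sr; have r0 := lt_le_trans s0 sr.
  by rewrite lef_pV2 ?posrE ?exprn_gt0// lerXn2r ?nnegrE// ltW.
pose G (r : R) := r ^- (2 * N.-1) * \1_(`[s, t[%classic : set R) r.
have mG : measurable_fun setT G.
  apply: measurable_funM; last by apply: measurable_indic; exact: measurable_itv.
  by apply: (measurableT_comp (@measurable_invr R)); exact: exprn_measurable.
transitivity (\int[lebesgue_rV R N]_(x in @unit_ball R N) G (enorm x)).
  apply: eq_Rintegral => x _; rewrite annulusE// /G indicE mem_setE in_itv/=.
  by [].
have GE (r : R) : 0 < r -> G r * r ^+ N.-1 = r ^- N.-1 * \1_(`[s, t[%classic : set R) r.
  move=> r0; rewrite /G mulrAC; congr (_ * _).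
  by rewrite mulSn mul1n exprD; field; rewrite expf_neq0// gt_eqF.
rewrite Rintegral_radial//; last 2 first.
- exact: leq_trans N2.
- apply: (integrable_bounded (K := s ^- N.-1)) => //.
  + exact: lebesgue_itv01_lty.
  + by apply: measurable_funTS; apply: measurable_funM => //; exact: exprn_measurable.
  + move=> r /=; rewrite in_itv/= => /andP[r0 r1]; rewrite GE// indicE mem_setE in_itv/=.
    have [/andP[sr _]|] := boolP (s <= r < t); last first.
      by rewrite mulr0 normr0 invr_ge0 exprn_ge0// ltW.
    rewrite mulr1 ger0_norm ?invr_ge0 ?exprn_ge0 ?(ltW r0)//.
    exact: powb.
congr (_ * _); rewrite -integral_power//.
rewrite -Rintegral_itv_bndo_bndc; last first.
  apply: (integrable_bounded (K := s ^- N.-1)) => //.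
  + have loo : (lebesgue_measure (`[s, t[%classic : set R) < +oo)%E.
      by rewrite lebesgue_measure_itv/=; case: ifP => _; rewrite ?ltry.
    exact: loo.
  + by apply: measurable_funTS; apply: (measurableT_comp (@measurable_invr R)); exact: exprn_measurable.
  + move=> r /=; rewrite in_itv/= => /andP[sr _].
    by rewrite ger0_norm ?powb// invr_ge0 exprn_ge0// (le_trans (ltW s0)).
rewrite /Rintegral; congr fine; rewrite [LHS]integral_indicE [RHS]integral_indicE.
apply: eq_integral => r _; rewrite -!EFinM; congr (_%:E); rewrite !indicE !mem_setE !in_itv/=.
have [/andP[r0 r1]|nr] := boolP (0 < r < 1).
  rewrite mul1r GE// indicE mem_setE in_itv/= mulrC//.
rewrite mul0r; have [/andP[sr rt]|] := boolP (s <= r < t); last by rewrite mul0r.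
by move: nr; rewrite (lt_le_trans s0 sr) (lt_le_trans rt t1).
Qed.

(** Cauchy-Schwarz, splitting the flux density as the radial component of the
    gradient times [|x|^(1-N)]. *)
Lemma flux_sqr_le (R : realType) N (u : 'rV[R]_N -> R) Du (s t : R) : (2 < N)%N ->
  H10 u Du -> 0 < s -> s <= t -> t <= 1 ->
  (flux Du s - flux Du t) ^+ 2 <=
  (\int[lebesgue_rV R N]_(x in @unit_ball R N) (sqnorm (Du x) * annulus s t x)) *
  (sphere_area R N * ((s ^- N.-2 - t ^- N.-2) / (N%:R - 2))).
Proof.
move=> N2 hu s0 st t1; have mB := @measurable_unit_ball R N.
have [u2 Du2] := H10_L2 hu; have iG := H10_grad_integrable hu.
have t0 := lt_le_trans s0 st.
have is_ := flux_density_integrable s0 Du2; have it := flux_density_integrable t0 Du2.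
pose f x := dot (Du x) x / enorm x * annulus s t x.
pose g (x : 'rV[R]_N) := enorm x ^- N.-1 * annulus s t x.
have mg : measurable_fun setT g.
  apply: measurable_funM; last exact: measurable_annulus.
  apply: (measurableT_comp (@measurable_invr R)).
  by apply: measurable_funX; exact: measurable_enorm.
have fle x : f x ^+ 2 <= sqnorm (Du x) * annulus s t x.
  rewrite /f exprMn annulus_sqr// ler_wpM2r ?annulus_ge0//.
  have [x0|x0] := eqVneq (enorm x) 0; first by rewrite x0 invr0 mulr0 expr0n sqnorm_ge0.
  have sx : 0 < sqnorm x by rewrite -enorm_sqr exprn_even_gt0.
  by rewrite exprMn exprVn enorm_sqr ler_pdivrMr// sqr_dot_le.
have igr : (lebesgue_rV R N).-integrable (@unit_ball R N)
    (EFin \o (fun x => sqnorm (Du x) * annulus s t x)).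
  apply: (integrable_mulb (K := 1)) => //; first exact: (measurable_funTS (@measurable_annulus R N s t)).
  by move=> x _; exact: annulus_norm_le1.
have mdot : measurable_fun (@unit_ball R N) (fun x => dot (Du x) x).
  apply: measurable_sum => i; apply: measurable_funM; first exact: (L2_measurable (Du2 i)).
  by apply: measurable_funTS; exact: measurable_coord.
have mf : measurable_fun (@unit_ball R N) f.
  apply: measurable_funM; last exact: (measurable_funTS (@measurable_annulus R N s t)).
  apply: measurable_funM => //; apply: measurable_funTS.
  by apply: (measurableT_comp (@measurable_invr R)); exact: measurable_enorm.
have f2 : L2 f.
  split => //; apply: (@le_lt_trans _ _ (\int[lebesgue_rV R N]_(x in @unit_ball R N)
      (sqnorm (Du x) * annulus s t x)%:E)%E).
    apply: ge0_le_integral => //.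
    - by move=> x _; rewrite lee_fin sqr_ge0.
    - by apply/measurable_EFinP; exact: measurable_funX.
    - by apply/measurable_EFinP; exact: integrable_measurable igr.
    - by move=> x _; rewrite lee_fin.
  have /integrableP[_] := igr; apply: le_lt_trans; apply: ge0_le_integral => //.
  - by move=> x _; rewrite lee_fin mulr_ge0 ?sqnorm_ge0 ?annulus_ge0.
  - by apply/measurable_EFinP; exact: integrable_measurable igr.
  - by apply: measurableT_comp => //; apply/measurable_EFinP; exact: integrable_measurable igr.
  - by move=> x _; rewrite lee_fin ler_norm.
have g2 : L2 g.
  apply: (L2_bounded (C := s ^- N.-1)); first exact: measurable_funTS.
  move=> x _; rewrite /g annulusE//; have [/andP[sx _]|] := boolP (s <= enorm x < t); last first.
    by rewrite mulr0 normr0 invr_ge0 exprn_ge0// ltW.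
  rewrite mulr1 ger0_norm ?invr_ge0 ?exprn_ge0 ?enorm_ge0//.
  have x0 := lt_le_trans s0 sx.
  by rewrite lef_pV2 ?posrE ?exprn_gt0// lerXn2r ?nnegrE// ltW.
have -> : flux Du s - flux Du t = \int[lebesgue_rV R N]_(x in @unit_ball R N) (f x * g x).
  rewrite /flux -RintegralB//; apply: eq_Rintegral => x _.
  rewrite -mulrBr -/(annulus s t x) /f /g /flux_density mulrACA -expr2 annulus_sqr//.
  by move: (N) N2 (Du) (x) (annulus s t x) => [//|n] _ D y z /=; rewrite exprS invfM mulrA.
apply: le_trans (L2_cauchy_schwarz f2 g2) _.
rewrite -integral_annulus_power//.
have -> : \int[lebesgue_rV R N]_(x in @unit_ball R N) (g x ^+ 2) =
    \int[lebesgue_rV R N]_(x in @unit_ball R N) (enorm x ^- (2 * N.-1) * annulus s t x).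
  by apply: eq_Rintegral => x _; rewrite /g exprMn annulus_sqr// exprVn -exprM mulnC.
apply: ler_wpM2r.
  apply: Rintegral_ge0 => x _; rewrite mulr_ge0 ?annulus_ge0//.
  by rewrite invr_ge0 exprn_ge0// enorm_ge0.
by apply: le_Rintegral => //; exact: L2_sqr_integrable.
Qed.

Lemma flux1 (R : realType) N (Du : 'rV[R]_N -> 'rV[R]_N) : flux Du 1 = 0.
Proof.
rewrite /flux (_ : Rintegral _ _ _ = \int[lebesgue_rV R N]_(x in @unit_ball R N) 0).
  by rewrite Rintegral_cst ?mul0r//; exact: measurable_unit_ball.
by apply: eq_Rintegral => x; rewrite inE => Bx; rewrite /reached leNgt Bx mulr0.
Qed.

Lemma annulus_energy_le (R : realType) N (u : 'rV[R]_N -> R) Du (s t : R) : H10 u Du ->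
  s <= t ->
  0 <= \int[lebesgue_rV R N]_(x in @unit_ball R N) (sqnorm (Du x) * annulus s t x) <=
  \int[lebesgue_rV R N]_(x in @unit_ball R N) (sqnorm (Du x) * (1 - reached x t)).
Proof.
move=> hu st; have mB := @measurable_unit_ball R N.
have iG := H10_grad_integrable hu.
apply/andP; split.
  by apply: Rintegral_ge0 => x _; rewrite mulr_ge0 ?sqnorm_ge0// annulus_ge0.
apply: le_Rintegral => //.
- apply: (integrable_mulb (K := 1)) => //; first exact: (measurable_funTS (@measurable_annulus R N s t)).
  by move=> x _; exact: annulus_norm_le1.
- apply: (integrable_mulb (K := 1)) => //.
    by apply: measurable_funTS; apply: measurable_funB => //; exact: measurable_reachedl.
  by move=> x _; rewrite /reached; case: (t <= _); rewrite ?subrr ?subr0 ?normr0 ?normr1 ?ler01.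
- move=> x _; rewrite ler_wpM2l ?sqnorm_ge0// lerD2r.
  by rewrite /reached; case: (s <= _); rewrite ?ler01.
Qed.

(** The outer radius [t = 1], where the flux vanishes. *)
Lemma flux_sqr_le1 (R : realType) N (u : 'rV[R]_N -> R) Du : (2 < N)%N -> H10 u Du ->
  exists2 K : R, 0 <= K & forall s, 0 < s -> s <= 1 ->
    flux Du s ^+ 2 <= K * (s ^- N.-2 - 1).
Proof.
move=> N2 hu; have mB := @measurable_unit_ball R N.
pose G := \int[lebesgue_rV R N]_(x in @unit_ball R N) (sqnorm (Du x) * (1 - reached x 1)).
have G0 : 0 <= G by case/andP : (annulus_energy_le hu (lexx 1)) => /le_trans; exact.
have w0 : 0 <= sphere_area R N.
  by rewrite mulr_ge0 ?ler0n// fine_ge0// measure_ge0.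
have N20 : 0 < N%:R - 2 :> R by rewrite subr_gt0 ltr_nat.
exists (G * (sphere_area R N / (N%:R - 2))).
  by rewrite mulr_ge0// divr_ge0// ltW.
move=> s s0 s1; have := flux_sqr_le N2 hu s0 s1 (lexx 1).
rewrite flux1 subr0 => /le_trans; apply.
have [V0 VG] := andP (annulus_energy_le hu s1).
rewrite expr1n invr1; set y := _ - 1.
have -> : sphere_area R N * (y / (N%:R - 2)) = sphere_area R N / (N%:R - 2) * y.
  by rewrite mulrA mulrAC.
rewrite -[leRHS]mulrA; apply: ler_wpM2r => //; apply: mulr_ge0; first by rewrite divr_ge0// ltW.
rewrite subr_ge0 invf_ge1 ?exprn_gt0// exprn_ile1// ltW//.
Qed.

Lemma flux_bound (R : realType) N (u : 'rV[R]_N -> R) Du : (2 < N)%N -> H10 u Du ->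
  exists C : R, forall s, 0 < s -> s <= 1 -> s ^+ N.-2 * flux Du s ^+ 2 <= C.
Proof.
move=> N2 hu; have [K K0 h] := flux_sqr_le1 N2 hu; exists K => s s0 s1.
apply: (@le_trans _ _ (s ^+ N.-2 * (K * s ^- N.-2))).
  apply: ler_wpM2l; first by rewrite exprn_ge0// ltW.
  by apply: (le_trans (h s s0 s1)); rewrite ler_wpM2l// gerBl.
by rewrite mulrCA mulfV ?mulr1// expf_neq0// gt_eqF.
Qed.

Lemma flux_near1 (R : realType) N (u : 'rV[R]_N -> R) Du (e : R) : (2 < N)%N -> H10 u Du ->
  0 < e -> exists2 d : R, d < 1 & forall s, 0 < s -> d < s -> s < 1 -> flux Du s ^+ 2 < e.
Proof.
move=> N2 hu e0; have [K K0 h] := flux_sqr_le1 N2 hu.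
have c1 : (K * (s ^- N.-2 - 1)) @[s --> (1 : R)] --> (0 : R).
  rewrite (_ : 0 = K * ((1 : R) ^- N.-2 - 1)); last by rewrite expr1n invr1 subrr mulr0.
  apply: cvgM; first exact: cvg_cst.
  apply: cvgB; last exact: cvg_cst.
  apply: cvgV; first by rewrite expr1n oner_eq0.
  exact: exprn_continuous.
have /cvgrPdist_lt/(_ _ e0) := c1.
move=> -[d /= d0 hd]; exists (1 - d); first by rewrite ltrBlDr ltrDl.
move=> s s0 ds s1; apply: (le_lt_trans (h s s0 (ltW s1))).
have := hd s; rewrite sub0r normrN /=; move=> /(_ _)/(le_lt_trans (ler_norm _)); apply.
by rewrite ger0_norm ?subr_ge0 1?ltW//; move: ds; lra.
Qed.

(** The Dirichlet integral is absolutely continuous. *)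
Lemma small_ball_energy (R : realType) N (u : 'rV[R]_N -> R) Du (e : R) : (0 < N)%N -> H10 u Du ->
  0 < e -> exists2 t : R, 0 < t <= 1 &
  \int[lebesgue_rV R N]_(x in @unit_ball R N) (sqnorm (Du x) * (1 - reached x t)) < e.
Proof.
move=> N0 hu e0; have mB := @measurable_unit_ball R N.
have iG := H10_grad_integrable hu.
pose f n (x : 'rV[R]_N) := sqnorm (Du x) * (1 - reached x n.+1%:R^-1).
have mr (t : R) : measurable_fun (@unit_ball R N) (fun x => 1 - reached x t).
  by apply: measurable_funTS; apply: measurable_funB => //; exact: measurable_reachedl.
have if_ n : (lebesgue_rV R N).-integrable (@unit_ball R N) (EFin \o f n).
  apply: (integrable_mulb (K := 1)) => //.
  by move=> x _; rewrite /reached; case: (_ <= enorm x); rewrite ?subrr ?subr0 ?normr0 ?normr1 ?ler01.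
have [] := @dominated_convergence _ _ _ (lebesgue_rV R N) _ mB
  (fun n x => (f n x)%:E) (fun=> 0%E) (fun x => `|(sqnorm (Du x))%:E|%E).
- by move=> n; apply/measurable_EFinP; exact: integrable_measurable (if_ n).
- exact: measurable_cst.
- apply: unit_ball_ae => // x x0 _.
  have r0 : 0 < enorm x by rewrite enorm_gt0.
  have [n hn] := ltr_add_invr r0; rewrite add0r in hn.
  apply: (@cvg_trans _ (cst 0%E @ \oo)); last exact: cvg_cst.
  apply: near_eq_cvg; exists n => // m /= nm; rewrite /f /reached.
  rewrite (_ : m.+1%:R^-1 <= enorm x) ?subrr ?mulr0//.
  by apply: le_trans (ltW hn); rewrite lef_pV2 ?posrE// ler_nat.
- exact: integrable_abse.
- apply: aeW => x n _; rewrite !abse_EFin lee_fin normrM ler_piMr//.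
  by rewrite /reached; case: (_ <= enorm x); rewrite ?subrr ?subr0 ?normr0 ?normr1 ?ler01.
move=> _ _; rewrite integral0 => /fine_cvgP[_] /cvgrPdist_lt/(_ _ e0) [n _ hn].
exists n.+1%:R^-1; first by rewrite invr_gt0 ltr0n/= invf_le1// ler1n.
have := hn n (leqnn n); rewrite /= sub0r normrN; apply: le_lt_trans; exact: ler_norm.
Qed.

(** Compare [flux Du s] with [flux Du t] for a fixed [t] so small that the
    energy in the ball of radius [t] is negligible: the difference is small in
    the scale [s^(N-2)], and [s^(N-2) (flux Du t)^2] tends to zero with [s]. *)
Lemma flux_near0 (R : realType) N (u : 'rV[R]_N -> R) Du (e : R) : (2 < N)%N -> H10 u Du ->
  0 < e -> exists2 d : R, 0 < d & forall s, 0 < s -> s < d -> s ^+ N.-2 * flux Du s ^+ 2 < e.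
Proof.
move=> N2 hu e0; have N0 : (0 < N)%N by exact: leq_trans N2.
pose K := sphere_area R N / (N%:R - 2).
have N20 : 0 < N%:R - 2 :> R by rewrite subr_gt0 ltr_nat.
have K0 : 0 <= K.
  by rewrite divr_ge0 ?(ltW N20)// mulr_ge0 ?ler0n// fine_ge0// measure_ge0.
have e1 : 0 < e / (4 * (K + 1)) by rewrite divr_gt0// mulr_gt0// ltr_wpDl.
have [t /andP[t0 t1] ht] := small_ball_energy N0 hu e1.
set V := Rintegral _ _ _ in ht.
(* Half of [e] pays for the energy in the small ball, the other half for [2
   s (flux Du t)^2]. *)
pose a := 4 * (flux Du t ^+ 2 + 1).
have a0 : 0 < a by rewrite mulr_gt0// ltr_wpDl// sqr_ge0.
exists (Num.min t (e / a)); first by rewrite lt_min t0 divr_gt0.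
move=> s s0; rewrite lt_min => /andP[st se].
have := flux_sqr_le N2 hu s0 (ltW st) t1.
have [A0 AV] := andP (annulus_energy_le hu (ltW st)).
set A := Rintegral _ _ _ in A0 AV *.
have -> : sphere_area R N * ((s ^- N.-2 - t ^- N.-2) / (N%:R - 2)) = K * (s ^- N.-2 - t ^- N.-2).
  by rewrite /K mulrA mulrAC.
have p0 : 0 < s ^+ N.-2 by rewrite exprn_gt0.
have q0 : 0 <= t ^- N.-2 by rewrite invr_ge0 exprn_ge0// ltW.
have ps : s ^+ N.-2 <= s.
  have -> : N.-2 = (N - 3).+1 by rewrite -subSn // subSS subn2.
  by rewrite exprS ler_piMr ?(ltW s0)// exprn_ile1 ?ltW// (lt_le_trans st).
have VK : V * (K + 1) < e / 4.
  by move: ht; rewrite ltr_pdivlMr ?mulr_gt0 ?ltr_wpDl//; lra.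
have se' : s * a < e by rewrite -ltr_pdivlMr.
have pi : s ^+ N.-2 * s ^- N.-2 = 1 by rewrite mulfV// gt_eqF.
move: pi p0 ps q0; move: (s ^+ N.-2) (s ^- N.-2) (t ^- N.-2) => p i q pi p0 ps q0 h.
have hf : flux Du s ^+ 2 <= 2 * flux Du t ^+ 2 + 2 * (flux Du s - flux Du t) ^+ 2.
  have := sqr_ge0 (flux Du s - 2 * flux Du t); move: (flux Du s) (flux Du t) => x y; nra.
have h1 : p * (flux Du s - flux Du t) ^+ 2 <= V * K.
  apply: (@le_trans _ _ (p * (A * (K * i)))).
    apply: ler_wpM2l; first exact: ltW.
    apply: (le_trans h); apply: ler_wpM2l => //; apply: ler_wpM2l => //.
    by rewrite gerBl.
  have -> : p * (A * (K * i)) = (p * i) * (A * K) by ring.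
  by rewrite pi mul1r ler_wpM2r.
have h2 : p * flux Du t ^+ 2 <= s * flux Du t ^+ 2 by rewrite ler_wpM2r// sqr_ge0.
have h3 : p * flux Du s ^+ 2 <= 2 * (s * flux Du t ^+ 2) + 2 * (V * K).
  apply: (@le_trans _ _ (p * (2 * flux Du t ^+ 2 + 2 * (flux Du s - flux Du t) ^+ 2))).
    by rewrite ler_wpM2l// ltW.
  lra.
apply: (le_lt_trans h3); move: se'; rewrite /a.
have V0 : 0 <= V by apply: le_trans AV.
move: (flux Du t ^+ 2) => y; lra.
Qed.

(** * The Euler-Lagrange equation for radial solutions *)

Lemma powR_le1 (R : realType) (q y : R) : 0 < q -> 0 <= y -> y <= 1 -> y `^ q <= 1.
Proof.
move=> q0 y0 y1; rewrite [leRHS](_ : 1 = 1 `^ q); last by rewrite powR1.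
by apply: ge0_ler_powR; rewrite ?nnegrE// ltW.
Qed.

Lemma normr_powRD2 (R : realType) (q y : R) : 0 < q ->
  `|y| `^ (q + 2) = `|y| `^ q * y ^+ 2.
Proof.
move=> q0; have [->|y0] := eqVneq y 0.
  by rewrite normr0 powR0 ?gt_eqF ?addr_gt0// expr0n mulr0.
rewrite powRD; last by rewrite normr_eq0 y0 implybT.
by rewrite powR_mulrn// real_normK ?num_real.
Qed.

Lemma is_derive_normr_powR (R : realType) (q y : R) : 0 < q ->
  is_derive y 1 (fun y : R => `|y| `^ (q + 2)) ((q + 2) * (`|y| `^ q * y)).
Proof.
move=> q0.
have pos (z : R) : 0 < z -> is_derive z 1 (fun y : R => y `^ (q + 2)) ((q + 2) * (z `^ q * z)).
  move=> z0; apply: is_derive_eq (is_derive1_powR _ z0) _; congr (_ * _).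
  have -> : q + 2 - 1 = q + 1 by ring.
  rewrite powRD; last by rewrite (gt_eqF z0) implybT.
  by rewrite powRr1// ltW.
have [y0|y0|->] := ltgtP y 0.
- apply: (near_eq_is_derive (f := fun z => (- z) `^ (q + 2))) => //.
    near=> z; rewrite ltr0_norm//; near: z; exact: lt_nbhsl.
  have ny : 0 < - y by rewrite oppr_gt0.
  apply: is_derive_eq (der_comp (pos _ ny) (derN (der_id y))) _.
  by rewrite ltr0_norm//; ring.
- apply: (near_eq_is_derive (f := fun z => z `^ (q + 2))) => //.
    near=> z; rewrite gtr0_norm//; near: z; exact: lt_nbhsr.
  by apply: is_derive_eq (pos _ y0) _; rewrite gtr0_norm.
- rewrite mulr0 mulr0.
  pose g (h : R) := if `|h| < 1 then `|h| `^ (q + 2) else 0.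
  apply: (near_eq_is_derive (f := g)) => //.
    near=> h; rewrite /g; case: ifPn => //; rewrite -leNgt => h1; exfalso.
    suff : `|h| < 1 by rewrite ltNge h1.
    by near: h; exists 1 => //= z; rewrite /ball_/= sub0r normrN.
  apply: (der_quadratic (C := 1)) => h; rewrite mul1r /g; case: ifP => h1.
    rewrite normr_powRD2// ger0_norm; last by apply: mulr_ge0; [exact: powR_ge0|exact: sqr_ge0].
    apply: ler_piMl; first exact: sqr_ge0.
    by apply: powR_le1 => //; exact: ltW.
  by rewrite normr0 sqr_ge0.
Unshelve. all: by end_near. Qed.

Lemma continuous_normr_powR (R : realType) (q : R) : 0 < q ->
  continuous (fun y : R => `|y| `^ q * y).
Proof.
move=> q0 y; have [->|y0] := eqVneq y 0.
  apply/cvgrPdist_le => e e0; near=> h.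
  rewrite mulr0 sub0r normrN normrM ger0_norm ?powR_ge0//.
  have h1 : `|h| <= 1.
    by near: h; exists 1 => //= z; rewrite /ball_/= sub0r normrN; exact: ltW.
  have he : `|h| <= e.
    by near: h; exists e => //= z; rewrite /ball_/= sub0r normrN; exact: ltW.
  apply: le_trans he; rewrite ler_piMl//.
  exact: powR_le1.
rewrite /continuous_at; apply: cvgM; last exact: cvg_id.
apply: (continuous_comp (g := fun z => z `^ q)); first exact: norm_continuous.
have yp : 0 < `|y| by rewrite normr_gt0.
exact: der_cvg (is_derive1_powR q yp).
Unshelve. all: by end_near. Qed.

(** With [q = 4/m] the bound [r^m y^2 <= C] has exactly the homogeneity that
    makes [|y|^q] comparable to the Hardy weight [1 / r^2]: the nonlinearity
    becomes a bounded perturbation of that weight. *)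
Lemma powR_weight_le (R : realType) (m : nat) (q r y C : R) : (0 < m)%N ->
  q * m%:R = 4 -> 0 < r -> r ^+ m * y ^+ 2 <= C -> `|y| `^ q <= C `^ (q / 2) / r ^+ 2.
Proof.
move=> m0 qm r0 h; rewrite ler_pdivlMr ?exprn_gt0//.
have q0 : 0 < q.
  by rewrite -(pmulr_lgt0 _ (_ : 0 < m%:R)) ?qm// ltr0n.
have -> : `|y| `^ q = (y ^+ 2) `^ (q / 2).
  rewrite -(real_normK (num_real y)) -powR_mulrn// -powRrM; congr (_ `^ _).
  by field.
have -> : r ^+ 2 = (r ^+ m) `^ (q / 2).
  rewrite -!powR_mulrn ?ltW// -powRrM; congr (_ `^ _).
  by rewrite mulrA [_ * q]mulrC qm; by field.
have a0 : 0 <= r ^+ m * y ^+ 2 by rewrite mulr_ge0 ?sqr_ge0// exprn_ge0// ltW.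
rewrite -powRM ?sqr_ge0//; last by rewrite exprn_ge0// ltW.
rewrite mulrC; apply: ge0_ler_powR => //; rewrite ?nnegrE//.
- by rewrite divr_ge0// ltW.
- exact: le_trans h.
Qed.

(** Differentiation under the integral. Since [C |x|^(2-N)] bounds the squares
    of [a] and [b], the power [|a + t b|^q] is at most a multiple of
    [|x|^(-2)], and the derivative is dominated by the integrable functions
    [a^2/|x|^2] and [b^2/|x|^2]. *)
Lemma is_derive_integral_power (R : realType) N (q C : R) (a b : 'rV[R]_N -> R) :
  (2 < N)%N -> q * N.-2%:R = 4 ->
  measurable_fun (@unit_ball R N) a -> measurable_fun (@unit_ball R N) b ->
  (forall x, unit_ball x -> enorm x ^+ N.-2 * a x ^+ 2 <= C) ->
  (forall x, unit_ball x -> enorm x ^+ N.-2 * b x ^+ 2 <= C) ->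
  a 0 = 0 ->
  (lebesgue_rV R N).-integrable (@unit_ball R N) (EFin \o (fun x => a x ^+ 2 / enorm x ^+ 2)) ->
  (lebesgue_rV R N).-integrable (@unit_ball R N) (EFin \o (fun x => b x ^+ 2 / enorm x ^+ 2)) ->
  is_derive (0 : R) (1 : R) (fun t : R => \int[lebesgue_rV R N]_(x in @unit_ball R N)
      (`|a x + t * b x| `^ (q + 2)))
    ((q + 2) * \int[lebesgue_rV R N]_(x in @unit_ball R N) (`|a x| `^ q * a x * b x)).
Proof.
move=> N2 qm ma mb aC bC a0 ia ib; have mB := @measurable_unit_ball R N.
have m0 : (0 < N.-2)%N by case: (N) N2 => [|[|[|n]]].
have q0 : 0 < q by rewrite -(pmulr_lgt0 _ (_ : 0 < N.-2%:R)) ?qm// ltr0n.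
have p0 : 0 < q + 2 by rewrite addr_gt0.
(* Since [(a + t b)^2 <= 2 a^2 + 2 b^2], the bound [C] becomes [4 C]. *)
pose K := (4 * C) `^ (q / 2); have K0 : 0 <= K by exact: powR_ge0.
(* The contribution of the origin, where the weight [0^-1] vanishes and
   dominates nothing. *)
pose M := `|b 0| `^ q * b 0 ^+ 2.
have M0 : 0 <= M by rewrite mulr_ge0 ?powR_ge0 ?sqr_ge0.
pose H x := (q + 2) * (K * (2 * (a x ^+ 2 / enorm x ^+ 2) + 2 * (b x ^+ 2 / enorm x ^+ 2)) + M).
have iH : (lebesgue_rV R N).-integrable (@unit_ball R N) (EFin \o H).
  apply: integrable_mulrl => //; apply: integrable_addr => //.
    by apply: integrable_mulrl => //; apply: integrable_addr => //; exact: integrable_mulrl.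
  by apply: continuous_integrable_ball; exact: cst_continuous.
have w0 x : 0 <= 2 * (a x ^+ 2 / enorm x ^+ 2) + 2 * (b x ^+ 2 / enorm x ^+ 2).
  by rewrite addr_ge0// mulr_ge0// divr_ge0// sqr_ge0.
have H0 x : 0 <= H x.
  by apply: mulr_ge0; [exact: ltW|rewrite addr_ge0// mulr_ge0].
have ysq (t : R) x : `|t| <= 1 -> (a x + t * b x) ^+ 2 <= 2 * a x ^+ 2 + 2 * b x ^+ 2.
  move=> t1; have t2 : t ^+ 2 <= 1 by rewrite -[leLHS]real_normK ?num_real// exprn_ile1.
  have := sqr_ge0 (a x - t * b x); have : t ^+ 2 * b x ^+ 2 <= 1 * b x ^+ 2.
    by rewrite ler_wpM2r// sqr_ge0.
  move: (a x) (b x) => y z; nra.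
have key (t : R) x : unit_ball x -> x != 0 -> `|t| <= 1 ->
    `|a x + t * b x| `^ q <= K / enorm x ^+ 2.
  move=> Bx x0 t1; apply: (powR_weight_le m0 qm); first by rewrite enorm_gt0.
  apply: (@le_trans _ _ (enorm x ^+ N.-2 * (2 * a x ^+ 2 + 2 * b x ^+ 2))).
    by apply: ler_wpM2l; [rewrite exprn_ge0// enorm_ge0|exact: ysq].
  have := aC x Bx; have := bC x Bx; rewrite mulrDr; move: (enorm x ^+ _) => r.
  by rewrite ![r * (2 * _)]mulrCA; lra.
have I1 (t : R) : (`]-1, 1[%classic : set R) t -> `|t| <= 1.
  by rewrite /= in_itv/= -ltr_norml => /ltW.
pose f (t : R) x := `|a x + t * b x| `^ (q + 2).
have df (t : R) x : is_derive t 1 (f ^~ x) ((q + 2) * (`|a x + t * b x| `^ q * (a x + t * b x)) * b x).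
  have h1 := derD (der_cst (a x) t) (derM (der_id t) (der_cst (b x) t)).
  apply: is_derive_eq (der_comp (f := fun y : R => `|y| `^ (q + 2)) (g := fun t : R => a x + t * b x)
    (is_derive_normr_powR (a x + t * b x) q0) h1) _.
  by rewrite mul1r mulr0 addr0 add0r.
have dfE t x : partial1of2 f t x = (q + 2) * (`|a x + t * b x| `^ q * (a x + t * b x)) * b x.
  by rewrite partial1of2E (@derive_val _ _ _ _ _ _ _ (df t x)).
have my t : measurable_fun (@unit_ball R N) (fun x => a x + t * b x).
  by apply: measurable_funD => //; exact: measurable_funM.
have intf t : (`]-1, 1[%classic : set R) t ->
    (lebesgue_rV R N).-integrable (@unit_ball R N) (EFin \o f t).
  move=> /I1 t1; apply: le_integrable iH => //.
    apply/measurable_EFinP; apply: (measurableT_comp (measurable_powR _)).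
    by apply: measurableT_comp.
  move=> x Bx /=; rewrite lee_fin (ger0_norm (H0 x)) ger0_norm ?powR_ge0//.
  rewrite /f normr_powRD2//; apply: (@le_trans _ _ (1 * (H x / (q + 2)))); last first.
    rewrite mul1r ler_pdivrMr//; apply: ler_peMr => //; lra.
  rewrite mul1r /H mulrAC mulfV ?gt_eqF// mul1r.
  have [->|x0] := eqVneq x 0.
    rewrite [in leLHS]a0 add0r -[leLHS]add0r; apply: lerD; first exact: mulr_ge0.
    rewrite /M; apply: ler_pM; rewrite ?powR_ge0 ?sqr_ge0//.
      apply: ge0_ler_powR; rewrite ?nnegrE ?(ltW q0)//.
      by rewrite normrM ler_piMl.
    rewrite exprMn ler_piMl ?sqr_ge0//.
    by rewrite -[leLHS]real_normK ?num_real// exprn_ile1.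
  rewrite -[leLHS]addr0; apply: lerD => //.
  apply: (@le_trans _ _ (K / enorm x ^+ 2 * (2 * a x ^+ 2 + 2 * b x ^+ 2))).
    by apply: ler_pM; rewrite ?powR_ge0 ?sqr_ge0 ?key ?ysq.
  by rewrite le_eqVlt; apply/orP; left; apply/eqP; ring.
have Gub t x : (`]-1, 1[%classic : set R) t -> @unit_ball R N x -> `|partial1of2 f t x| <= H x.
  move=> /I1 t1 Bx; rewrite dfE -mulrA normrM gtr0_norm// ler_pM2l// !normrM.
  rewrite (ger0_norm (powR_ge0 _ _)) -mulrA.
  have [->|x0] := eqVneq x 0.
    rewrite [in leLHS]a0 add0r -[leLHS]add0r; apply: lerD; first exact: mulr_ge0.
    rewrite /M; apply: ler_pM; rewrite ?powR_ge0 ?mulr_ge0//.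
      apply: ge0_ler_powR; rewrite ?nnegrE ?(ltW q0)//.
      by rewrite normrM ler_piMl.
    by rewrite normrM -[b 0 ^+ 2]real_normK ?num_real// expr2 ler_wpM2r// ler_piMl.
  rewrite -[leLHS]addr0; apply: lerD => //.
  apply: (@le_trans _ _ (K / enorm x ^+ 2 * (2 * a x ^+ 2 + 2 * b x ^+ 2))).
    apply: ler_pM; rewrite ?powR_ge0 ?mulr_ge0 ?key//.
    have := ysq t x t1; rewrite -[X in X <= _]real_normK ?num_real//.
    rewrite -[b x ^+ 2]real_normK ?num_real//.
    have := sqr_ge0 (`|a x + t * b x| - `|b x|); have := sqr_ge0 (a x).
    move: `|b x| `|a x + t * b x| (a x ^+ 2) => y z s; nra.
  by rewrite le_eqVlt; apply/orP; left; apply/eqP; ring.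
have I0 : (`]-1, 1[%classic : set R) 0 by rewrite /= in_itv/= ltrN10 ltr01.
have derf t x : (`]-1, 1[%classic : set R) t -> @unit_ball R N x -> derivable (f ^~ x) t 1.
  by move=> _ _; exact: (@ex_derive _ _ _ _ _ _ _ (df t x)).
have D1 := derivable_under_integral mB I0 intf derf H0 iH Gub.
have D2 := differentiation_under_integral mB I0 intf derf H0 iH Gub.
split; first exact: D1.
rewrite -derive1E D2 -RintegralZl//.
  by apply: eq_Rintegral => x _; rewrite dfE mul0r addr0 -mulrA.
have : (lebesgue_rV R N).-integrable (@unit_ball R N) (EFin \o (partial1of2 f 0)).
  apply: le_integrable iH => //.
    apply/measurable_EFinP; apply: (eq_measurable_fun
      (fun x => (q + 2) * (`|a x + 0 * b x| `^ q * (a x + 0 * b x)) * b x)).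
      by move=> x _; rewrite dfE.
    apply: measurable_funM => //; apply: measurable_funM => //; apply: measurable_funM => //.
    by apply: (measurableT_comp (measurable_powR _)); apply: measurableT_comp.
  by move=> x Bx; rewrite !abse_EFin lee_fin (ger0_norm (H0 x)) Gub.
move=> /(integrable_mulrl (q + 2)^-1 mB); apply: eq_integrable => // x _ /=.
by rewrite dfE mul0r addr0; congr (_%:E); field; rewrite gt_eqF.
Qed.

(** The integral is a quadratic polynomial in [t]. *)
Lemma is_derive_integral_sqr (R : realType) N (a b : 'rV[R]_N -> R) : L2 a -> L2 b ->
  is_derive (0 : R) (1 : R) (fun t : R => \int[lebesgue_rV R N]_(x in @unit_ball R N)
      ((a x + t * b x) ^+ 2))
    (2 * \int[lebesgue_rV R N]_(x in @unit_ball R N) (a x * b x)).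
Proof.
move=> ha hb; have mB := @measurable_unit_ball R N.
have ia := L2_sqr_integrable ha; have ib := L2_sqr_integrable hb.
have iab := L2_mul_integrable ha hb.
rewrite (_ : (fun t : R => _) = fun t : R =>
    \int[lebesgue_rV R N]_(x in @unit_ball R N) (a x ^+ 2) +
    (2 * \int[lebesgue_rV R N]_(x in @unit_ball R N) (a x * b x)) * t +
    \int[lebesgue_rV R N]_(x in @unit_ball R N) (b x ^+ 2) * t ^+ 2); last first.
  apply/funext => t.
  have i1 := integrable_mulrl (2 * t) mB iab; have i2 := integrable_mulrl (t ^+ 2) mB ib.
  have i3 := integrable_addr mB ia i1.
  transitivity (\int[lebesgue_rV R N]_(x in @unit_ball R N)
      (a x ^+ 2 + 2 * t * (a x * b x) + t ^+ 2 * b x ^+ 2)).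
    by apply: eq_Rintegral => x _; ring.
  by rewrite RintegralD// RintegralD// !RintegralZl//; ring.
set A := Rintegral _ _ _; set B := 2 * _; set C := Rintegral _ _ _.
apply: is_derive_eq (derD (derD (der_cst A 0) (derM (der_cst B 0) (der_id 0)))
  (derM (der_cst C 0) (derX 2 (der_id 0)))) _.
by rewrite /=; ring.
Qed.

Lemma ae_eq_Rintegral d (T : measurableType d) (R : realType)
    (mu : {measure set T -> \bar R}) (D : set T) (f g : T -> R) : measurable D ->
  measurable_fun D f -> measurable_fun D g -> {ae mu, forall x, D x -> f x = g x} ->
  \int[mu]_(x in D) f x = \int[mu]_(x in D) g x.
Proof.
move=> mD mf mg fg; rewrite /Rintegral; congr fine; apply: ae_eq_integral => //.
- exact/measurable_EFinP.
- exact/measurable_EFinP.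
- by apply: filterS fg => x h Dx; rewrite h.
Qed.

Lemma is_derive_bigsum (R : realType) n (F : 'I_n -> R -> R) (d : 'I_n -> R) (x : R) :
  (forall i, is_derive x 1 (F i) (d i)) ->
  is_derive x 1 (fun t => \sum_(i < n) F i t) (\sum_(i < n) d i).
Proof.
elim: n F d => [|n IH] F d h.
  rewrite big_ord0 (_ : (fun t => _) = fun=> 0); first exact: der_cst.
  by apply/funext => t; rewrite big_ord0.
rewrite big_ord_recl (_ : (fun t => _) = fun t => F ord0 t + \sum_(i < n) F (lift ord0 i) t).
  by apply: derD => //; exact: IH.
by apply/funext => t; rewrite big_ord_recl.
Qed.

Lemma test_function_H10 (R : realType) N (v : 'rV[R]_N -> R) : test_function v ->
  H10 v (grad v).
Proof.
move=> tv; have mB := @measurable_unit_ball R N.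
have [cv dv] : continuous v /\ forall i, continuous (partial i v).
  by case: tv => h _ _; split; [exact: (h [::]).1|move=> i; exact: (h [:: i]).1].
split; first split.
- exact: L2_continuous.
- move=> i; rewrite (_ : (fun x => _) = partial i v); first exact: L2_continuous.
  by apply/funext => x; rewrite mxE.
- move=> phi tphi i; have h1 := test_function_C1c i tv; have h2 := test_function_C1c i tphi.
  have [c1 d1 c1' _ _] := h2.
  have dphi x : is_derive x (delta_mx ord0 i) phi (partial i phi x) by exact: derivableP.
  rewrite (C1c_pairing h1 c1 c1' dphi).
  by congr (- _); apply: eq_Rintegral => x _; rewrite mxE.
- move=> e e0; exists v => //; rewrite /H1_sqnorm integral0_eq; last first.
    move=> x _; rewrite !subrr expr0n add0r /sqnorm big1// => i _.
    by rewrite mxE expr0n.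
  by rewrite lte_fin exprn_gt0.
Qed.

(** The derivative of the energy at a critical point, term by term. The almost
    everywhere equal function [a] stands for [u] in the nonlinear term because
    the domination there needs a pointwise bound. *)
Lemma euler_lagrange (R : realType) N (gamma eps q C : R) (u : 'rV[R]_N -> R) Du
    (a v : 'rV[R]_N -> R) :
  (2 < N)%N -> q * N.-2%:R = 4 -> H10 u Du -> critical_point gamma eps u Du ->
  measurable_fun setT a ->
  {ae lebesgue_rV R N, forall x, unit_ball x -> u x = a x} ->
  (forall x, unit_ball x -> enorm x ^+ N.-2 * a x ^+ 2 <= C) -> a 0 = 0 ->
  test_function v ->
  \int[lebesgue_rV R N]_(x in @unit_ball R N) dot (Du x) (grad v x) =
  gamma * \int[lebesgue_rV R N]_(x in @unit_ball R N) (a x * v x / enorm x ^+ 2) +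
  eps * \int[lebesgue_rV R N]_(x in @unit_ball R N) (a x * v x) +
  \int[lebesgue_rV R N]_(x in @unit_ball R N) (`|a x| `^ q * a x * v x).
Proof.
move=> N2 qm hu cu ma ua aC a0 tv; have mB := @measurable_unit_ball R N.
have maB : measurable_fun (@unit_ball R N) a by exact: measurable_funTS.
have hv := test_function_H10 tv.
have [u2 Du2] := H10_L2 hu; have [v2 Dv2] := H10_L2 hv.
have mu := L2_measurable u2; have mv := L2_measurable v2.
have cv : continuous v by case: tv => h _ _; exact: (h [::]).1.
have [M vM] := continuous_bounded_ball cv.
have N2r : 0 < N%:R - 2 :> R by rewrite subr_gt0 ltr_nat.
have N2E : N.-2%:R = N%:R - 2 :> R by rewrite -subn2 natrB// ltnW.
have q2 : q + 2 = 2 * N%:R / (N%:R - 2).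
  apply: (mulIf (lt0r_neq0 N2r)); rewrite divfK ?gt_eqF// mulrDl -N2E qm N2E; ring.
have mrinv : measurable_fun setT (fun x : 'rV[R]_N => (enorm x)^-1).
  exact: (measurableT_comp (@measurable_invr R) (@measurable_enorm R N)).
have wL2 (w : 'rV[R]_N -> R) : measurable_fun (@unit_ball R N) w ->
    (lebesgue_rV R N).-integrable (@unit_ball R N) (EFin \o (fun x => w x ^+ 2 / enorm x ^+ 2)) ->
    L2 (fun x => w x / enorm x).
  move=> mw iw; split; first by apply: measurable_funM => //; exact: measurable_funTS.
  have /integrableP[_] := iw; apply: le_lt_trans; apply: ge0_le_integral => //.
  - by move=> x _; rewrite lee_fin sqr_ge0.
  - apply/measurable_EFinP; apply: measurable_funX; apply: measurable_funM => //.
    exact: measurable_funTS.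
  - by apply: measurableT_comp => //; apply/measurable_EFinP; exact: integrable_measurable iw.
  - by move=> x _; rewrite lee_fin exprMn exprVn ler_norm.
have hdu := hardy N2 hu; have hdv := hardy N2 hv.
have u2r := wL2 u mu hdu; have v2r := wL2 v mv hdv.
have ma2r : measurable_fun (@unit_ball R N) (fun x => a x ^+ 2 / enorm x ^+ 2).
  apply: measurable_funM; first exact: measurable_funX.
  apply: measurable_funTS; apply: (measurableT_comp (@measurable_invr R)).
  by apply: measurable_funX; exact: measurable_enorm.
have hda : (lebesgue_rV R N).-integrable (@unit_ball R N)
    (EFin \o (fun x => a x ^+ 2 / enorm x ^+ 2)).
  apply: ae_eq_integrable hdu => //.
  by apply: filterS ua => x h Bx; rewrite h.
pose C' := Num.max C (M ^+ 2).
have aC' x : unit_ball x -> enorm x ^+ N.-2 * a x ^+ 2 <= C'.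
  by move=> Bx; rewrite le_max aC.
have vC' x : unit_ball x -> enorm x ^+ N.-2 * v x ^+ 2 <= C'.
  move=> Bx; rewrite le_max; apply/orP; right.
  apply: (@le_trans _ _ (v x ^+ 2)).
    by rewrite ler_piMl ?sqr_ge0// exprn_ile1 ?enorm_ge0// ltW.
  have h := vM x Bx; rewrite -[leLHS]real_normK ?num_real// lerXn2r ?nnegrE//.
  exact: le_trans h.
have D4 := is_derive_integral_power N2 qm maB mv aC' vC' a0 hda hdv.
have D3 := is_derive_integral_sqr u2 v2.
have D2 := is_derive_integral_sqr u2r v2r.
have D1 : is_derive (0 : R) (1 : R) (fun t : R => \int[lebesgue_rV R N]_(x in @unit_ball R N)
      sqnorm (Du x + t *: grad v x))
    (2 * \int[lebesgue_rV R N]_(x in @unit_ball R N) dot (Du x) (grad v x)).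
  have h := is_derive_bigsum (fun i => is_derive_integral_sqr (Du2 i) (Dv2 i)).
  rewrite -mulr_sumr in h.
  have [_ E] := Rintegral_sum mB (fun i => L2_mul_integrable (Du2 i) (Dv2 i)).
  rewrite -E in h; move: h; congr (is_derive _ _ _ _); apply/funext => t.
  have i2 i : L2 (fun x => Du x ord0 i + t * grad v x ord0 i).
    have hh : L2 (fun x => - t * grad v x ord0 i).
      have [m1 f1] := Dv2 i; split; first exact: measurable_funM.
      have /(integrable_mulrl ((- t) ^+ 2) mB)/integrableP[_] := L2_sqr_integrable (Dv2 i).
      under eq_integral do rewrite /= -exprMn ger0_norm ?sqr_ge0//.
      by [].
    have := L2_sub (Du2 i) hh; congr L2; apply/funext => x; ring.
  have [_ <-] := Rintegral_sum mB (fun i => L2_sqr_integrable (i2 i)).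
  by apply: eq_Rintegral => x _; apply: eq_bigr => i _; rewrite !mxE.
have := cu v (grad v) hv.
have EE : (fun t : R => energy gamma eps (fun x => u x + t * v x) (fun x => Du x + t *: grad v x)) =
  (fun t : R => 2^-1 * (\int[lebesgue_rV R N]_(x in @unit_ball R N) sqnorm (Du x + t *: grad v x))
   - gamma / 2 * \int[lebesgue_rV R N]_(x in @unit_ball R N) ((u x / enorm x + t * (v x / enorm x)) ^+ 2)
   - eps / 2 * \int[lebesgue_rV R N]_(x in @unit_ball R N) ((u x + t * v x) ^+ 2)
   - (N%:R - 2) / (2 * N%:R) *
     \int[lebesgue_rV R N]_(x in @unit_ball R N) (`|a x + t * v x| `^ (q + 2))).
  apply/funext => t; rewrite /energy; congr (_ - _ * _ - _ - _ * _).
    apply: eq_Rintegral => x _; rewrite mulrA -mulrDl exprMn exprVn//.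
  rewrite -q2; apply: (ae_eq_Rintegral mB).
  - apply: (measurableT_comp (measurable_powR _)).
    apply: measurableT_comp => //; apply: measurable_funD => //; exact: measurable_funM.
  - apply: (measurableT_comp (measurable_powR _)).
    apply: measurableT_comp => //; apply: measurable_funD => //; exact: measurable_funM.
  - by apply: filterS ua => x h Bx /=; rewrite h.
rewrite EE => h0.
have h1 := derB (derB (derB (derZ 2^-1 D1) (derZ (gamma / 2) D2)) (derZ (eps / 2) D3))
  (derZ ((N%:R - 2) / (2 * N%:R)) D4).
have := @derive_val _ _ _ _ _ _ _ h0; rewrite (@derive_val _ _ _ _ _ _ _ h1).
have -> : \int[lebesgue_rV R N]_(x in @unit_ball R N) (u x / enorm x * (v x / enorm x)) =
    \int[lebesgue_rV R N]_(x in @unit_ball R N) (a x * v x / enorm x ^+ 2).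
  apply: (ae_eq_Rintegral mB).
  - by apply: measurable_funM; exact: L2_measurable.
  - apply: measurable_funM; first exact: measurable_funM.
    apply: measurable_funTS; apply: (measurableT_comp (@measurable_invr R)).
    by apply: measurable_funX; exact: measurable_enorm.
  - by apply: filterS ua => x h Bx; rewrite h// mulrACA -invfM -expr2.
have -> : \int[lebesgue_rV R N]_(x in @unit_ball R N) (u x * v x) =
    \int[lebesgue_rV R N]_(x in @unit_ball R N) (a x * v x).
  apply: (ae_eq_Rintegral mB).
  - exact: measurable_funM.
  - exact: measurable_funM.
  - by apply: filterS ua => x h Bx; rewrite h.
have -> : (N%:R - 2) / (2 * N%:R) * ((q + 2) *
    \int[lebesgue_rV R N]_(x in @unit_ball R N) (`|a x| `^ q * a x * v x)) =
    \int[lebesgue_rV R N]_(x in @unit_ball R N) (`|a x| `^ q * a x * v x).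
  have Nr : N%:R != 0 :> R by rewrite pnatr_eq0 -lt0n (leq_trans _ N2).
  rewrite q2 mulrA; move: (Rintegral _ _ _) (N%:R : R) N2r Nr => y z z2 z0; field.
  by rewrite z0 gt_eqF.
move=> h; lra.
Qed.

(** * The ordinary differential equation of the profile *)

(** The representative provided by [radial_flux]. Its value at the origin is
    chosen to vanish, in accordance with the convention [0^-1 = 0] for the
    weight. *)
Definition profile (R : realType) N (Du : 'rV[R]_N -> 'rV[R]_N) (s : R) : R :=
  if 0 < s < 1 then - flux Du s / sphere_area R N else 0.

Lemma flux_reached (R : realType) N (Du : 'rV[R]_N -> 'rV[R]_N) (a s : R) : a <= s ->
  \int[lebesgue_rV R N]_(x in @unit_ball R N) (flux_density Du x * reached x a * reached x s) =
  flux Du s.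
Proof.
move=> as_; rewrite /flux; apply: eq_Rintegral => y _; rewrite /reached.
have [xy|] := leP s (enorm y); last by rewrite !mulr0.
by rewrite (le_trans as_ xy) !mulr1.
Qed.

Lemma measurable_profile (R : realType) N (Du : 'rV[R]_N -> 'rV[R]_N) :
  (forall i, L2 (fun x => Du x ord0 i)) -> measurable_fun setT (profile Du).
Proof.
move=> Du2.
have mF : measurable_fun (`]0%R, 1%R[%classic : set R) (fun s => - flux Du s / sphere_area R N).
  rewrite (_ : `]0, 1[%classic = \bigcup_n (`]n.+2%:R^-1, 1[%classic : set R)).
    apply/measurable_fun_bigcup => [n|n]; first exact: measurable_itv.
    apply: measurable_funM => //; apply: measurableT_comp => //.
    have n0 : 0 < n.+2%:R^-1 :> R by rewrite invr_gt0.
    have [mh _] := measurable_flux (flux_density_integrable n0 Du2).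
    apply: (eq_measurable_fun (fun s => \int[lebesgue_rV R N]_(x in @unit_ball R N)
      (flux_density Du x * reached x n.+2%:R^-1 * reached x s))); last exact: (measurable_funTS mh).
    by move=> s; rewrite inE/= in_itv/= => /andP[ns _]; apply: flux_reached; exact: ltW.
  apply/seteqP; split => s /=; rewrite in_itv/=.
    move=> /andP[s0 s1]; have [n hn] := ltr_add_invr s0; rewrite add0r in hn.
    exists n => //=; rewrite in_itv/= s1 andbT; apply: le_lt_trans hn.
    by rewrite lef_pV2 ?posrE// ler_nat.
  move=> [n _ /=]; rewrite in_itv/= => /andP[ns ->]; rewrite andbT.
  by apply: lt_trans ns; rewrite invr_gt0.
have m01 : measurable (`]0%R, 1%R[%classic : set R) by exact: measurable_itv.
have /(measurable_restrictT _ m01) := mF.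
congr measurable_fun; apply/funext => s; rewrite patchE mem_setE in_itv/= /profile.
by case: (0 < s < 1).
Qed.

(** The function [F] with [- Delta u = F (|x|)] when [u = f (|x|)]. *)
Definition source (R : realType) (gamma eps q : R) (f : R -> R) (s : R) : R :=
  gamma * f s / s ^+ 2 + eps * f s + `|f s| `^ q * f s.

Lemma measurable_source (R : realType) (gamma eps q : R) (f : R -> R) :
  measurable_fun setT f -> measurable_fun setT (source gamma eps q f).
Proof.
move=> mf; apply: measurable_funD; first apply: measurable_funD.
- apply: measurable_funM; first exact: measurable_funM.
  by apply: (measurableT_comp (@measurable_invr R)); exact: exprn_measurable.
- exact: measurable_funM.
- by apply: measurable_funM => //; apply: (measurableT_comp (measurable_powR _)); exact: measurableT_comp.
Qed.

(** [|x|^(-2)] is integrable in dimension at least three; with the Hardy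
    inequality this makes [u / |x|^2] integrable. *)
Lemma L2_inv_enorm (R : realType) N : (2 < N)%N -> L2 (fun x : 'rV[R]_N => (enorm x)^-1).
Proof.
move=> N2; have N1 : (1 < N)%N by exact: ltnW.
have mi : measurable_fun setT (fun x : 'rV[R]_N => (enorm x)^-1).
  exact: (measurableT_comp (@measurable_invr R) (@measurable_enorm R N)).
split; first exact: measurable_funTS.
have mG : measurable_fun setT (fun s : R => (s^-1 ^+ 2)%:E).
  by apply/measurable_EFinP; apply: measurable_funX; exact: measurable_invr.
have := ge0_integral_radial N1 mG (fun s => _); rewrite /= => /(_ (fun s => sqr_ge0 _)) ->.
apply: lte_mul_pinfty => //; apply: lte_mul_pinfty => //.
  by rewrite ge0_fin_numE// lebesgue_rV_unit_ball_lty.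
apply: (@le_lt_trans _ _ (\int[lebesgue_measure]_(s in `]0%R, 1%R[) (1 : R)%:E)%E).
  apply: ge0_le_integral => //.
  - move=> s /=; rewrite in_itv/= => /andP[s0 _]; rewrite -EFinM lee_fin.
    by rewrite mulr_ge0 ?sqr_ge0// exprn_ge0// ltW.
  - apply: measurable_funTS; apply: emeasurable_funM => //.
    by apply/measurable_EFinP; exact: exprn_measurable.
  - move=> s /=; rewrite in_itv/= => /andP[s0 s1]; rewrite -EFinM lee_fin.
    have -> : N.-1 = (2 + (N - 3))%N by case: (N) N2 => [|[|[|n]]]//= _; rewrite subSS subSS subSS subn0.
    rewrite exprD mulrA -exprMn mulVf ?gt_eqF// expr1n mul1r exprn_ile1// ltW//.
by rewrite integral_cst// mul1e lebesgue_itv01_lty.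
Qed.

Section radial_equation.
Variables (R : realType) (N : nat) (gamma eps q C : R) (u : 'rV[R]_N -> R)
  (Du : 'rV[R]_N -> 'rV[R]_N) (f : R -> R).
Hypotheses (N2 : (2 < N)%N) (qm : q * N.-2%:R = 4)
  (B0 : (0 < lebesgue_rV R N (@unit_ball R N))%E)
  (hu : H10 u Du) (cu : critical_point gamma eps u Du) (mf : measurable_fun setT f)
  (uf : {ae lebesgue_rV R N, forall x, unit_ball x -> u x = f (enorm x)})
  (f0 : f 0 = 0) (fC : forall s, 0 <= s -> s < 1 -> s ^+ N.-2 * f s ^+ 2 <= C).

Local Notation B := (@unit_ball R N).
Local Notation leb := (lebesgue_rV R N).
Local Notation w := (sphere_area R N).
Local Notation g := (source gamma eps q f).

Let N1 : (1 < N)%N. Proof. exact: ltnW. Qed.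
Let mB := @measurable_unit_ball R N.

Let afe : measurable_fun setT (fun x : 'rV[R]_N => f (enorm x)).
Proof. exact: (measurableT_comp mf (@measurable_enorm R N)). Qed.

Let K := C `^ (q / 2).

Let weight x : B x -> `|enorm x ^+ 2 * `|f (enorm x)| `^ q| <= K.
Proof.
move=> Bx; rewrite ger0_norm; last by apply: mulr_ge0; [exact: sqr_ge0|exact: powR_ge0].
have [->|x0] := eqVneq x 0; first by rewrite enorm0 expr0n mul0r powR_ge0.
have r0 : 0 < enorm x by rewrite enorm_gt0.
have m0 : (0 < N.-2)%N by case: (N) N2 => [|[|[|n]]].
have := powR_weight_le m0 qm r0 (fC (ltW r0) Bx).
by rewrite ler_pdivlMr ?exprn_gt0// mulrC.
Qed.

Let base_integrable :
  leb.-integrable B (EFin \o (fun x => f (enorm x) / enorm x ^+ 2)).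
Proof.
have h1 : L2 (fun x : 'rV[R]_N => f (enorm x) / enorm x).
  split.
    apply: measurable_funTS; apply: measurable_funM => //.
    exact: (measurableT_comp (@measurable_invr R) (@measurable_enorm R N)).
  have hd : leb.-integrable B (EFin \o (fun x => f (enorm x) ^+ 2 / enorm x ^+ 2)).
    apply: ae_eq_integrable (hardy N2 hu) => //.
      apply: measurable_funTS; apply: measurable_funM; first exact: measurable_funX.
      apply: (measurableT_comp (@measurable_invr R)).
      by apply: measurable_funX; exact: measurable_enorm.
    by apply: filterS uf => x h Bx; rewrite h.
  have /integrableP[_] := hd; apply: le_lt_trans; apply: ge0_le_integral => //.
  - by move=> x _; rewrite lee_fin sqr_ge0.
  - apply/measurable_EFinP; apply: measurable_funTS; apply: measurable_funX; apply: measurable_funM => //.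
    exact: (measurableT_comp (@measurable_invr R) (@measurable_enorm R N)).
  - by apply: measurableT_comp => //; apply/measurable_EFinP; exact: integrable_measurable hd.
  - by move=> x _; rewrite lee_fin exprMn exprVn ler_norm.
have := L2_mul_integrable h1 (L2_inv_enorm R N2).
by apply: eq_integrable => // x _ /=; rewrite -mulrA -invfM.
Qed.

Let base_mulb (m : 'rV[R]_N -> R) (k : R) : measurable_fun setT m ->
  (forall x, B x -> `|m x| <= k) ->
  leb.-integrable B (EFin \o (fun x => f (enorm x) / enorm x ^+ 2 * m x)).
Proof.
by move=> mm mk; apply: (integrable_mulb (K := k)) => //; exact: measurable_funTS.
Qed.

Let msq : measurable_fun setT (fun x : 'rV[R]_N => enorm x ^+ 2).
Proof. by apply: measurable_funX; exact: measurable_enorm. Qed.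

Let mpow : measurable_fun setT (fun x : 'rV[R]_N => `|f (enorm x)| `^ q).
Proof. by apply: (measurableT_comp (measurable_powR _)); exact: measurableT_comp. Qed.

Let sqle1 x : B x -> `|enorm x ^+ 2| <= 1.
Proof. by move=> Bx; rewrite ger0_norm ?sqr_ge0// exprn_ile1 ?enorm_ge0// ltW. Qed.

Let sq_cancel (x : 'rV[R]_N) : f (enorm x) / enorm x ^+ 2 * enorm x ^+ 2 = f (enorm x).
Proof.
have [x0|x0] := eqVneq (enorm x) 0; first by rewrite x0 f0 !mul0r.
by rewrite divfK// expf_neq0.
Qed.

Let source_integrable (v : 'rV[R]_N -> R) (k : R) : measurable_fun setT v ->
  (forall x, B x -> `|v x| <= k) ->
  [/\ leb.-integrable B (EFin \o (fun x => f (enorm x) * v x / enorm x ^+ 2)),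
      leb.-integrable B (EFin \o (fun x => f (enorm x) * v x)) &
      leb.-integrable B (EFin \o (fun x => `|f (enorm x)| `^ q * f (enorm x) * v x))].
Proof.
move=> mv vk; split.
- have := base_mulb mv vk; apply: eq_integrable => // x _ /=; congr (_%:E); ring.
- have m1 : measurable_fun setT (fun x => enorm x ^+ 2 * v x) by exact: measurable_funM.
  have b1 x : B x -> `|enorm x ^+ 2 * v x| <= 1 * k.
    by move=> Bx; rewrite normrM; apply: ler_pM => //; [exact: sqle1|exact: vk].
  have := base_mulb m1 b1; apply: eq_integrable => // x _ /=; congr (_%:E).
  by rewrite mulrA sq_cancel.
- have m1 : measurable_fun setT (fun x => enorm x ^+ 2 * `|f (enorm x)| `^ q * v x).
    by apply: measurable_funM => //; exact: measurable_funM.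
  have b1 x : B x -> `|enorm x ^+ 2 * `|f (enorm x)| `^ q * v x| <= K * k.
    by move=> Bx; rewrite normrM; apply: ler_pM => //; [exact: weight|exact: vk].
  have := base_mulb m1 b1; apply: eq_integrable => // x _ /=; congr (_%:E).
  transitivity ((f (enorm x) / enorm x ^+ 2 * enorm x ^+ 2) * (`|f (enorm x)| `^ q * v x)).
    by ring.
  by rewrite sq_cancel; ring.
Qed.

Let source_sum (v : 'rV[R]_N -> R) (k : R) : measurable_fun setT v ->
  (forall x, B x -> `|v x| <= k) ->
  leb.-integrable B (EFin \o (fun x => g (enorm x) * v x)) /\
  \int[leb]_(x in B) (g (enorm x) * v x) =
  gamma * \int[leb]_(x in B) (f (enorm x) * v x / enorm x ^+ 2) +
  eps * \int[leb]_(x in B) (f (enorm x) * v x) +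
  \int[leb]_(x in B) (`|f (enorm x)| `^ q * f (enorm x) * v x).
Proof.
move=> mv vk; have [i1 i2 i3] := source_integrable mv vk.
have j1 := integrable_mulrl gamma mB i1; have j2 := integrable_mulrl eps mB i2.
have j12 := integrable_addr mB j1 j2; have j := integrable_addr mB j12 i3.
split.
  by apply: eq_integrable j => // x _ /=; congr (_%:E); rewrite /source; ring.
rewrite -!RintegralZl// -!RintegralD//.
by apply: eq_Rintegral => x _; rewrite /source; ring.
Qed.

Let g_integrable : leb.-integrable B (EFin \o (fun x => g (enorm x))).
Proof.
have [|i1 _] := @source_sum (fun=> 1) 1 (measurable_cst _); first by move=> x _; rewrite normr1.
by apply: eq_integrable i1 => // x _ /=; rewrite mulr1.
Qed.

Lemma source_integrable01 :
  (@lebesgue_measure R).-integrable `]0, 1[%classic (EFin \o (fun s => g s * s ^+ N.-1)).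
Proof.
apply: (radial_integrable01 N1 B0); first exact: measurable_source.
exact: g_integrable.
Qed.

(** Mass of the source in the ball of radius [s], up to the area of the sphere. *)
Definition mass s : R := \int[lebesgue_measure]_(r in `[0, s]) (g r * r ^+ N.-1).

Let mg : measurable_fun setT g := measurable_source gamma eps q mf.

Let mgw : measurable_fun setT (fun s => g s * s ^+ N.-1).
Proof. by apply: measurable_funM => //; exact: exprn_measurable. Qed.

Lemma source_integrable_cc :
  (@lebesgue_measure R).-integrable `[0, 1]%classic (EFin \o (fun s => g s * s ^+ N.-1)).
Proof.
have /integrableP[m1 i1] := source_integrable01.
have mE : measurable_fun setT (EFin \o (fun s => g s * s ^+ N.-1)) by apply/measurable_EFinP.
apply/integrableP; split; first exact: (measurable_funTS mE).
rewrite -integral_itv_bndo_bndc; last by apply: measurableT_comp => //; exact: (measurable_funTS mE).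
rewrite -integral_itv_obnd_cbnd//; by apply: measurableT_comp => //; exact: (measurable_funTS mE).
Qed.

Let mass_source s : 0 < s -> s < 1 ->
  \int[leb]_(x in B) (g (enorm x) * (1 - reached x s)) = w * mass s.
Proof.
move=> s0 s1; pose h r := g r * (1 - (s <= r)%R%:R).
have mh : measurable_fun setT h.
  apply: measurable_funM => //; apply: measurable_funB => //.
  by apply: measurable_natb; exact: measurable_fun_ler.
have E r : h r * r ^+ N.-1 = (g r * r ^+ N.-1) * (1 - (s <= r)%R%:R) by rewrite /h; ring.
have mk : measurable_fun setT (fun r : R => 1 - (s <= r)%R%:R : R).
  by apply: measurable_funB => //; apply: measurable_natb; exact: measurable_fun_ler.
have bk (r : R) : `|1 - (s <= r)%R%:R : R| <= 1.
  by case: (s <= r); rewrite ?subrr ?subr0 ?normr0 ?normr1 ?ler01.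
have m01 : measurable (`]0%R, 1%R[%classic : set (measurableTypeR R)) by exact: measurable_itv.
have ih := integrable_mulb m01 source_integrable01 (measurable_funTS mk) (fun r _ => bk r).
rewrite (_ : Rintegral _ _ _ = \int[leb]_(x in B) h (enorm x)); last exact: eq_Rintegral.
rewrite Rintegral_radial//; last first.
  by apply: eq_integrable ih => // r _ /=; rewrite E.
congr (_ * _); rewrite /mass /Rintegral; congr fine.
have mE : measurable_fun setT (EFin \o (fun s => g s * s ^+ N.-1)) by apply/measurable_EFinP.
rewrite -integral_itv_bndo_bndc; last exact: (measurable_funTS mE).
rewrite -integral_itv_obnd_cbnd; last exact: (measurable_funTS mE).
rewrite [LHS]integral_indicE [RHS]integral_indicE; apply: eq_integral => r _.
rewrite E -!EFinM; congr (_%:E); rewrite !indicE !mem_setE !in_itv/=.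
have [rs|sr] := ltP r s; last by rewrite andbF subrr mulr0 mul0r mulr0.
by rewrite (lt_trans rs s1) subr0 mulr1.
Qed.

Let mass_bound : exists M, forall s, 0 <= s -> s <= 1 -> `|mass s| <= M.
Proof.
exists (\int[lebesgue_measure]_(r in `[0, 1]) `|g r * r ^+ N.-1|) => s s0 s1.
have sub : (`[0, s] `<=` `[0, 1])%classic.
  by move=> r /=; rewrite !in_itv/= => /andP[-> /le_trans]; apply.
have is_ : lebesgue_measure.-integrable (`[0, s]%classic : set R) (EFin \o (fun s => g s * s ^+ N.-1)).
  exact: integrableS source_integrable_cc.
apply: le_trans (le_normr_Rintegral _ is_) _ => //.
rewrite /Rintegral; apply: fine_le.
- exact: (integrable_fin_num _ (integrable_norm is_)).
- exact: (integrable_fin_num _ (integrable_norm source_integrable_cc)).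
- apply: ge0_subset_integral => //; apply/measurable_EFinP; apply: measurable_funTS.
  exact: measurableT_comp.
Qed.

Lemma mass_continuous s : 0 < s -> s < 1 -> {for s, continuous mass}.
Proof.
move=> s0 s1; apply: (within_continuous_continuous (a := 0) (b := 1)) => //.
- exact: (parameterized_integral_continuous ler01 source_integrable_cc).
- by rewrite in_itv/= s0.
Qed.

Let mmass : measurable_fun (`]0%R, 1%R[%classic : set R) mass.
Proof.
apply: open_continuous_measurable_fun; first exact: interval_open.
by move=> s; rewrite inE/= in_itv/= => /andP[s0 s1]; exact: mass_continuous.
Qed.

(** The Euler-Lagrange equation tested with the radial function [W (|x|)]
    whose derivative in the radius is [chi s = bump a b n s / s ^+ N.-1]. The
    left-hand side is then the flux density weighted by the bump; on the
    right, writing [W] as an integral of [chi] and exchanging the integrals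
    lets the mass of the source in balls appear. *)
Let flux_bump (a b : R) n : 0 < a -> a < b -> b < 1 ->
  \int[leb]_(x in B) (flux_density Du x * bump a b n (enorm x)) =
  - (w * \int[lebesgue_measure]_(s in `]0, 1[) (bump a b n s / s ^+ N.-1 * mass s)).
Proof.
move=> a0 ab b1.
have N0 : (0 < N)%N by exact: leq_trans N2.
pose chi s := bump a b n s / s ^+ N.-1.
have bump0 s : s < a -> bump a b n s = 0 by move=> sa; apply: bump_eq0l; exact: ltW.
have schi : sm chi by exact: (sm_divX N.-1 (sm_bump a b n) a0 bump0).
have chi0 s : s < a -> chi s = 0 by move=> sa; rewrite /chi bump0// mul0r.
have chib s : b <= s -> chi s = 0 by move=> bs; rewrite /chi bump_eq0r// mul0r.
have cchi := sm_continuous schi.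
have mchi : measurable_fun setT chi by exact: continuous_measurable_fun.
have [F [sF dF F0]] := sm_primitive a0 schi chi0.
(* Normalised to vanish near the sphere, as a test function must. *)
pose W s := F s + - F 1.
have sW : sm W by exact: (sm_add sF (sm_cst (- F 1))).
have Wa s : s < a -> W s = - F 1 by move=> sa; rewrite /W F0// add0r.
have Wb s : b < s -> W s = 0.
  suff Fb t : b <= t -> F t = F b by move=> bs; rewrite /W !Fb ?subrr// ltW.
  rewrite le_eqVlt => /predU1P[<-//|bt].
  have [c cb] := MVT bt (fun x _ => dF x) (continuous_subspaceT (fun x => der_cvg (dF x))).
  move: cb; rewrite in_itv/= => /andP[bc _].
  by rewrite chib ?mul0r ?(ltW bc)// => /eqP; rewrite subr_eq0 => /eqP.
have tv := test_function_radial N sW a0 b1 Wa Wb.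
have dW (s : R) : is_derive s 1 W (chi s).
  by apply: is_derive_eq (derD (dF s) (der_cst (- F 1) s)) _; rewrite addr0.
have EL := euler_lagrange N2 qm hu cu afe uf _ _ tv.
have fC' x : B x -> enorm x ^+ N.-2 * f (enorm x) ^+ 2 <= C.
  by move=> Bx; apply: fC => //; exact: enorm_ge0.
have f0' : f (enorm (0 : 'rV[R]_N)) = 0 by rewrite enorm0.
have := EL _ fC' f0'.
have cW : continuous (fun x : 'rV[R]_N => W (enorm x)).
  by case: tv => h _ _; exact: (h [::]).1.
have mW : measurable_fun setT (fun x : 'rV[R]_N => W (enorm x)).
  exact: continuous_measurable_rV.
have [k Wk] := continuous_bounded_ball cW.
have [iW <-] := source_sum mW Wk.
have -> : \int[leb]_(x in B) dot (Du x) (grad (fun x => W (enorm x)) x) =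
    \int[leb]_(x in B) (flux_density Du x * bump a b n (enorm x)).
  apply: eq_Rintegral => x _.
  have gE i : grad (fun x => W (enorm x)) x ord0 i = chi (enorm x) / enorm x * x ord0 i.
    by rewrite mxE; exact: (@derive_val _ _ _ _ _ _ _ (is_derive_radial i x a0 dW Wa)).
  rewrite /flux_density /dot (eq_bigr (fun i => (chi (enorm x) / enorm x) * (Du x ord0 i * x ord0 i))).
    rewrite -mulr_sumr /chi; set S := \sum_(i < N) _.
    have -> : enorm x ^+ N = enorm x * enorm x ^+ N.-1 by rewrite -exprS prednK.
    by rewrite invfM; ring.
  by move=> i _; rewrite gE; ring.
move=> ->.
have bchi : exists2 c, 0 <= c & forall s, `|chi s| <= c.
  exists (a ^- N.-1); first by rewrite invr_ge0 exprn_ge0// ltW.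
  move=> s; have [sa|as_] := ltP s a.
    by rewrite chi0// normr0 invr_ge0 exprn_ge0// ltW.
  have s0 := lt_le_trans a0 as_.
  rewrite /chi normrM ger0_norm ?bump_ge0// -[leRHS]mul1r; apply: ler_pM => //.
  - exact: bump_ge0.
  - exact: bump_le1.
  - rewrite ger0_norm ?invr_ge0 ?exprn_ge0 ?(ltW s0)//.
    by rewrite lef_pV2 ?posrE ?exprn_gt0// lerXn2r ?nnegrE// ltW.
have [c c0 chic] := bchi.
have ichi (h : R -> R) : measurable_fun setT h -> (forall s, `|h s| <= 1) ->
    lebesgue_measure.-integrable (`]0%R, 1%R[%classic : set R) (EFin \o (fun s => chi s * h s)).
  move=> mh h1; apply: (integrable_bounded (K := c)) => //.
  - exact: lebesgue_itv01_lty.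
  - by apply: measurable_funTS; exact: measurable_funM.
  - by move=> s _; rewrite normrM -[leRHS]mulr1; apply: ler_pM.
pose kk (x : 'rV[R]_N) s : R := 1 - reached x s.
have mkk : measurable_fun setT (fun p : 'rV[R]_N * R => kk p.1 p.2).
  by apply: measurable_funB => //; exact: measurable_reached.
have bkk x s : `|kk x s| <= 1.
  by rewrite /kk /reached; case: (s <= _); rewrite ?subrr ?subr0 ?normr0 ?normr1 ?ler01.
have := fubini_kernel g_integrable mchi chic mkk bkk.
have -> : \int[lebesgue_measure]_(s in `]0, 1[) (chi s * \int[leb]_(x in B) (g (enorm x) * kk x s)) =
    w * \int[lebesgue_measure]_(s in `]0, 1[) (chi s * mass s).
  rewrite -RintegralZl//; last first.
    have [M hM] := mass_bound; apply: (integrable_bounded (K := c * M)) => //.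
    - exact: lebesgue_itv01_lty.
    - apply: measurable_funM => //; exact: (measurable_funTS mchi).
    - move=> s /=; rewrite in_itv/= => /andP[s0 s1]; rewrite normrM; apply: ler_pM => //.
      by apply: hM; exact: ltW.
  apply: eq_Rintegral => s; rewrite inE/= in_itv/= => /andP[s0 s1].
  by rewrite /kk mass_source// mulrCA.
move=> <-.
have -> : \int[leb]_(x in B) (g (enorm x) * \int[lebesgue_measure]_(s in `]0, 1[) (chi s * kk x s)) =
    - 1 * \int[leb]_(x in B) (g (enorm x) * W (enorm x)); last by ring.
rewrite -RintegralZl//; apply: eq_Rintegral => x; rewrite inE => Bx.
rewrite mulrCA mulN1r; congr (_ * _).
have ir : lebesgue_measure.-integrable (`]0%R, 1%R[%classic : set R)
    (EFin \o (fun s => chi s * reached x s)).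
  apply: ichi; last exact: reached_le1.
  by apply: measurable_natb; apply: measurable_fun_ler => //; exact: measurable_cst.
have i1 : lebesgue_measure.-integrable (`]0%R, 1%R[%classic : set R) (EFin \o chi).
  have := ichi (fun=> 1) (measurable_cst _) (fun s => _); rewrite normr1 => /(_ (fun _ => lexx 1)).
  by apply: eq_integrable => // s _ /=; rewrite mulr1.
transitivity (\int[lebesgue_measure]_(s in `]0, 1[) chi s -
    \int[lebesgue_measure]_(s in `]0, 1[) (chi s * reached x s)).
  by rewrite -RintegralB//; apply: eq_Rintegral => s _; rewrite /kk; ring.
rewrite (integral_01_primitive cchi dF (F0 0 a0)) /W opprD opprK addrC; congr (- _ + _).
have [->|x0] := eqVneq x 0.
  rewrite enorm0 (F0 0 a0) (_ : Rintegral _ _ _ = \int[lebesgue_measure]_(s in `]0, 1[) 0).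
    by rewrite Rintegral_cst// mul0r.
  apply: eq_Rintegral => s; rewrite inE/= in_itv/= => /andP[s0 _].
  by rewrite /reached enorm0 leNgt s0 mulr0.
by rewrite (integral_reached a0 _ Bx cchi dF F0)// enorm_gt0.
Qed.

(** As the bumps increase to the indicator of [`]a, b[], the weighted flux
    density tends to the flux through the shell, by dominated convergence on
    both sides. *)
Lemma flux_increment (a b : R) : 0 < a -> a < b -> b < 1 ->
  flux Du a - flux Du b = - (w * \int[lebesgue_measure]_(s in `]a, b[) (mass s / s ^+ N.-1)).
Proof.
move=> a0 ab b1; have [u2 Du2] := H10_L2 hu.
have ia := flux_density_integrable a0 Du2.
have ma := integrable_measurable ia.
have m01 : measurable (`]0%R, 1%R[%classic : set (measurableTypeR R)) by exact: measurable_itv.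
have mb n : measurable_fun setT (bump a b n).
  by apply: continuous_measurable_fun; exact: sm_continuous (sm_bump a b n).
have mbe n : measurable_fun (@unit_ball R N) (fun x => bump a b n (enorm x)).
  by apply: measurable_funTS; exact: (measurableT_comp (mb n) (@measurable_enorm R N)).
have mI : measurable_fun setT (\1_(`]a, b[%classic : set R) : R -> R).
  by apply: measurable_indic; exact: measurable_itv.
have mIe : measurable_fun (@unit_ball R N) (fun x => \1_(`]a, b[%classic : set R) (enorm x) : R).
  by apply: measurable_funTS; exact: (measurableT_comp mI (@measurable_enorm R N)).
have [] := @dominated_convergence _ _ _ leb _ mB
  (fun n x => (flux_density Du x * reached x a * bump a b n (enorm x))%:E)
  (fun x => (flux_density Du x * reached x a * \1_(`]a, b[%classic : set R) (enorm x))%:E)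
  (fun x => `|(flux_density Du x * reached x a)%:E|%E).
- by move=> n; apply/measurable_EFinP; exact: measurable_funM.
- by apply/measurable_EFinP; exact: measurable_funM.
- apply: aeW => x _; apply: cvg_EFin; first exact: nearW.
  by apply: cvgM; [exact: cvg_cst|exact: cvg_bump].
- exact: integrable_abse.
- apply: aeW => x n _; rewrite !abse_EFin lee_fin normrM ler_piMr//.
  by rewrite ger0_norm ?bump_ge0// bump_le1.
move=> iL _ cL.
have [M hM] := mass_bound.
have mpw : measurable_fun setT (fun s : R => s ^- N.-1).
  by apply: (measurableT_comp (@measurable_invr R)); exact: exprn_measurable.
have [] := @dominated_convergence _ _ _ (@lebesgue_measure R) _ m01
  (fun n s => (bump a b n s / s ^+ N.-1 * mass s)%:E)
  (fun s => (\1_(`]a, b[%classic : set R) s / s ^+ N.-1 * mass s)%:E)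
  (fun s => (a ^- N.-1 * M)%:E).
- move=> n; apply/measurable_EFinP; apply: measurable_funM => //.
  exact: (measurable_funTS (measurable_funM (mb n) mpw)).
- apply/measurable_EFinP; apply: measurable_funM => //.
  exact: (measurable_funTS (measurable_funM mI mpw)).
- apply: aeW => s _; apply: cvg_EFin; first exact: nearW.
  apply: cvgM; last exact: cvg_cst.
  by apply: cvgM; [exact: cvg_bump|exact: cvg_cst].
- apply: (integrable_bounded (K := `|a ^- N.-1 * M|)) => //.
  exact: lebesgue_itv01_lty.
- apply: aeW => s n /=; rewrite in_itv/= => /andP[s0 s1].
  rewrite lee_fin normrM; apply: ler_pM => //; last by apply: hM; exact: ltW.
  have [sa|as_] := leP s a.
    by rewrite bump_eq0l// mul0r normr0 invr_ge0 exprn_ge0// ltW.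
  rewrite normrM ger0_norm ?bump_ge0// -[leRHS]mul1r; apply: ler_pM => //.
  + exact: bump_ge0.
  + exact: bump_le1.
  + rewrite ger0_norm ?invr_ge0 ?exprn_ge0 ?(ltW s0)//.
    by rewrite lef_pV2 ?posrE ?exprn_gt0// lerXn2r ?nnegrE// ltW.
move=> iR _ cR.
have E n : \int[leb]_(x in B) (flux_density Du x * reached x a * bump a b n (enorm x)) =
    - (w * \int[lebesgue_measure]_(s in `]0, 1[) (bump a b n s / s ^+ N.-1 * mass s)).
  rewrite -flux_bump//; apply: eq_Rintegral => x _; rewrite /reached.
  have [ax|xa] := leP a (enorm x); first by rewrite mulr1.
  by rewrite bump_eq0l ?mulr0// ltW.
have eL := esym (EFin_Rintegral mB iL); have eR := esym (EFin_Rintegral m01 iR).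
rewrite eL in cL; rewrite eR in cR.
move: cL cR => /fine_cvgP[_ cL] /fine_cvgP[_ cR].
have {}cR : - (w * \int[lebesgue_measure]_(s in `]0, 1[) (bump a b n s / s ^+ N.-1 * mass s)) @[n --> \oo] -->
    - (w * \int[lebesgue_measure]_(s in `]0, 1[) (\1_(`]a, b[%classic : set R) s / s ^+ N.-1 * mass s)).
  by apply: cvgN; apply: cvgM; [exact: cvg_cst|exact: cR].
have cE : - (w * \int[lebesgue_measure]_(s in `]0, 1[) (\1_(`]a, b[%classic : set R) s / s ^+ N.-1 * mass s)) =
   \int[leb]_(x in B) (flux_density Du x * reached x a * \1_(`]a, b[%classic : set R) (enorm x)).
  apply: (cvg_unique _ cR) => //.
  apply: cvg_trans cL; apply: near_eq_cvg; apply: nearW => n.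
  exact: (E n).
have -> : \int[lebesgue_measure]_(s in `]a, b[) (mass s / s ^+ N.-1) =
   \int[lebesgue_measure]_(s in `]0, 1[) (\1_(`]a, b[%classic : set R) s / s ^+ N.-1 * mass s).
  rewrite /Rintegral; congr fine; rewrite [LHS]integral_indicE [RHS]integral_indicE.
  apply: eq_integral => s _; rewrite -!EFinM; congr (_%:E); rewrite !indicE !mem_setE !in_itv/=.
  have [/andP[as_ sb]|] := boolP (a < s < b); last by rewrite !mul0r mulr0.
  by rewrite (lt_trans a0 as_) (lt_trans sb b1) !mul1r mulrC.
rewrite cE.
have as_ := lt_le_trans a0 (ltW ab).
have ib := flux_density_integrable as_ Du2.
rewrite /flux -RintegralB//; apply: (ae_eq_Rintegral mB).
- by apply: measurable_funB => //; exact: integrable_measurable ib.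
- exact: measurable_funM.
have S0 : (\int[lebesgue_measure]_(s in `]0%R, 1%R[) (\1_[set a] s)%:E = 0 :> \bar R)%E.
  rewrite integral_indic//; apply/eqP; rewrite eq_le measure_ge0 andbT.
  rewrite -(lebesgue_measure_set1 a); apply: le_measure; rewrite ?inE//.
  by apply: measurableI => //; exact: measurable_set1.
have := radial_null N1 (measurable_set1 a) S0; apply: filterS => x h Bx.
have xa : enorm x != a by apply/eqP => xa; exact: (h Bx).
rewrite /reached indicE mem_setE in_itv/= -mulrBr -mulrA; congr (_ * _).
have [ax|xa'] := leP a (enorm x); last first.
  by rewrite mul0r leNgt (lt_trans xa' ab)/= subrr.
rewrite lt_neqAle eq_sym xa ax mul1r ltNge.
by case: (b <= enorm x); rewrite ?subrr ?subr0.
Qed.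

Hypothesis fE : forall s, 0 < s -> s < 1 -> f s = - flux Du s / w.

Let w0 : 0 < w := sphere_area_gt0 N1 B0.

Let speed s := mass s / s ^+ N.-1.

Let speed_integrable (a : R) : 0 < a -> a < 1 ->
  (@lebesgue_measure R).-integrable `[a, 1[%classic (EFin \o speed).
Proof.
move=> a0 a1; have [M hM] := mass_bound.
have sub : (`[a, 1[ `<=` `]0, 1[)%classic.
  by move=> r /=; rewrite !in_itv/= => /andP[ar ->]; rewrite (lt_le_trans a0).
apply: (integrable_bounded (K := M * a ^- N.-1)) => //.
- have loo : (lebesgue_measure (`[a, 1%R[%classic : set R) < +oo)%E.
    by rewrite lebesgue_measure_itv/=; case: ifP => _; rewrite ?ltry.
  exact: loo.
- apply: measurable_funM; first exact: (measurable_funS _ sub mmass).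
  by apply: measurable_funTS; apply: (measurableT_comp (@measurable_invr R)); exact: exprn_measurable.
- move=> s /=; rewrite in_itv/= => /andP[as_ s1]; have s0 := lt_le_trans a0 as_.
  rewrite normrM; apply: ler_pM => //; first by apply: hM; exact: ltW.
  rewrite ger0_norm ?invr_ge0 ?exprn_ge0 ?(ltW s0)//.
  by rewrite lef_pV2 ?posrE ?exprn_gt0// lerXn2r ?nnegrE// ltW.
Qed.

(** [flux_increment] presents the profile as a primitive of [speed], which is
    continuous because the mass is a primitive. *)
Lemma der_profile (s : R) : 0 < s -> s < 1 -> is_derive s 1 f (- speed s).
Proof.
move=> s0 s1; pose a := s / 2; pose b := (1 + s) / 2.
have a0 : 0 < a by rewrite divr_gt0.
have as_ : a < s by rewrite /a; lra.
have sb : s < b by rewrite /b; lra.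
have b1 : b < 1 by rewrite /b; lra.
have a1 : a < 1 by exact: lt_trans s1.
have iab y : y < 1 -> (@lebesgue_measure R).-integrable `[a, y]%classic (EFin \o speed).
  move=> y1; apply: integrableS (speed_integrable a0 a1) => //.
  by move=> r /=; rewrite !in_itv/= => /andP[-> ry]; rewrite (le_lt_trans ry y1).
have cs : {for s, continuous speed}.
  apply: cvgM; first exact: mass_continuous.
  apply: cvgV; first by rewrite expf_neq0// gt_eqF.
  exact: exprn_continuous.
have [dF FE] := continuous_FTC1_closed sb (iab b b1) as_ cs.
have fF : \near s, f s = f a - \int[lebesgue_measure]_(t in `[a, s]) speed t.
  near=> y.
  have ay : a < y by near: y; exact: lt_nbhsr.
  have y1 : y < 1 by near: y; exact: lt_nbhsl.
  have y0 := lt_trans a0 ay.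
  have H := flux_increment a0 ay y1.
  have <- : \int[lebesgue_measure]_(t in `]a, y[) speed t = \int[lebesgue_measure]_(t in `[a, y]) speed t.
    rewrite /Rintegral; congr fine.
    have m1 : measurable_fun (`[a, y]%classic : set R) (EFin \o speed) by case/integrableP: (iab y y1).
    rewrite integral_itv_bndo_bndc ?integral_itv_obnd_cbnd//.
      by apply: measurable_funS m1 => // r /=; rewrite !in_itv/= => /andP[/ltW -> ->].
    by apply: measurable_funS m1 => // r /=; rewrite !in_itv/= => /andP[/ltW -> /ltW ->].
  rewrite !fE//; apply: (mulIf (lt0r_neq0 w0)).
  rewrite mulrBl !divfK ?gt_eqF//; move: H; rewrite -/speed [_ * w]mulrC; lra.
pose F y := f a - \int[lebesgue_measure]_(t in `[a, y]) speed t.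
have dFs : is_derive s 1 F (- speed s).
  have dI : is_derive s 1 (fun y : R => \int[lebesgue_measure]_(t in `[a, y]) speed t) (speed s).
    by split; [exact: dF|rewrite -derive1E FE].
  by apply: is_derive_eq (derB (der_cst (f a) s) dI) _; rewrite sub0r.
apply: (near_eq_is_derive _ dFs); by apply: filterS fF => y ->.
Unshelve. all: by end_near. Qed.

(** Once the profile is known to be continuous, so is the source. *)
Lemma der_mass (s : R) : 0 < s -> s < 1 -> is_derive s 1 mass (g s * s ^+ N.-1).
Proof.
move=> s0 s1; have cf := der_cvg (der_profile s0 s1).
have q0 : 0 < q.
  have m0 : (0 < N.-2)%N by case: (N) N2 => [|[|[|n]]].
  by rewrite -(pmulr_lgt0 _ (_ : 0 < N.-2%:R)) ?qm// ltr0n.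
have cg : {for s, continuous (fun s => g s * s ^+ N.-1)}.
  apply: cvgM; last exact: exprn_continuous.
  apply: cvgD; first apply: cvgD.
  - apply: cvgM; first by apply: cvgM; [exact: cvg_cst|exact: cf].
    apply: cvgV; first by rewrite expf_neq0// gt_eqF.
    exact: exprn_continuous.
  - by apply: cvgM; [exact: cvg_cst|exact: cf].
  - apply: (cvg_comp f (fun y => `|y| `^ q * y)); first exact: cf.
    exact: continuous_normr_powR.
have [dF FE] := continuous_FTC1_closed s1 source_integrable_cc s0 cg.
by split; [exact: dF|rewrite -derive1E FE].
Qed.

End radial_equation.

(** Criticality gives the equation, as a first-order system, and membership in
    the form domain gives the behaviour of the profile at both ends. *)
Lemma radial_solution_profile (R : realType) (N : nat) (gamma eps q : R) (u : 'rV[R]_N -> R) Du :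
  (2 < N)%N -> q * N.-2%:R = 4 -> (0 < lebesgue_rV R N (@unit_ball R N))%E ->
  H10 u Du -> critical_point gamma eps u Du -> radial u ->
  exists f Phi : R -> R,
  [/\ forall s : R, 0 < s -> s < 1 -> is_derive s 1 f (- (Phi s / s ^+ N.-1)),
      forall s : R, 0 < s -> s < 1 -> is_derive s 1 Phi (source gamma eps q f s * s ^+ N.-1),
      {ae lebesgue_rV R N, forall x, unit_ball x -> u x = f (enorm x)},
      forall e : R, 0 < e -> exists2 d : R, d < 1 & forall s, 0 < s -> d < s -> s < 1 -> f s ^+ 2 < e &
      forall e : R, 0 < e -> exists2 d : R, 0 < d & forall s, 0 < s -> s < d -> s < 1 -> s ^+ N.-2 * f s ^+ 2 < e].
Proof.
move=> N2 qm B0 hu cu ru; have N1 : (1 < N)%N by exact: ltnW.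
have [u2 Du2] := H10_L2 hu.
have w0 := sphere_area_gt0 N1 B0.
have w2 : 0 < sphere_area R N ^+ 2 by rewrite exprn_gt0.
pose f := profile Du.
have fE s : 0 < s -> s < 1 -> f s = - flux Du s / sphere_area R N.
  by move=> s0 s1; rewrite /f /profile s0 s1.
have f2E s : 0 < s -> s < 1 -> f s ^+ 2 = flux Du s ^+ 2 / sphere_area R N ^+ 2.
  by move=> s0 s1; rewrite fE// exprMn sqrrN exprVn.
have mf : measurable_fun setT f by exact: measurable_profile.
have f0 : f 0 = 0 by rewrite /f /profile ltxx.
have uf : {ae lebesgue_rV R N, forall x, unit_ball x -> u x = f (enorm x)}.
  have nz := unit_ball_ae (P := fun x : 'rV[R]_N => x != 0) (ltnW N1) (fun x h _ => h).
  apply: filterS2 (radial_flux N1 B0 hu ru) nz => x h x0 Bx.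
  by rewrite h// fE// enorm_gt0 x0.
have [C hC] := flux_bound N2 hu.
have fC s : 0 <= s -> s < 1 -> s ^+ N.-2 * f s ^+ 2 <= Num.max 0 (C / sphere_area R N ^+ 2).
  rewrite le_eqVlt => /predU1P[<- _|s0 s1]; rewrite le_max.
    by rewrite f0 [X in _ * X]expr0n mulr0 lexx.
  by apply/orP; right; rewrite f2E// mulrA ler_wpM2r ?invr_ge0 ?(ltW w2)// hC// ltW.
exists f, (mass N gamma eps q f); split => //.
- move=> s s0 s1; exact: (der_profile N2 qm B0 hu cu mf uf f0 fC fE s0 s1).
- move=> s s0 s1; exact: (der_mass N2 qm B0 hu cu mf uf f0 fC fE s0 s1).
- move=> e e0; have ew : 0 < e * sphere_area R N ^+ 2 by rewrite mulr_gt0.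
  have [d d1 hd] := flux_near1 N2 hu ew; exists d => // s s0 ds s1.
  by rewrite f2E// ltr_pdivrMr// hd.
- move=> e e0; have ew : 0 < e * sphere_area R N ^+ 2 by rewrite mulr_gt0.
  have [d d1 hd] := flux_near0 N2 hu ew; exists d => // s s0 ds s1.
  by rewrite f2E// mulrA ltr_pdivrMr// hd.
Qed.

(** * Non-existence for the Emden-Fowler equation *)

Lemma ge0_derive_le (R : realType) (F dF : R -> R) (s t : R) : s <= t ->
  (forall x, s <= x -> x <= t -> is_derive x 1 F (dF x)) ->
  (forall x, s < x -> x < t -> 0 <= dF x) -> F s <= F t.
Proof.
rewrite le_eqVlt => /predU1P[<-//|st] dFx dF0.
have cF : {within `[s, t], continuous F}.
  apply: continuous_in_subspaceT => x; rewrite inE/= in_itv/= => /andP[sx xt].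
  exact: der_cvg (dFx x sx xt).
have [|c] := MVT (f := F) (df := dF) st _ cF.
  by move=> x; rewrite in_itv/= => /andP[sx xt]; apply: dFx; exact: ltW.
rewrite in_itv/= => /andP[sc ct] E; rewrite -subr_ge0 E.
by rewrite mulr_ge0 ?dF0// subr_ge0 ltW.
Qed.

Lemma positive_near (R : realType) (h : R -> R) (t : R) : {for t, continuous h} ->
  0 < h t -> exists2 d : R, 0 < d & forall s, `|t - s| < d -> 0 < h s.
Proof.
move=> /cvgrPdist_lt ch ht; have [d /= d0 hd] := ch _ ht.
exists d => // s /hd /=; move/(le_lt_trans (ler_norm _)); lra.
Qed.

Lemma last_root (R : realType) (h : R -> R) (z U : R) :
  (forall t, 0 < t -> {for t, continuous h}) -> 0 < z -> z <= U -> h z = 0 ->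
  exists T, [/\ 0 < T, T <= U, h T = 0 & forall t, T < t -> t <= U -> h t != 0].
Proof.
move=> ch z0 zU hz; pose Z := [set t | [/\ 0 < t, t <= U & h t = 0]].
have Zz : Z z by [].
have hZ : has_sup Z by split; [exists z|exists U => t []].
pose T := sup Z.
have ZT t : Z t -> t <= T by move=> Zt; apply: sup_upper_bound.
have T_0 : 0 < T by exact: lt_le_trans z0 (ZT z Zz).
exists T; split => //.
- by apply: ge_sup; [exists z|move=> t []].
- apply/eqP/negPn/negP => hT.
  have := ch T T_0 => /cvgrPdist_lt /(_ `|h T|); rewrite normr_gt0 => /(_ hT) [d /= d0 hd].
  have [s [s0 sU hs] sT] := sup_adherent d0 hZ.
  suff /hd : ball_ [eta Num.norm] T d s by rewrite /= hs subr0 ltxx.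
  rewrite /ball_/= ger0_norm; first by rewrite ltrBlDr -ltrBlDl.
  by rewrite subr_ge0; apply: ZT.
- move=> t Tt tU; apply/eqP => ht; have := ZT t; rewrite leNgt Tt => /(_ _)/negP; apply=> //.
  by split => //; exact: lt_trans Tt.
Qed.

Section emden_fowler.
Variables (R : realType) (mu eps q : R) (w v : R -> R).
Hypotheses (mu0 : 0 < mu) (mu2 : mu <= 2) (q0 : 0 < q) (eps0 : 0 < eps)
  (eps1 : eps <= mu ^+ 2 / 4).
Hypothesis dw : forall t : R, 0 < t -> is_derive t 1 w (v t).
Hypothesis dv : forall t : R, 0 < t ->
  is_derive t 1 v ((mu ^+ 2 - eps * expR (- 2 * t) - `|w t| `^ q) * w t).
Hypothesis w_oo : forall e : R, 0 < e -> exists T : R, forall t, 0 < t -> T < t -> `|w t| < e.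
Hypothesis w_0 : forall e : R, 0 < e -> exists2 d : R, 0 < d & forall t, 0 < t -> t < d -> `|w t| < e.

Let c t : R := eps * expR (- 2 * t).

Let c_gt0 t : 0 < c t. Proof. by rewrite mulr_gt0// expR_gt0. Qed.

Let c_le t : 0 < t -> c t <= eps.
Proof.
by move=> t0; rewrite -[leRHS]mulr1 ler_wpM2l ?(ltW eps0)// -expR0 ler_expR mulNr oppr_le0 mulr_ge0// ltW.
Qed.

Let dc (t : R) : is_derive t 1 c (- 2 * c t).
Proof.
have h := derZ eps (der_exp (derZ (- 2) (der_id t))).
by apply: is_derive_eq h _; rewrite /c; ring.
Qed.

Let b0 : 0 < mu ^+ 2. Proof. by rewrite exprn_gt0. Qed.

Definition ef_energy t : R := 2^-1 * v t ^+ 2 - mu ^+ 2 / 2 * w t ^+ 2 + 2^-1 * (c t * w t ^+ 2)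
  + (q + 2)^-1 * `|w t| `^ (q + 2).
Local Notation E := ef_energy.

(** The energy decreases because the only time dependent coefficient of the
    equation does. *)
Let dE (t : R) : 0 < t -> is_derive t 1 E (- (c t * w t ^+ 2)).
Proof.
move=> t0; have h1 := derZ 2^-1 (derX 2 (dv t0)).
have h2 := derZ (mu ^+ 2 / 2) (derX 2 (dw t0)).
have h3 := derZ 2^-1 (derM (dc t) (derX 2 (dw t0))).
have h4 := derZ (q + 2)^-1 (der_comp (f := fun y : R => `|y| `^ (q + 2))
  (is_derive_normr_powR (w t) q0) (dw t0)).
apply: is_derive_eq (derD (derD (derB h1 h2) h3) h4) _.
rewrite /= -/(c t); move: (`|w t| `^ q) (c t) (w t) (v t) => P C W V.
by field; rewrite gt_eqF// addr_gt0.
Qed.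

Let cw (t : R) : 0 < t -> {for t, continuous w}.
Proof. by move=> t0; exact: der_cvg (dw t0). Qed.

Let cwitv (s t : R) : 0 < s -> {within `[s, t], continuous w}.
Proof.
move=> s0; apply: continuous_in_subspaceT => x; rewrite inE/= in_itv/= => /andP[sx _].
by apply: cw; exact: lt_le_trans sx.
Qed.

Let E_nonincr s t : 0 < s -> s <= t -> E t <= E s.
Proof.
move=> s0 st; rewrite -lerN2; apply: (ge0_derive_le (F := fun t => - E t) (dF := fun t => c t * w t ^+ 2) st).
  move=> x sx _; have x0 := lt_le_trans s0 sx.
  by apply: is_derive_eq (derN (dE x0)) _; rewrite opprK.
by move=> x _ _; rewrite mulr_ge0 ?sqr_ge0// ltW.
Qed.

(** The only negative term of the energy is a multiple of [w^2], which tends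
    to zero; a negative value, by contrast, would persist. *)
Let E_ge0 t : 0 < t -> 0 <= E t.
Proof.
move=> t0; rewrite leNgt; apply/negP => Et.
have e0 : 0 < Num.min 1 (- E t / mu ^+ 2) by rewrite lt_min ltr01 divr_gt0// oppr_gt0.
have [T hT] := w_oo e0; pose s := Num.max t (T + 1).
have ts : t <= s by rewrite le_max lexx.
have s0 := lt_le_trans t0 ts.
have Ts : T < s by rewrite lt_max ltrDl ltr01 orbT.
have := hT s s0 Ts; rewrite lt_min => /andP[ws1 ws2].
have w2 : w s ^+ 2 <= `|w s|.
  by rewrite -real_normK ?num_real// expr2 ler_piMl// ltW.
have := E_nonincr t0 ts; rewrite {1}/ef_energy.
have := sqr_ge0 (v s); have : 0 <= c s * w s ^+ 2 by rewrite mulr_ge0 ?sqr_ge0// ltW.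
have : 0 <= (q + 2)^-1 * `|w s| `^ (q + 2).
  by rewrite mulr_ge0 ?powR_ge0// invr_ge0 ltW// addr_gt0.
move: ws2; rewrite ltr_pdivlMr// => ws2.
have : mu ^+ 2 / 2 * w s ^+ 2 <= (`|w s| * mu ^+ 2) / 2.
  by rewrite mulrAC ler_wpM2r// mulrC ler_wpM2r// ltW.
move: Et ws2; move: (mu ^+ 2 / 2 * w s ^+ 2) (`|w s| * mu ^+ 2) (E t) => A B e.
by move: (c s * w s ^+ 2) ((q + 2)^-1 * _) (v s ^+ 2) => x y z; lra.
Qed.

(** By the mean value theorem, [v] is small somewhere in every late interval
    of length one. *)
Let small_tail (e T0 : R) : 0 < e -> exists t, [/\ 0 < t, T0 < t, `|w t| < e & `|v t| < e].
Proof.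
move=> e0; have e2 : 0 < e / 2 by rewrite divr_gt0.
have [T hT] := w_oo e2; pose s := Num.max 1 (Num.max (T0 + 1) (T + 1)).
have s0 : 0 < s by rewrite lt_max ltr01.
have s1 : s < s + 1 by rewrite ltrDl.
have [|x] := MVT (f := w) (df := v) s1 _ (cwitv s0).
  by move=> x; rewrite in_itv/= => /andP[sx _]; apply: dw; exact: lt_trans sx.
rewrite in_itv/= => /andP[sx _]; rewrite addrAC subrr add0r mulr1 => wv.
have Ts : T < s by rewrite !lt_max ltrDl ltr01 !orbT.
have T0s : T0 < s by rewrite !lt_max ltrDl ltr01 !orbT.
have x0 := lt_trans s0 sx.
exists x; split => //; first exact: lt_trans sx.
  by apply: lt_trans (hT x x0 (lt_trans Ts sx)) _; lra.
rewrite -wv (le_lt_trans (ler_normB _ _))//.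
have := hT s s0 Ts; have := hT (s + 1) (lt_trans s0 s1) (lt_trans Ts s1); lra.
Qed.

(** Gronwall: for [L] large [exp (L t) (w^2 + v^2)] is nondecreasing, so
    vanishing data at [t] propagate to earlier times. *)
Let no_double_zero (s t : R) : w t = 0 -> v t = 0 -> 0 < s -> s <= t -> w s = 0.
Proof.
move=> wt vt s0 st; have t0 := lt_le_trans s0 st.
have cn : {within `[s, t], continuous (fun x => `|w x|)}.
  apply: continuous_in_subspaceT => x; rewrite inE/= in_itv/= => /andP[sx _].
  by apply: (continuous_comp (cw (lt_le_trans s0 sx))); exact: norm_continuous.
have [x _ hx] := EVT_max st cn.
(* Large enough for [2 (1 + a) w v] to be at most [L (w^2 + v^2)] in
   absolute value. *)
pose L := 1 + (mu ^+ 2 + eps + `|w x| `^ q).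
pose F y := expR (L * y) * (w y ^+ 2 + v y ^+ 2).
pose a y := mu ^+ 2 - c y - `|w y| `^ q.
have aL y : s <= y -> y <= t -> `|1 + a y| <= L.
  move=> sy yt; have y0 := lt_le_trans s0 sy.
  have : `|w y| `^ q <= `|w x| `^ q.
    apply: ge0_ler_powR; rewrite ?nnegrE ?(ltW q0)//.
    by apply: hx; rewrite in_itv/= sy.
  have := powR_ge0 `|w y| q; have := c_le y0; have := c_gt0 y.
  rewrite ler_norml /L /a; move: (_ `^ _) (_ `^ _) (c y) => P Q C; have := b0; lra.
have dF (y : R) : 0 < y -> is_derive y 1 F
    (expR (L * y) * (L * (w y ^+ 2 + v y ^+ 2) + 2 * (1 + a y) * (w y * v y))).
  move=> y0; have h1 := der_exp (derZ L (der_id y)).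
  apply: is_derive_eq (derM h1 (derD (derX 2 (dw y0)) (derX 2 (dv y0)))) _.
  by rewrite /= -/(c y) -/(a y); ring.
have : F s <= F t.
  apply: (ge0_derive_le st (fun y sy _ => dF y (lt_le_trans s0 sy))) => y sy yt.
  apply: mulr_ge0; first exact: expR_ge0.
  have := aL y (ltW sy) (ltW yt); rewrite ler_norml => /andP[l1 l2].
  have h1 : 0 <= (L - (1 + a y)) * (w y - v y) ^+ 2 by rewrite mulr_ge0 ?sqr_ge0// subr_ge0.
  have h2 : 0 <= (L + (1 + a y)) * (w y + v y) ^+ 2.
    by apply: mulr_ge0; [move: l1; lra|exact: sqr_ge0].
  move: h1 h2; move: (1 + a y) (w y) (v y) => A X Y; lra.
rewrite /F wt vt expr0n addr0 mulr0 pmulr_rle0 ?expR_gt0// => h.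
apply/eqP; rewrite -sqrf_eq0 eq_le sqr_ge0 andbT; apply: le_trans h.
by rewrite lerDl sqr_ge0.
Qed.

Let bq : 0 < (mu ^+ 2 / 4) `^ q^-1.
Proof. by rewrite powR_gt0// divr_gt0. Qed.

Let powR_lt_root (y A : R) : 0 <= y -> 0 <= A -> y < A `^ q^-1 -> y `^ q < A.
Proof.
move=> y0 A0 yA; rewrite -[ltRHS](powRr1 A0) -(mulVf (lt0r_neq0 q0)) powRrM.
by apply: gt0_ltr_powR; rewrite ?nnegrE ?powR_ge0.
Qed.

(** Near infinity the square of a solution is convex, so that a late zero
    forces the solution to vanish identically. *)
Let late_zero : exists2 T, 0 < T & forall s, T < s -> w s = 0 -> forall t, 0 < t -> w t = 0.
Proof.
have [T hT] := w_oo bq.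
exists (Num.max 1 T); first by rewrite lt_max ltr01.
move=> s; rewrite gt_max => /andP[s1 Ts] ws.
have s0 : 0 < s by exact: lt_trans s1.
have convex t : s <= t -> 0 <= (mu ^+ 2 - c t - `|w t| `^ q) * w t * w t.
  move=> st; rewrite -mulrA -expr2 mulr_ge0 ?sqr_ge0//.
  have t0 := lt_le_trans s0 st.
  have := powR_lt_root (normr_ge0 _) _ (hT t t0 (lt_le_trans Ts st)).
  move=> /(_ (ltW (divr_gt0 b0 (ltr0n R 4)))); have := c_le t0; have := eps1.
  have := b0; lra.
(* A convex function that vanishes with its derivative and tends to zero
   vanishes from there on. *)
pose y t := w t ^+ 2; pose y' t := 2 * (w t * v t).
have dy (t : R) : 0 < t -> is_derive t 1 y (y' t).
  by move=> t0; apply: is_derive_eq (derX 2 (dw t0)) _; rewrite /= /y'; ring.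
have dy' (t : R) : 0 < t -> is_derive t 1 y'
    (2 * (v t ^+ 2 + (mu ^+ 2 - c t - `|w t| `^ q) * w t * w t)).
  move=> t0; apply: is_derive_eq (derZ 2 (derM (dw t0) (dv t0))) _.
  by rewrite -/(c t); ring.
have y'0 t : s <= t -> 0 <= y' t.
  move=> st; have : y' s <= y' t.
    apply: (ge0_derive_le st (fun x sx _ => dy' x (lt_le_trans s0 sx))) => x sx _.
    by rewrite mulr_ge0// addr_ge0 ?sqr_ge0// convex// ltW.
  by rewrite {1}/y' ws mul0r mulr0.
have ymono t t' : s <= t -> t <= t' -> y t <= y t'.
  move=> st tt'.
  apply: (ge0_derive_le tt' (fun x tx _ => dy x (lt_le_trans s0 (le_trans st tx)))) => x tx _.
  by apply: y'0; exact: le_trans (ltW tx).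
have w0 t : s <= t -> w t = 0.
  move=> st; apply/eqP/negPn/negP => wt.
  have e0 : 0 < `|w t| by rewrite normr_gt0.
  have [T' hT'] := w_oo e0; pose t' := Num.max t (T' + 1).
  have tt' : t <= t' by rewrite le_max lexx.
  have := hT' t' (lt_le_trans s0 (le_trans st tt')); rewrite lt_max ltrDl ltr01 orbT => /(_ isT).
  have := ymono t t' st tt'; rewrite /y -[leLHS]real_normK ?num_real// -[leRHS]real_normK ?num_real//.
  by rewrite ler_sqr ?nnegrE// leNgt => /negbTE ->.
have ss : s < s + 1 by rewrite ltrDl.
have s10 : 0 < s + 1 by exact: lt_trans ss.
have v0 : v (s + 1) = 0.
  have h1 : is_derive (s + 1) 1 w 0.
    apply: (near_eq_is_derive _ (der_cst 0 (s + 1))).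
    near=> z; rewrite w0//; apply: ltW; near: z; exact: lt_nbhsr.
  by rewrite -(@derive_val _ _ _ _ _ _ _ (dw s10)) (@derive_val _ _ _ _ _ _ _ h1).
move=> t t0; have [ts|st] := leP t (s + 1); last by apply: w0; exact/ltW/(lt_trans ss).
exact: (no_double_zero (w0 _ (ltW ss)) v0 t0 ts).
Unshelve. all: by end_near. Qed.

Let ivt (s t : R) : 0 < s -> s <= t -> (w s <= 0 <= w t) || (w t <= 0 <= w s) ->
  exists2 z, s <= z <= t & w z = 0.
Proof.
move=> s0 st h; have [|z] := @IVT R w s t 0 st (cwitv s0).
  by rewrite ge_min le_max; case/orP: h => /andP[-> ->]; rewrite ?orbT.
by rewrite in_itv/= => zst wz; exists z.
Qed.

Let last_zero (t1 t2 : R) : 0 < t1 -> w t1 < 0 -> 0 < t2 -> 0 < w t2 ->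
  exists T, [/\ 0 < T, w T = 0 & forall t, T < t -> w t != 0].
Proof.
move=> t10 w1 t20 w2; have [T0 T00 hT0] := late_zero.
have [z0 [z00 wz0]] : exists z, 0 < z /\ w z = 0.
  have [t12|t21] := leP t1 t2.
    have [z /andP[h1 _] wz] := ivt t10 t12 (introT orP (or_introl _ (introT andP (conj (ltW w1) (ltW w2))))).
    by exists z; split => //; exact: lt_le_trans h1.
  have [z /andP[h1 _] wz] := ivt t20 (ltW t21) (introT orP (or_intror _ (introT andP (conj (ltW w1) (ltW w2))))).
  by exists z; split => //; exact: lt_le_trans h1.
have Zub t : 0 < t -> w t = 0 -> t <= T0.
  move=> t0 wt; rewrite leNgt; apply/negP => T0t.
  by have := hT0 t T0t wt t1 t10; move/eqP; rewrite lt_eqF.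
have [T [T_0 TT0 wT hT]] := last_root cw z00 (Zub _ z00 wz0) wz0.
exists T; split => // t Tt; have [tT0|T0t] := leP t T0; first exact: hT.
apply/eqP => wt; move: T0t; rewrite ltNge Zub//; exact: lt_trans Tt.
Qed.

(** A multiplier for the half line after the last zero. Its derivative
    contains [exp (- mu (t - T)) w^2], the quantity to which the energy is
    lost; subtracting [M (v + mu w)] gives the nonlinear term the sign of [M -
    w]. *)
Let virial (T M : R) (t : R) : R := expR (- mu * (t - T)) *
  (w t * v t + mu / 2 * w t ^+ 2 - M * (v t + mu * w t)).

Let dvirial (T M t : R) : 0 < t -> is_derive t 1 (virial T M)
  (expR (- mu * (t - T)) * (v t ^+ 2 + mu ^+ 2 / 2 * w t ^+ 2
     + (c t + `|w t| `^ q) * w t * (M - w t))).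
Proof.
move=> t0; have h1 := der_exp (derZ (- mu) (derB (der_id t) (der_cst T t))).
have h2 := derM (dw t0) (dv t0).
have h3 := derZ (mu / 2) (derX 2 (dw t0)).
have h4 := derZ M (derD (dv t0) (derZ mu (dw t0))).
apply: is_derive_eq (derM h1 (derB (derD h2 h3) h4)) _.
by rewrite /= -/(c t); field.
Qed.

Section last_zero.
Variables (T : R).
Hypotheses (T0 : 0 < T) (wT : w T = 0) (w_pos : forall t, T < t -> 0 < w t)
  (w_neg : exists2 t, 0 < t & w t < 0).

Local Notation slope := (v T).

(** The slope cannot vanish at a zero of a nontrivial solution, and it cannot
    be negative since [w] is positive afterwards. *)
Let slope_gt0 : 0 < slope.
Proof.
have [t t0 wt] := w_neg.
have tT : t <= T by rewrite leNgt; apply/negP => /w_pos; rewrite ltNge (ltW wt).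
rewrite lt_neqAle; apply/andP; split.
  by apply/eqP => vT; move: wt; rewrite (no_double_zero wT (esym vT) t0 tT) ltxx.
rewrite leNgt; apply/negP => vT.
have cvN : {for T, continuous (fun s => - v s)}.
  by apply: cvgN; exact: der_cvg (dv T0).
have [|d d0 hd] := positive_near cvN; first by rewrite oppr_gt0.
have Td : T < T + d / 2 by rewrite ltrDl divr_gt0.
have : - w T <= - w (T + d / 2).
  apply: (ge0_derive_le (F := fun s => - w s) (dF := fun s => - v s) (ltW Td)) => x Tx xd.
    by apply: derN; apply: dw; exact: lt_le_trans Tx.
  apply/ltW/hd; rewrite distrC ger0_norm ?subr_ge0 ?(ltW Tx)// ltrBlDl.
  by apply: lt_trans xd _; rewrite ltrD2l ltr_pdivrMr// ltr_pMr// ltr1n.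
by rewrite wT oppr0 oppr_ge0 leNgt w_pos.
Qed.

Local Notation p := (q + 2).
Let p0 : 0 < p. Proof. by rewrite addr_gt0. Qed.
Let M := (p * mu ^+ 2) `^ q^-1.
Let M0 : 0 < M. Proof. by rewrite powR_gt0// mulr_gt0. Qed.

(** At the late times provided by [small_tail] the energy is arbitrarily
    small. *)
Let E_tail (e t : R) : 0 < t -> e <= 1 -> `|w t| < e -> `|v t| < e -> E t <= e * (2 + eps).
Proof.
move=> t0 e1 we ve; have e0 : 0 <= e by exact: le_trans (normr_ge0 _) (ltW we).
have sq (x : R) : `|x| < e -> x ^+ 2 <= e.
  move=> xe; rewrite -[leLHS]real_normK ?num_real// expr2.
  apply: le_trans (ltW xe); rewrite ler_piMl//; exact: le_trans (ltW xe) e1.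
have w2 := sq _ we; have v2 := sq _ ve.
have P1 : `|w t| `^ p <= e.
  rewrite normr_powRD2//; apply: le_trans w2; rewrite ler_piMl ?sqr_ge0//.
  by apply: powR_le1 => //; exact: le_trans (ltW we) e1.
have P2 : p^-1 * `|w t| `^ p <= `|w t| `^ p.
  rewrite ler_piMl ?powR_ge0// invf_le1//; have := q0; lra.
have P3 : c t * w t ^+ 2 <= eps * e.
  by apply: ler_pM; rewrite ?sqr_ge0 ?c_le// ltW.
have P4 : 0 <= mu ^+ 2 / 2 * w t ^+ 2 by rewrite mulr_ge0 ?sqr_ge0// divr_ge0// ltW.
have P5 : 0 <= eps * e by rewrite mulr_ge0// ltW.
rewrite /ef_energy; move: P4 P3; move: (mu ^+ 2 / 2 * _) (c t * _) => A B; lra.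
Qed.

Let E_T : E T = slope ^+ 2 / 2.
Proof.
rewrite /ef_energy wT normr0 expr0n !mulr0 powR0 ?gt_eqF// mulr0 !addr0 subr0 mulrC//.
Qed.

(** At the maximum of [w] after [T] the energy is an explicit function of the
    amplitude [S]. It is at most the energy at [T], which is lost entirely
    afterwards, hence at most the integral of [c] times [S^2], that is [eps
    S^2 / 2]. Solving for [S] gives a bound that does not depend on [eps]. *)
Let w_le_M t : T <= t -> w t <= M.
Proof.
have T1 : T < T + 1 by rewrite ltrDl.
have w1 := w_pos T1.
have [T2 hT2] := w_oo w1; pose U := Num.max (T + 1) T2.
have U1 : T + 1 <= U by rewrite le_max lexx.
have TU : T <= U by exact: le_trans (ltW T1) U1.
have [s] := EVT_max TU (cwitv T0).
rewrite in_itv/= => /andP[Ts sU] hs.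
have hs' t' : T <= t' -> w t' <= w s.
  move=> Tt'; have [t'U|Ut'] := leP t' U; first by apply: hs; rewrite in_itv/= Tt'.
  apply: (@le_trans _ _ (w (T + 1))); last by apply: hs; rewrite in_itv/= (ltW T1) U1.
  apply: le_trans (ler_norm _) _; apply/ltW/hT2; first exact: lt_le_trans T0 Tt'.
  by apply: le_lt_trans Ut'; rewrite le_max lexx orbT.
have ws : 0 < w s by apply: lt_le_trans w1 (hs' _ (ltW T1)).
have sT : T < s by rewrite lt_neqAle Ts andbT; apply/eqP => Es; rewrite -Es wT ltxx in ws.
have s0 := lt_trans T0 sT.
have vs : v s = 0.
  have ss : s < s + 1 by rewrite ltrDl.
  have [_ h2] : is_derive s 1 w 0.
    apply: (@derive1_at_max R w T (s + 1) s).
  - by rewrite ltW// (lt_trans sT).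
  - move=> x; rewrite in_itv/= => /andP[Tx _].
    exact: (@ex_derive _ _ _ _ _ _ _ (dw (lt_trans T0 Tx))).
  - by rewrite in_itv/= sT ss.
  - by move=> x; rewrite in_itv/= => /andP[Tx _]; apply: hs'; exact: ltW.
  by move: h2; rewrite (@derive_val _ _ _ _ _ _ _ (dw s0)).
have ET : E T <= eps / 2 * w s ^+ 2.
  (* As [c' = - 2 c], the subtracted term loses [c * (w s)^2], which is
     more than the energy does. *)
  pose F x := E x - w s ^+ 2 / 2 * c x.
  have dF (x : R) : 0 < x -> is_derive x 1 F (c x * (w s ^+ 2 - w x ^+ 2)).
    move=> x0; apply: is_derive_eq (derB (dE x0) (derZ (w s ^+ 2 / 2) (dc x))) _.
    by field.
  have Fle x : T <= x -> F T <= F x.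
    move=> Tx; apply: (ge0_derive_le Tx (fun y Ty _ => dF y (lt_le_trans T0 Ty))) => y Ty _.
    apply: mulr_ge0; first exact: ltW.
    rewrite subr_ge0 ler_sqr ?nnegrE ?(ltW ws) ?(ltW (w_pos Ty))//.
    by apply: hs'; exact: ltW.
  have cT := c_le T0.
  suff : F T <= 0.
    have : w s ^+ 2 / 2 * c T <= w s ^+ 2 / 2 * eps by rewrite ler_wpM2l// divr_ge0// sqr_ge0.
    rewrite /F; lra.
  apply/ler_addgt0Pr => d d0; rewrite add0r.
  have e0 : 0 < Num.min 1 (d / (2 + eps)) by rewrite lt_min ltr01 divr_gt0// addr_gt0.
  have [x [x0 Tx wx vx]] := small_tail T e0.
  apply: le_trans (Fle x (ltW Tx)) _.
  apply: (@le_trans _ _ (E x)); first by rewrite /F gerBl mulr_ge0 ?divr_ge0 ?sqr_ge0// ltW.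
  apply: le_trans (E_tail x0 _ wx vx) _; first by rewrite ge_min lexx.
  by rewrite -ler_pdivlMr ?addr_gt0// ge_min lexx orbT.
have Es := le_trans (E_nonincr T0 Ts) ET.
have key : w s `^ q <= p * mu ^+ 2.
  have w2 : 0 < w s ^+ 2 by rewrite exprn_gt0.
  rewrite -(ler_pM2r w2) -(ler_pM2l (_ : 0 < p^-1)) ?invr_gt0//.
  have -> : p^-1 * (p * mu ^+ 2 * w s ^+ 2) = mu ^+ 2 * w s ^+ 2 by field; rewrite gt_eqF.
  move: Es; rewrite /ef_energy vs expr0n mulr0 add0r normr_powRD2// gtr0_norm//.
  have : 0 <= c s * w s ^+ 2 by rewrite mulr_ge0 ?ltW.
  have : eps * w s ^+ 2 <= mu ^+ 2 / 4 * w s ^+ 2 by rewrite ler_wpM2r// ltW.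
  move: w2; move: (w s ^+ 2) => A; move: (c s * A) (p^-1 * _) => B C; nra.
move=> Tt; apply: le_trans (hs' t Tt) _; rewrite /M.
have -> : w s = (w s `^ q) `^ q^-1 by rewrite -powRrM mulfV ?gt_eqF// powRr1// ltW.
apply: ge0_ler_powR; rewrite ?invr_ge0 ?nnegrE ?powR_ge0 ?(ltW q0)//.
by rewrite mulr_ge0// ltW.
Qed.

(** Since [mu <= 2], the weight [exp (- mu (t - T))] of the virial dominates
    the weight [exp (- 2 (t - T))] of the energy loss, so that adding a small
    multiple [K] of the virial turns the energy into a nondecreasing function.
    It tends to zero, and at [T] it equals [slope^2 / 2 - K M slope]. *)
Let slope_le : slope <= 4 * M / mu ^+ 2 * c T.
Proof.
(* Chosen so that the virial gains exactly what the energy may lose. *)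
pose K := c T * (2 / mu ^+ 2).
have K0 : 0 < K by rewrite mulr_gt0// divr_gt0.
pose G t := E t + K * virial T M t.
have dG (t : R) : 0 < t -> is_derive t 1 G _ := fun t0 => derD (dE t0) (derZ K (dvirial T M t0)).
have G0 t : T <= t -> G T <= G t.
  move=> Tt; apply: (ge0_derive_le Tt (fun y Ty _ => dG y (lt_le_trans T0 Ty))) => y Ty _.
  have cy : c y <= c T * expR (- mu * (y - T)).
    have -> : c y = c T * expR (- 2 * (y - T)).
      by rewrite /c -mulrA -expRD; congr (_ * expR _); ring.
    apply: ler_wpM2l; first exact: ltW.
    by rewrite ler_expR; apply: ler_wpM2r; rewrite ?lerN2// subr_ge0 ltW.
  have wy := w_pos Ty; have wM := w_le_M (ltW Ty).
  have h1 : 0 <= (c y + `|w y| `^ q) * w y * (M - w y).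
    apply: mulr_ge0; last by rewrite subr_ge0.
    by apply: mulr_ge0; [apply: addr_ge0; [exact: ltW|exact: powR_ge0]|exact: ltW].
  set phi := expR _ in cy *; have phi0 : 0 < phi by exact: expR_gt0.
  have h2 : c y * w y ^+ 2 <= c T * phi * w y ^+ 2 by rewrite ler_wpM2r ?sqr_ge0.
  have h3 : K * (phi * (mu ^+ 2 / 2 * w y ^+ 2)) = c T * phi * w y ^+ 2.
    by rewrite /K; field; rewrite gt_eqF.
  have h4 : 0 <= K * phi * (v y ^+ 2 + (c y + `|w y| `^ q) * w y * (M - w y)).
    by apply: mulr_ge0; [rewrite mulr_ge0 ?ltW|rewrite addr_ge0 ?sqr_ge0].
  move: h1 h2 h3 h4; move: (_ * w y * (M - w y)) => A; move: (w y ^+ 2) (v y ^+ 2) => B V.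
  move=> h1 h2 h3 h4; rewrite !mulrDr h3; move: h4; rewrite mulrDr !mulrA; lra.
have GT : G T <= 0.
  pose C := 2 + eps + K * (2 + 3 * M).
  have KM : 0 < K * (2 + 3 * M) by apply: mulr_gt0 => //; move: M0; lra.
  have C0 : 0 < C by rewrite /C; move: KM eps0; lra.
  apply/ler_addgt0Pr => d d0; rewrite add0r.
  have e0 : 0 < Num.min 1 (d / C) by rewrite lt_min ltr01 divr_gt0.
  have [x [x0 Tx wx vx]] := small_tail T e0; set e := Num.min _ _ in e0 wx vx.
  have e1 : e <= 1 by rewrite ge_min lexx.
  apply: le_trans (G0 x (ltW Tx)) _; apply: (@le_trans _ _ (e * C)); last first.
    by rewrite -ler_pdivlMr// ge_min lexx orbT.
  rewrite /G /C mulrDr; apply: lerD; first exact: E_tail.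
  rewrite [leRHS]mulrCA ler_pM2l//.
  have phi1 : expR (- mu * (x - T)) <= 1.
    by rewrite -expR0 ler_expR mulNr oppr_le0 mulr_ge0 ?subr_ge0 ?ltW.
  have inner : w x * v x + mu / 2 * w x ^+ 2 - M * (v x + mu * w x) <= e * (2 + 3 * M).
    have /ltr_normlP[w1 w2] := wx; have /ltr_normlP[v1 v2] := vx.
    have h1 : w x * v x <= e.
      apply: (le_trans (ler_norm _)); rewrite normrM -[leRHS]mulr1; apply: ler_pM => //; first exact: ltW.
      exact: le_trans (ltW vx) e1.
    have h2 : w x ^+ 2 <= e.
      rewrite -[leLHS]real_normK ?num_real// expr2 -[leRHS]mulr1; apply: ler_pM => //; first exact: ltW.
      exact: le_trans (ltW wx) e1.
    have h3 : mu / 2 * w x ^+ 2 <= 1 * e.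
      by apply: ler_pM; rewrite ?sqr_ge0 ?divr_ge0 ?(ltW mu0)// ler_pdivrMr// mul1r.
    have h4 : - (mu * w x) <= 2 * e.
      rewrite -mulrN; apply: le_trans (_ : mu * e <= _); first by rewrite ler_wpM2l ?(ltW mu0)// ltW.
      by rewrite ler_wpM2r// ltW.
    have h5 : M * (- (v x + mu * w x)) <= M * (3 * e).
      by rewrite ler_wpM2l ?(ltW M0)//; move: h4 v1 => {}h4 v1; lra.
    move: h5; rewrite mulrN; lra.
  have [i0|i0] := leP 0 (w x * v x + mu / 2 * w x ^+ 2 - M * (v x + mu * w x)).
    by apply: le_trans inner; rewrite ler_piMl.
  apply: (@le_trans _ _ 0).
    by rewrite pmulr_rle0 ?expR_gt0// ltW.
  by rewrite mulr_ge0 ?addr_ge0 ?mulr_ge0// ltW.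
move: GT; rewrite /G E_T /virial subrr mulr0 expR0 wT mul1r mul0r expr0n !mulr0 !addr0 sub0r.
move=> GT; have : slope * (slope / 2 - K * M) <= 0 by move: GT; lra.
rewrite pmulr_rle0// subr_le0 => h.
have -> : 4 * M / mu ^+ 2 * c T = (K * M) * 2 by rewrite /K; field; rewrite gt_eqF.
by rewrite -ler_pdivrMr.
Qed.

(** Before the last zero the solution goes down at least to its last critical
    point, where non-negativity of the energy forces a large amplitude. From
    there to [T] the combination [exp (mu t) (v - mu w)] increases, because [w
    <= 0]: this bounds the amplitude by the slope. *)
Let amplitude : exists2 m, (p * mu ^+ 2 / 4) `^ q^-1 <= m & mu * m <= slope * expR (mu * T).
Proof.
have cv t : 0 < t -> {for t, continuous v} by move=> t0; exact: der_cvg (dv t0).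
have [n n0 wn] := w_neg.
have nT : n <= T by rewrite leNgt; apply/negP => /w_pos; rewrite ltNge (ltW wn).
have cvitv (s t : R) : 0 < s -> {within `[s, t], continuous v}.
  move=> s0; apply: continuous_in_subspaceT => x; rewrite inE/= in_itv/= => /andP[sx _].
  by apply: cv; exact: lt_le_trans sx.
have v_ivt s : 0 < s -> s <= T -> v s <= 0 -> exists z, [/\ s <= z, z <= T & v z = 0].
  move=> s0 sT vs; have [|z] := @IVT R v s T 0 sT (cvitv s T s0).
    by rewrite ge_min vs/= le_max (ltW slope_gt0) orbT.
  by rewrite in_itv/= => /andP[sz zT] vz; exists z.
have [z [z0 zT vz]] : exists z, [/\ 0 < z, z <= T & v z = 0].
  apply: contrapT => nz.
  have vpos s : 0 < s -> s <= T -> 0 < v s.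
    move=> s0 sT; rewrite ltNge; apply/negP => vs.
    have [z [sz zT vz]] := v_ivt s s0 sT vs.
    by apply: nz; exists z; split => //; exact: lt_le_trans sz.
  have [d d0 hd] : exists2 d, 0 < d & forall t, 0 < t -> t < d -> `|w t| < `|w n|.
    by apply: w_0; rewrite normr_gt0 lt_eqF.
  pose s := Num.min (d / 2) n.
  have s0 : 0 < s by rewrite lt_min n0 divr_gt0.
  have sd : s < d by rewrite gt_min ltr_pdivrMr// ltr_pMr// ltr1n.
  have sn : s <= n by rewrite ge_min lexx orbT.
  have ws : w s <= w n.
    apply: (ge0_derive_le sn (fun x sx _ => dw (lt_le_trans s0 sx))) => x sx xn.
    by apply/ltW/vpos; [exact: lt_trans sx|exact: le_trans (ltW xn) nT].
  have := hd s s0 sd; rewrite !ltr0_norm//; last exact: le_lt_trans wn.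
  by rewrite ltrN2 ltNge ws.
have [s [s0 sT vs hs]] := last_root cv z0 zT vz.
have vpos t : s < t -> t <= T -> 0 < v t.
  move=> st tT; rewrite ltNge; apply/negP => vt.
  have t0 := lt_trans s0 st.
  have [y [ty yT vy]] := v_ivt t t0 tT vt.
  by have := hs y (lt_le_trans st ty) yT; rewrite vy eqxx.
have wmono x y : s <= x -> x <= y -> y <= T -> w x <= w y.
  move=> sx xy yT.
  apply: (ge0_derive_le xy (fun r xr _ => dw (lt_le_trans s0 (le_trans sx xr)))) => r xr ry.
  by apply/ltW/vpos; [exact: le_lt_trans xr|exact: le_trans (ltW ry) yT].
have w_le0 t : s <= t -> t <= T -> w t <= 0 by move=> st tT; rewrite -wT; exact: wmono.
have ws : w s < 0.
  rewrite lt_neqAle w_le0// andbT; apply/eqP => ws.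
  have [ns|sn] := leP n s.
    by move: wn; rewrite (no_double_zero ws vs n0 ns) ltxx.
  by move: wn; rewrite ltNge -ws wmono// ltW.
have w2 : 0 < w s ^+ 2 by rewrite exprn_even_gt0//= lt_eqF.
exists (- w s).
  have key : p * mu ^+ 2 / 4 <= `|w s| `^ q.
    rewrite -(ler_pM2r w2) -(ler_pM2l (_ : 0 < p^-1)) ?invr_gt0//.
    have -> : p^-1 * (p * mu ^+ 2 / 4 * w s ^+ 2) = mu ^+ 2 / 4 * w s ^+ 2 by field; rewrite gt_eqF.
    have := E_ge0 s0; rewrite /ef_energy vs expr0n mulr0 add0r normr_powRD2//.
    have : c s * w s ^+ 2 <= mu ^+ 2 / 4 * w s ^+ 2.
      by rewrite ler_wpM2r ?(ltW w2)//; exact: le_trans (c_le s0) eps1.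
    have : 0 <= mu ^+ 2 * w s ^+ 2 by rewrite mulr_ge0 ?ltW.
    move: (w s ^+ 2) w2 => A A0; move: (c s * A) (p^-1 * _) => B C; lra.
  have -> : - w s = (`|w s| `^ q) `^ q^-1.
    by rewrite -powRrM mulfV ?gt_eqF// powRr1// ltr0_norm.
  apply: ge0_ler_powR; rewrite ?invr_ge0 ?nnegrE ?powR_ge0 ?(ltW q0)//.
  by rewrite divr_ge0// mulr_ge0// ltW.
(* The growing mode of the linear part. *)
pose F y := expR (mu * y) * (v y - mu * w y).
have dF (y : R) : 0 < y -> is_derive y 1 F (expR (mu * y) * (- (c y + `|w y| `^ q) * w y)).
  move=> y0; have h1 := der_exp (derZ mu (der_id y)).
  apply: is_derive_eq (derM h1 (derB (dv y0) (derZ mu (dw y0)))) _.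
  by rewrite -/(c y); ring.
have Fle : F s <= F T.
  apply: (ge0_derive_le sT (fun y sy _ => dF y (lt_le_trans s0 sy))) => y sy yT.
  apply: mulr_ge0; first exact: expR_ge0.
  rewrite mulNr -mulrN; apply: mulr_ge0; last by rewrite oppr_ge0 w_le0// ltW.
  by apply: addr_ge0; [exact: ltW|exact: powR_ge0].
apply: (@le_trans _ _ (F T)); last by rewrite /F wT mulr0 subr0 mulrC.
apply: le_trans Fle; rewrite /F vs sub0r -mulrN ler_peMl//.
  by rewrite mulr_ge0 ?oppr_ge0 ?ltW.
by rewrite -expR0 ler_expR mulr_ge0// ltW.
Qed.

(** The factor [M] cancels between the lower and the upper bound, and [exp
    ((mu - 2) T) <= 1]. *)
Lemma ef_eps_large : mu ^+ 3 * (4^-1) `^ q^-1 / 4 <= eps.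
Proof.
have [m hm mm] := amplitude.
have mE : M * (4^-1) `^ q^-1 <= m.
  by apply: le_trans hm; rewrite /M -powRM// mulr_ge0// ltW.
have cT : c T * expR (mu * T) <= eps.
  rewrite /c -mulrA -expRD -[leRHS]mulr1; apply: ler_wpM2l; first exact: ltW.
  rewrite -[leRHS]expR0 ler_expR -mulrDl; apply: mulr_le0_ge0; last exact: ltW.
  by have := mu2; lra.
have h1 : mu * (M * (4^-1) `^ q^-1) <= 4 * M / mu ^+ 2 * eps.
  apply: (@le_trans _ _ (mu * m)); first by rewrite ler_wpM2l// ltW.
  apply: (le_trans mm); apply: (@le_trans _ _ (4 * M / mu ^+ 2 * c T * expR (mu * T))).
    by rewrite ler_wpM2r ?expR_ge0// slope_le.
  by rewrite -mulrA ler_wpM2l// divr_ge0 ?mulr_ge0// ltW.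
have k0 : 0 < mu ^+ 2 / (4 * M) by rewrite divr_gt0// mulr_gt0.
move: h1; rewrite -(ler_pM2l k0).
have -> : mu ^+ 2 / (4 * M) * (4 * M / mu ^+ 2 * eps) = eps.
  by field; rewrite !gt_eqF.
by apply: le_trans; rewrite le_eqVlt; apply/orP; left; apply/eqP; field; rewrite gt_eqF.
Qed.

End last_zero.

Lemma ef_last_zero (t1 t2 : R) : 0 < t1 -> w t1 < 0 -> 0 < t2 -> 0 < w t2 ->
  exists T, [/\ 0 < T, w T = 0 & (forall t, T < t -> 0 < w t) \/ (forall t, T < t -> w t < 0)].
Proof.
move=> t10 w1 t20 w2; have [T [T0 wT hT]] := last_zero t10 w1 t20 w2.
exists T; split => //.
have T1 : T < T + 1 by rewrite ltrDl.
have sgn s t : T < s -> T < t -> ~ (w s < 0 /\ 0 < w t).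
  move=> Ts Tt [ws wt]; have s0 := lt_trans T0 Ts; have t0 := lt_trans T0 Tt.
  have [st|ts] := leP s t.
    have [|z /andP[sz _] wz] := @ivt s t s0 st; first by rewrite (ltW ws) (ltW wt).
    by have := hT z (lt_le_trans Ts sz); rewrite wz eqxx.
  have [|z /andP[tz _] wz] := @ivt t s t0 (ltW ts); first by rewrite (ltW ws) (ltW wt) orbT.
  by have := hT z (lt_le_trans Tt tz); rewrite wz eqxx.
have := hT _ T1; rewrite neq_lt => /orP[wn|wp]; [right|left] => t Tt.
  have := hT t Tt; rewrite neq_lt => /orP[//|wt].
  by case: (sgn (T + 1) t).
have := hT t Tt; rewrite neq_lt => /orP[wt|//].
by case: (sgn t (T + 1)).
Qed.

End emden_fowler.

(** The equation is odd, so the sign after the last zero does not matter. *)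
Lemma emden_fowler_nonexistence (R : realType) (mu eps q : R) (w v : R -> R) :
  0 < mu -> mu <= 2 -> 0 < q -> 0 < eps -> eps <= mu ^+ 2 / 4 ->
  eps < mu ^+ 3 * (4^-1) `^ q^-1 / 4 ->
  (forall t : R, 0 < t -> is_derive t 1 w (v t)) ->
  (forall t : R, 0 < t ->
    is_derive t 1 v ((mu ^+ 2 - eps * expR (- 2 * t) - `|w t| `^ q) * w t)) ->
  (forall e : R, 0 < e -> exists T : R, forall t, 0 < t -> T < t -> `|w t| < e) ->
  (forall e : R, 0 < e -> exists2 d : R, 0 < d & forall t, 0 < t -> t < d -> `|w t| < e) ->
  (exists2 t, 0 < t & w t < 0) -> (exists2 t, 0 < t & 0 < w t) -> False.
Proof.
move=> mu0 mu2 q0 e0 e1 e2 dw dv woo w0 [t1 t10 w1] [t2 t20 w2].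
have [T [T0 wT [wp|wn]]] := ef_last_zero mu0 q0 e0 e1 dw dv woo t10 w1 t20 w2.
  have := ef_eps_large mu0 mu2 q0 e0 e1 dw dv woo w0 T0 wT wp (ex_intro2 _ _ t1 t10 w1).
  by rewrite leNgt e2.
have dw' (t : R) : 0 < t -> is_derive t 1 (fun t => - w t) (- v t).
  by move=> t0; apply: derN; exact: dw.
have dv' (t : R) : 0 < t -> is_derive t 1 (fun t => - v t)
    ((mu ^+ 2 - eps * expR (- 2 * t) - `|- w t| `^ q) * - w t).
  by move=> t0; apply: is_derive_eq (derN (dv t t0)) _; rewrite normrN mulrN.
have := @ef_eps_large R mu eps q (fun t => - w t) (fun t => - v t) mu0 mu2 q0 e0 e1 dw' dv'.
move=> /(_ _ _ T T0); rewrite leNgt e2 => h; apply: notF; apply: h.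
- by move=> e /woo[T' hT']; exists T' => t t0 Tt; rewrite normrN hT'.
- by move=> e /w0[d d0 hd]; exists d => // t t0 td; rewrite normrN hd.
- by rewrite wT oppr0.
- by move=> t Tt; rewrite oppr_gt0 wn.
- by exists t2 => //; rewrite oppr_lt0.
Qed.

(** * From the profile to the Emden-Fowler equation *)

(** The exponent [k] is the one for which the logarithmic variable removes the
    first-order term, and [q = 2 / k] makes the nonlinearity autonomous; the
    term in [eps] keeps the factor [exp (- 2 t)]. *)
Lemma emden_fowler_transform (R : realType) (m : nat) (gamma eps q mu : R) (f Phi : R -> R) :
  let k : R := m%:R / 2 in
  q * m%:R = 4 -> mu ^+ 2 = k ^+ 2 - gamma ->
  (forall s : R, 0 < s -> s < 1 -> is_derive s 1 f (- (Phi s / s ^+ m.+1))) ->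
  (forall s : R, 0 < s -> s < 1 -> is_derive s 1 Phi (source gamma eps q f s * s ^+ m.+1)) ->
  let w t := expR (- k * t) * f (expR (- t)) in
  exists v : R -> R,
    (forall t : R, 0 < t -> is_derive t 1 w (v t)) /\
    (forall t : R, 0 < t ->
      is_derive t 1 v ((mu ^+ 2 - eps * expR (- 2 * t) - `|w t| `^ q) * w t)).
Proof.
move=> k qm muE df dPhi w.
pose A t := expR (- k * t); pose s t : R := expR (- t).
have A0 t : 0 < A t by exact: expR_gt0.
have s0 t : 0 < s t by exact: expR_gt0.
have s1 t : 0 < t -> s t < 1.
  by move=> t0; rewrite /s -[ltRHS]expR0 ltr_expR oppr_lt0.
have As t : s t ^+ m = A t ^+ 2.
  by rewrite /s /A -!expRM_natl; congr expR; rewrite /k; field.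
have sA t : A t `^ q = s t ^+ 2.
  rewrite /s /A -expRM_natl -expRM; congr expR.
  have -> : - k * t * q = - (q * m%:R) / 2 * t by rewrite /k; field.
  by rewrite qm; field.
have dA (t : R) : is_derive t 1 A (- k * A t).
  by apply: is_derive_eq (der_exp (derZ (- k) (der_id t))) _; rewrite /A; ring.
have ds (t : R) : is_derive t 1 s (- s t).
  by apply: is_derive_eq (der_exp (derN (der_id t))) _; rewrite /s; ring.
pose v t := - k * w t + (A t)^-1 * Phi (s t).
have dw (t : R) : 0 < t -> is_derive t 1 w (v t).
  move=> t0; have h := der_comp (df _ (s0 t) (s1 t t0)) (ds t).
  apply: is_derive_eq (derM (dA t) h) _.
  rewrite /v /w -/(A t) -/(s t) exprS As; field.
  by rewrite !gt_eqF.
exists v; split; first exact: dw.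
move=> t t0.
have h := der_comp (dPhi _ (s0 t) (s1 t t0)) (ds t).
apply: is_derive_eq (derD (derZ (- k) (dw t t0)) (derM (derV (lt0r_neq0 (A0 t)) (dA t)) h)) _.
have -> : `|w t| `^ q = s t ^+ 2 * `|f (s t)| `^ q.
  by rewrite /w normrM powRM// gtr0_norm ?expR_gt0// -/(A t) sA.
have -> : expR (- 2 * t) = s t ^+ 2.
  by rewrite /s -expRM_natl; congr expR; ring.
have sm : s t ^+ m.+1 = s t * A t ^+ 2 by rewrite exprS As.
have wE : w t = A t * f (s t) by [].
have vE : v t = - k * w t + (A t)^-1 * Phi (s t) by [].
have gE : source gamma eps q f (s t) = gamma * f (s t) / s t ^+ 2 + eps * f (s t) +
  `|f (s t)| `^ q * f (s t) by [].
rewrite vE gE wE sm muE.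
move: (`|f (s t)| `^ q) (f (s t)) (Phi (s t)) (s t) (A t) (s0 t) (A0 t) => Q F P S B S0 B0.
by field; rewrite !gt_eqF.
Qed.

Lemma ball_null_ae (R : realType) N (P : 'rV[R]_N -> Prop) :
  lebesgue_rV R N (@unit_ball R N) = 0%E ->
  {ae lebesgue_rV R N, forall x, unit_ball x -> P x}.
Proof.
move=> B0; exists (@unit_ball R N); split => //; first exact: measurable_unit_ball.
by move=> x /= h; apply: contrapT => nB; apply: h.
Qed.

Lemma profile_sign (R : realType) N (u : 'rV[R]_N -> R) (f : R -> R) : (0 < N)%N ->
  {ae lebesgue_rV R N, forall x, unit_ball x -> u x = f (enorm x)} ->
  sign_changing u ->
  (exists s, [/\ 0 < s, s < 1 & f s < 0]) /\ (exists s, [/\ 0 < s, s < 1 & 0 < f s]).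
Proof.
move=> N0 uf [up un].
have nz := unit_ball_ae (P := fun x : 'rV[R]_N => x != 0) N0 (fun x h _ => h).
split; apply: contrapT => nf; [apply: un|apply: up]; apply: filterS2 uf nz => x h x0 Bx;
  have r0 : 0 < enorm x by rewrite enorm_gt0 x0.
  rewrite /funrneg h//; apply/max_r; rewrite oppr_le0 leNgt; apply/negP => fx.
  by apply: nf; exists (enorm x).
rewrite /funrpos h//; apply/max_r; rewrite leNgt; apply/negP => fx.
by apply: nf; exists (enorm x).
Qed.

Theorem theorem1p1 (R : realType) (N : nat) (gamma : R) :
  (3 <= N)%N ->
  (N%:R - 2) ^+ 2 / 4 - 4 <= gamma ->
  gamma < (N%:R - 2) ^+ 2 / 4 ->
  exists eps0 : R, 0 < eps0 /\
    forall eps : R, 0 < eps -> eps < eps0 ->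
      ~ exists u : 'rV[R]_N -> R,
          [/\ weak_solution gamma eps u, radial u & sign_changing u].
Proof.
move=> N3 g1 g2.
pose m := N.-2; have m0 : (0 < m)%N by rewrite /m; case: (N) N3 => [|[|[|n]]].
have NE : N = m.+2 by rewrite /m; case: (N) N3 => [|[|[|n]]].
have mE : N%:R - 2 = m%:R :> R by rewrite [in LHS]NE -addn2 natrD addrK.
rewrite mE in g1 g2.
have mr0 : 0 < m%:R :> R by rewrite ltr0n.
pose q : R := 4 / m%:R.
have qm : q * m%:R = 4 by rewrite divfK// gt_eqF.
have q0 : 0 < q by rewrite divr_gt0.
pose k : R := m%:R / 2.
have kE : k ^+ 2 = m%:R ^+ 2 / 4 by rewrite /k; field.
pose mu := Num.sqrt (k ^+ 2 - gamma).
have kg : 0 < k ^+ 2 - gamma by rewrite kE subr_gt0.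
have mu0 : 0 < mu by rewrite sqrtr_gt0.
have muE : mu ^+ 2 = k ^+ 2 - gamma by rewrite sqr_sqrtr// ltW.
have mu2 : mu <= 2.
  rewrite -(ler_sqr (_ : mu \is Num.nneg)) ?nnegrE ?(ltW mu0)// muE kE.
  by move: g1; rewrite -natrX/=; lra.
(* The first bound keeps [mu^2 - eps] comparable to [mu^2]; the second is
   what [ef_eps_large] contradicts. *)
exists (Num.min (mu ^+ 2 / 4) (mu ^+ 3 * (4^-1) `^ q^-1 / 4)); split.
  by rewrite lt_min !divr_gt0 ?mulr_gt0 ?exprn_gt0 ?powR_gt0 ?invr_gt0.
move=> eps eps0; rewrite lt_min => /andP[eps1 eps2] [u [[Du [hu cu]] ru su]].
have B0 : (0 < lebesgue_rV R N (@unit_ball R N))%E.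
  (* A sign-changing function does not live on a null set. *)
  rewrite lt_neqAle measure_ge0 andbT; apply/eqP => B0.
  by case: su => + _; apply; apply: ball_null_ae.
have [f [Phi [df dPhi uf f1 f0]]] := radial_solution_profile N3 qm B0 hu cu ru.
have [[s1 [s10 s11 fs1]] [s2 [s20 s21 fs2]]] := profile_sign (ltnW (ltnW N3)) uf su.
have N1E : N.-1 = m.+1 by rewrite NE.
rewrite N1E in df dPhi.
have [v [dw dv]] := emden_fowler_transform qm muE df dPhi.
set w := fun t => expR _ * _ in dw dv.
have expln (s : R) : 0 < s -> s < 1 -> 0 < - ln s /\ expR (- - ln s) = s.
  by move=> s0 s_1; rewrite opprK lnK ?posrE// oppr_gt0 ln_lt0// s0.
apply: (emden_fowler_nonexistence mu0 mu2 q0 eps0 (ltW eps1) eps2 dw dv).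
- move=> e e0; have [d d0 hd] := f0 _ (exprn_gt0 2 e0).
  exists (- ln d) => t t0 dt.
  have sd : expR (- t) < d by rewrite -[ltRHS]lnK ?posrE// ltr_expR -ltrNl.
  have s_1 : expR (- t) < 1 by rewrite -[ltRHS]expR0 ltr_expR oppr_lt0.
  have := hd _ (expR_gt0 _) sd s_1.
  rewrite -(ltr_sqr (_ : `|w t| \is Num.nneg)) ?nnegrE ?(ltW e0)// real_normK ?num_real//.
  apply: le_lt_trans; rewrite /w exprMn -/m -!expRM_natl.
  by rewrite le_eqVlt; apply/orP; left; apply/eqP; congr (expR _ * _); rewrite /k; field.
- move=> e e0; have [d d1 hd] := f1 _ (exprn_gt0 2 e0).
  exists (1 - d); first by rewrite subr_gt0.
  move=> t t0 td.
  have s_1 : expR (- t) < 1 by rewrite -[ltRHS]expR0 ltr_expR oppr_lt0.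
  have ds : d < expR (- t).
    by apply: lt_le_trans (expR_ge1Dx (- t)); move: td; lra.
  have := hd _ (expR_gt0 _) ds s_1.
  rewrite -(ltr_sqr (_ : `|w t| \is Num.nneg)) ?nnegrE ?(ltW e0)// real_normK ?num_real//.
  apply: le_lt_trans; rewrite /w exprMn ler_piMl ?sqr_ge0// exprn_ile1 ?expR_ge0//.
  by rewrite -expR0 ler_expR mulNr oppr_le0 mulr_ge0 ?(ltW t0)// divr_ge0// ltW.
- have [t0 tE] := expln s1 s10 s11; exists (- ln s1) => //.
  by rewrite /w tE pmulr_rlt0// expR_gt0.
- have [t0 tE] := expln s2 s20 s21; exists (- ln s2) => //.
  by rewrite /w tE mulr_gt0// expR_gt0.
Qed.
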